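(* Let $q\geq 1$ be an integer and let $p$ be a real number with $p>2q-1$. Let $X\in C_q$. Then the support of the measure $f\mapsto \mathcal{A}^*(f)(X)$ on $C_q$ is exactly $C(X)$.
   Context: Let $\mathbf F\in\{\mathbf R,\mathbf C,\mathbf H\}$ and $d=\dim_{\mathbf R}\mathbf F\in\{1,2,4\}$. $C_q$ is the space of real diagonal matrices $X=\mathrm{diag}[x_1,\dots,x_q]$, identified with $\mathbf R^q$. The Weyl group $W$ acts on $C_q$ by permuting the $x_i$ and changing any number of their signs; $C(X)$ is the convex hull of the orbit $W\cdot X$. $B_q=\{w\in M_q(\mathbf F): I-w^*w>0\}$ (positive definite), $dw$ is Lebesgue measure on $M_q(\mathbf F)\cong\mathbf R^{dq^2}$, and for $X\in C_q$, $w\in \overline{B_q}$, $Z(X,w)=\cosh X+\sinh X\,w$. The probability density $m_p$ on $B_q$ is $m_p(w)=\frac{1}{\kappa^{pd/2}}\det(I-w^*w)^{pd/2-d(q-1/2)-1}$ with $\kappa^{pd/2}=\int_{B_q}\det(I-w^*w)^{pd/2-d(q-1/2)-1}\,dw$. For $\mathbf F=\mathbf H$, the determinant of a Hermitian matrix is the product of its $q$ real eigenvalues, and for all $\mathbf F$, $|\det g|=\det(g^*g)^{1/2}$. $GL_0(q,\mathbf F)$ is the identity component of the group of invertible $q\times q$ matrices over $\mathbf F$, and $\mathbf U(q,\mathbf F)$ is its maximal compact subgroup ($SO(q)$, $U(q)$, $Sp(q)$) with normalized Haar measure $dk$. For $g\in GL_0(q,\mathbf F)$, $H^A(g)$ is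 the real diagonal matrix in the Iwasawa decomposition $g=k\,e^{H^A(g)}\,n$ with $k\in\mathbf U(q,\mathbf F)$ and $n$ upper triangular unipotent. With $\rho^A(H)=\sum_{i=1}^q\frac d2(q+1-2i)h_i$ for $H=\mathrm{diag}[h_1,\dots,h_q]$, the dual Abel transform of type $A$ is $$(\mathcal A^A)^*(f)(g)=\int_{\mathbf U(q,\mathbf F)} f(H^A(gk))\,e^{-\rho^A(H^A(gk))}\,dk,$$ and the dual of the (generalized) Abel transform of type $BC$ is $$\mathcal A^*(f)(X)=\int_{B_q}(\mathcal A^A)^*(f)(Z(X,w))\,|\det Z(X,w)|^{-d(p+1)/2+1}\,m_p(w)\,dw .$$ *)

(* Defs.v *)
From HB Require Import structures.
From mathcomp Require Import all_boot all_order all_algebra all_fingroup.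
From mathcomp Require Import complex ring.
From mathcomp Require Import all_classical all_reals all_analysis.

Set Implicit Arguments.
Unset Strict Implicit.
Unset Printing Implicit Defensive.
Import Order.TTheory GRing.Theory Num.Theory.
Import numFieldNormedType.Exports.

Local Open Scope classical_set_scope.
Local Open Scope ring_scope.

Record quaternion (R : Type) : Type :=
  Quaternion { qre : R; qi : R; qj : R; qk : R }.

Section QuaternionRing.
Variable R : comNzRingType.
Local Notation H := (quaternion R).

Definition quat_tuple (x : H) : R * R * R * R := (qre x, qi x, qj x, qk x).
Definition tuple_quat (t : R * R * R * R) : H :=
  let: (a, b, c, d) := t in Quaternion a b c d.
Lemma quat_tupleK : cancel quat_tuple tuple_quat. Proof. by case. Qed.
HB.instance Definition _ := Choice.copy H (can_type quat_tupleK).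

Definition addq (x y : H) : H :=
  Quaternion (qre x + qre y) (qi x + qi y) (qj x + qj y) (qk x + qk y).
Definition oppq (x : H) : H :=
  Quaternion (- qre x) (- qi x) (- qj x) (- qk x).
Definition mulq (x y : H) : H :=
  let: Quaternion a b c d := x in let: Quaternion a' b' c' d' := y in
  Quaternion (a * a' - b * b' - c * c' - d * d')
             (a * b' + b * a' + c * d' - d * c')
             (a * c' - b * d' + c * a' + d * b')
             (a * d' + b * c' - c * b' + d * a').
Definition conjq (x : H) : H :=
  Quaternion (qre x) (- qi x) (- qj x) (- qk x).

Lemma addqA : associative addq.
Proof. by move=> [????] [????] [????]; rewrite /addq /= !addrA. Qed.
Lemma addqC : commutative addq.
Proof. by move=> [????] [????]; congr Quaternion => /=; rewrite addrC. Qed.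
Lemma add0q : left_id (Quaternion 0 0 0 0) addq.
Proof. by move=> [????]; rewrite /addq /= !add0r. Qed.
Lemma addNq : left_inverse (Quaternion 0 0 0 0) oppq addq.
Proof. by move=> [????]; rewrite /addq /= !addNr. Qed.
HB.instance Definition _ := GRing.isZmodule.Build H addqA addqC add0q addNq.

Lemma mulqA : associative mulq.
Proof. by move=> [????] [????] [????] /=; congr Quaternion; ring. Qed.
Lemma mul1q : left_id (Quaternion 1 0 0 0) mulq.
Proof. by move=> [????] /=; congr Quaternion; ring. Qed.
Lemma mulq1 : right_id (Quaternion 1 0 0 0) mulq.
Proof. by move=> [????] /=; congr Quaternion; ring. Qed.
Lemma mulqDl : left_distributive mulq addq.
Proof. by move=> [????] [????] [????] /=; congr Quaternion => /=; ring. Qed.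
Lemma mulqDr : right_distributive mulq addq.
Proof. by move=> [????] [????] [????] /=; congr Quaternion => /=; ring. Qed.
Lemma oneq_neq0 : Quaternion 1 0 0 0 != Quaternion 0 0 0 0 :> H.
Proof. by apply/eqP => -[/eqP]; rewrite oner_eq0. Qed.
HB.instance Definition _ := GRing.Zmodule_isNzRing.Build H
  mulqA mul1q mulq1 mulqDl mulqDr oneq_neq0.

End QuaternionRing.

Variant scalar_kind := Reals | Complexes | Quaternions.

Section Scalars.
Variable R : realType.
Implicit Type F : scalar_kind.

Definition scalar F : nzRingType :=
  match F with Reals => R | Complexes => R[i] | Quaternions => quaternion R end.

Definition sdim F : nat :=
  match F with Reals => 1 | Complexes => 2 | Quaternions => 4 end.

(* c 0, ..., c (d - 1) are the real coordinates; further values are ignored. *)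
Definition of_coords F (c : nat -> R) : scalar F :=
  match F return scalar F with
  | Reals => c 0%N
  | Complexes => Complex (c 0%N) (c 1%N)
  | Quaternions => Quaternion (c 0%N) (c 1%N) (c 2%N) (c 3%N)
  end.

Definition of_real F (a : R) : scalar F :=
  of_coords F (fun k => if k is 0%N then a else 0).

Definition sconj F : scalar F -> scalar F :=
  match F return scalar F -> scalar F with
  | Reals => id
  | Complexes => @conjc R
  | Quaternions => @conjq R
  end.

Definition sre F : scalar F -> R :=
  match F return scalar F -> R with
  | Reals => id
  | Complexes => @complex.Re R
  | Quaternions => @qre R
  end.

Variable F : scalar_kind.
Local Notation d := (sdim F).

Definition adjmx m n (A : 'M[scalar F]_(m, n)) : 'M[scalar F]_(n, m) :=
  map_mx (@sconj F) A^T.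

Definition real_diag q (h : 'rV[R]_q) : 'M[scalar F]_q :=
  diag_mx (map_mx (of_real F) h).

(* For Hermitian A, the scalar v^* A v is real. *)
Definition posdefmx q (A : 'M[scalar F]_q) : Prop :=
  adjmx A = A /\
  forall v : 'cV[scalar F]_q, v != 0 -> 0 < sre ((adjmx v *m A *m v) 0 0).

Definition unitary_mx q (k : 'M[scalar F]_q) : Prop := adjmx k *m k = 1%:M.

(* For F = R this is SO(q), the maximal compact subgroup of the identity
   component of GL(q, R), not O(q). *)
Definition Ugroup q : set 'M[scalar F]_q :=
  [set k | unitary_mx k /\
    match F return 'M[scalar F]_q -> Prop with
    | Reals => fun k => \det (k : 'M[R]_q) = 1
    | _ => fun _ => True
    end k].

End Scalars.

Section HermitianDet.
Variable R : realType.

(* Determinant of a Hermitian matrix.  In the quaternionic case, it is the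
   product of the q real eigenvalues (with multiplicity) read off from any
   unitary diagonalization. *)
Definition hermdet (F : scalar_kind) q : 'M[scalar R F]_q -> R :=
  match F return 'M[scalar R F]_q -> R with
  | Reals => fun A => \det (A : 'M[R]_q)
  | Complexes => fun A => complex.Re (\det (A : 'M[R[i]]_q))
  | Quaternions => fun A =>
      xget 0 [set x | exists (u : 'M[scalar R Quaternions]_q) (l : 'rV[R]_q),
        [/\ unitary_mx u,
            A = u *m real_diag Quaternions l *m adjmx u &
            x = \prod_i l 0 i]]
  end.

Definition absdet (F : scalar_kind) q (g : 'M[scalar R F]_q) : R :=
  Num.sqrt (hermdet (adjmx g *m g)).

End HermitianDet.

(* The library's own sigma-finiteness instance for m1 \x m2 is shadowed by the
   one for subprobabilities. *)
Lemma product_sigma_finite d1 d2 (T1 : measurableType d1)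
    (T2 : measurableType d2) (R : realType)
    (m1 : {sigma_finite_measure set T1 -> \bar R})
    (m2 : {sigma_finite_measure set T2 -> \bar R}) :
  sigma_finite setT (m1 \x m2)%E.
Proof.
have /sigma_finiteP[F [TF ndF Foo]] := sigma_finiteT m1.
have /sigma_finiteP[G [TG ndG Goo]] := sigma_finiteT m2.
exists (fun n => F n `*` G n).
  rewrite -setXTT TF TG predeqE => -[x y]; split.
    move=> [/= [n _ Fnx] [k _ Gky]]; exists (maxn n k) => //; split.
    - by move: x Fnx; exact/subsetPset/ndF/leq_maxl.
    - by move: y Gky; exact/subsetPset/ndG/leq_maxr.
  by move=> [n _ []/= ? ?]; split; exists n.
move=> k; have [? ?] := Foo k; have [? ?] := Goo k.
split; first exact: measurableX.
by rewrite product_measure1E// lte_mul_pinfty// ge0_fin_numE.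
Qed.

Section LebesgueTuple.
Variable R : realType.
Local Notation RR := (measurableTypeR R).

Definition cons_pair n (x : RR * n.-tuple RR) : n.+1.-tuple RR :=
  [tuple of x.1 :: x.2].

Lemma measurable_cons_pair n : measurable_fun setT (@cons_pair n).
Proof. exact: measurable_cons. Qed.

Lemma measurable_thead n :
  measurable_fun setT (fun t : n.+1.-tuple RR => thead t).
Proof. exact: measurable_tnth. Qed.

Section Step.
Variables (n : nat) (mu : {sigma_finite_measure set (n.-tuple RR) -> \bar R}).

Definition lebesgue_cons : set (n.+1.-tuple RR) -> \bar R :=
  pushforward (@lebesgue_measure R \x mu)%E (@cons_pair n).

Let lebesgue_cons0 : lebesgue_cons set0 = 0%E.
Proof. by rewrite /lebesgue_cons /pushforward preimage_set0 measure0. Qed.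

Let lebesgue_cons_ge0 A : (0 <= lebesgue_cons A)%E.
Proof. by rewrite /lebesgue_cons /pushforward; exact: measure_ge0. Qed.

Let lebesgue_cons_sigma_additive : semi_sigma_additive lebesgue_cons.
Proof.
move=> G mG tG mUG; rewrite /lebesgue_cons /pushforward preimage_bigcup.
have mpre A : measurable A -> measurable (@cons_pair n @^-1` A).
  by move=> mA; rewrite -[X in measurable X]setTI; exact: measurable_cons_pair.
apply: measure_semi_sigma_additive.
- by move=> i; exact: mpre.
- apply/trivIsetP => /= i j _ _ ij; rewrite -preimage_setI.
  by move/trivIsetP : tG => /(_ _ _ _ _ ij) ->//; rewrite preimage_set0.
- by rewrite -preimage_bigcup; exact: mpre.
Qed.

HB.instance Definition _ := isMeasure.Build _ _ _ lebesgue_cons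
  lebesgue_cons0 lebesgue_cons_ge0 lebesgue_cons_sigma_additive.

Let lebesgue_cons_sigma_finite : sigma_finite setT lebesgue_cons.
Proof.
have [G GT Gfin] : sigma_finite setT (@lebesgue_measure R \x mu)%E.
  exact: product_sigma_finite.
pose g (t : n.+1.-tuple RR) := (thead t, [tuple of behead t]).
have gK : cancel (@cons_pair n) g.
  case=> a t; rewrite /g /cons_pair /= theadE; congr (_, _).
  exact/val_inj.
have mg : measurable_fun setT g.
  apply/measurable_fun_pairP; split => //=.
    exact: measurable_thead.
  exact: measurable_behead.
exists (fun i => g @^-1` G i).
  by rewrite -preimage_bigcup -GT preimage_setT.
move=> i; have [mGi Gi] := Gfin i; split.
  by rewrite -[X in measurable X]setTI; exact: mg.
rewrite /lebesgue_cons /pushforward -comp_preimage.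
by rewrite (_ : g \o _ = id)//; apply/funext => x /=; rewrite gK.
Qed.

HB.instance Definition _ := Measure_isSigmaFinite.Build _ _ _ lebesgue_cons
  lebesgue_cons_sigma_finite.

Definition lebesgue_step :
  {sigma_finite_measure set (n.+1.-tuple RR) -> \bar R} := lebesgue_cons.

End Step.

Definition lebesgue_tuple0 : {sigma_finite_measure set (0.-tuple RR) -> \bar R} :=
  \d_([tuple] : 0.-tuple RR).

Fixpoint lebesgue_tuple n : {sigma_finite_measure set (n.-tuple RR) -> \bar R} :=
  match n with
  | 0 => lebesgue_tuple0
  | n.+1 => lebesgue_step (lebesgue_tuple n)
  end.

End LebesgueTuple.

Section MatrixSpace.
Variables (R : realType) (F : scalar_kind) (q : nat).
Local Notation RR := (measurableTypeR R).

(* The identification of R^(d q^2) with M_q(F), entry after entry. *)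
Definition mx_of_tuple (t : (q * q * sdim F).-tuple RR) : 'M[scalar R F]_q :=
  \matrix_(i, j) of_coords F
    (fun k => nth (0 : R) t ((i * q + j) * sdim F + k)).

Definition mxF : Type := 'M[scalar R F]_q.
HB.instance Definition _ := Choice.on mxF.
HB.instance Definition _ := isPointed.Build mxF 0.

(* The Borel sigma-algebra of M_q(F), transported from R^(d q^2) along the
   bijection mx_of_tuple. *)
Definition mxF_measurable : set (set mxF) :=
  [set A | measurable (mx_of_tuple @^-1` A)].

Let mxF_measurable0 : mxF_measurable set0.
Proof. by rewrite /mxF_measurable /= preimage_set0. Qed.

Let mxF_measurableC A : mxF_measurable A -> mxF_measurable (~` A).
Proof.
by rewrite /mxF_measurable /= preimage_setC; exact: measurableC.
Qed.

Let mxF_measurable_bigcup (G : (set mxF)^nat) :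
  (forall i, mxF_measurable (G i)) -> mxF_measurable (\bigcup_i G i).
Proof.
by move=> mG; rewrite /mxF_measurable /= preimage_bigcup; exact: bigcupT_measurable.
Qed.

Fact mxF_display : measure_display.
Proof. exact: default_measure_display. Qed.

HB.instance Definition _ := @isMeasurable.Build mxF_display mxF
  mxF_measurable mxF_measurable0 mxF_measurableC mxF_measurable_bigcup.

Lemma measurable_mx_of_tuple :
  measurable_fun setT (mx_of_tuple : (q * q * sdim F).-tuple RR -> mxF).
Proof. by move=> _ A mA; rewrite setTI. Qed.

Definition lebesgue_mx : set mxF -> \bar R :=
  pushforward (lebesgue_tuple R (q * q * sdim F))
              (mx_of_tuple : (q * q * sdim F).-tuple RR -> mxF).

Let lebesgue_mx0 : lebesgue_mx set0 = 0%E.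
Proof. by rewrite /lebesgue_mx /pushforward preimage_set0 measure0. Qed.

Let lebesgue_mx_ge0 A : (0 <= lebesgue_mx A)%E.
Proof. by rewrite /lebesgue_mx /pushforward; exact: measure_ge0. Qed.

Let lebesgue_mx_sigma_additive : semi_sigma_additive lebesgue_mx.
Proof.
move=> G mG tG mUG; rewrite /lebesgue_mx /pushforward preimage_bigcup.
apply: measure_semi_sigma_additive.
- by move=> i; exact: mG.
- apply/trivIsetP => /= i j _ _ ij; rewrite -preimage_setI.
  by move/trivIsetP : tG => /(_ _ _ _ _ ij) ->//; rewrite preimage_set0.
- by rewrite -preimage_bigcup.
Qed.

HB.instance Definition _ := isMeasure.Build _ _ _ lebesgue_mx
  lebesgue_mx0 lebesgue_mx_ge0 lebesgue_mx_sigma_additive.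

End MatrixSpace.

(* The normalized Haar measure of U(q, F), as a Borel probability on M_q(F)
   carried by U(q, F). *)
Definition normalized_haar (R : realType) (F : scalar_kind) (q : nat)
    (mu : probability (mxF R F q) R) : Prop :=
  mu (@Ugroup R F q) = 1%E /\
  forall (k : 'M[scalar R F]_q) (A : set (mxF R F q)), @Ugroup R F q k ->
    measurable A -> mu [set k *m g | g in A] = mu A.

(* The space C_q of real diagonal matrices is represented by 'rV[R]_q. *)

Section AbelTransforms.
Variables (R : realType) (F : scalar_kind) (q : nat).
Local Notation d := ((sdim F)%:R : R).
Local Notation qR := (q%:R : R).

Definition cosh (x : R) : R := (expR x + expR (- x)) / 2.
Definition sinh (x : R) : R := (expR x - expR (- x)) / 2.

Definition ball_mx : set (mxF R F q) :=
  [set w | posdefmx (1%:M - adjmx w *m w)].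

Definition Zmx (X : 'rV[R]_q) (w : mxF R F q) : mxF R F q :=
  real_diag F (map_mx cosh X) + real_diag F (map_mx sinh X) *m w.

Definition m_exponent (p : R) : R := p * d / 2 - d * (qR - 1 / 2) - 1.

Definition kappa (p : R) : R :=
  \int[@lebesgue_mx R F q]_(w in ball_mx)
    hermdet (1%:M - adjmx w *m w) `^ m_exponent p.

Definition m_density (p : R) (w : mxF R F q) : R :=
  (kappa p)^-1 * hermdet (1%:M - adjmx w *m w) `^ m_exponent p.

Definition upper_unipotent (n : 'M[scalar R F]_q) : Prop :=
  (forall i, n i i = 1) /\ (forall i j : 'I_q, (j < i)%N -> n i j = 0).

(* Iwasawa projection; the value is only meaningful on GL_0(q, F), where the
   decomposition exists and is unique. *)
Definition HA (g : 'M[scalar R F]_q) : 'rV[R]_q :=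
  xget 0 [set h | exists k n : 'M[scalar R F]_q,
    [/\ Ugroup k, upper_unipotent n &
        g = k *m real_diag F (map_mx expR h) *m n]].

(* Indices start at 0, whence q + 1 - 2 (i + 1). *)
Definition rhoA (h : 'rV[R]_q) : R :=
  \sum_(i < q) d / 2 * (qR + 1 - 2 * (i.+1)%:R) * h 0 i.

Definition abelA_dual (dk : probability (mxF R F q) R)
    (f : 'rV[R]_q -> R) (g : 'M[scalar R F]_q) : R :=
  \int[dk]_(k in @Ugroup R F q)
    (f (HA (g *m k)) * expR (- rhoA (HA (g *m k)))).

Definition abel_dual (dk : probability (mxF R F q) R) (p : R)
    (f : 'rV[R]_q -> R) (X : 'rV[R]_q) : R :=
  \int[@lebesgue_mx R F q]_(w in ball_mx)
    (abelA_dual dk f (Zmx X w) *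
     absdet (Zmx X w) `^ (- (d * (p + 1) / 2) + 1) * m_density p w).

Definition weyl_orbit (X : 'rV[R]_q) : set 'rV[R]_q :=
  [set Y | exists (s : 'S_q) (e : 'I_q -> bool),
     Y = \row_i ((-1) ^+ e i * X 0 (s i))].

Definition weyl_hull (X : 'rV[R]_q) : set 'rV[R]_q :=
  smallest (@convex_set R 'rV[R]_q) (weyl_orbit X).

End AbelTransforms.

Section Support.
Variables (R : realType) (V : topologicalType).

Definition fun_support (f : V -> R) : set V := closure [set x | f x != 0].

Definition Cc : set (V -> R) :=
  [set f | continuous f /\ compact (fun_support f)].

(* A Radon measure is given by its linear form T on C_c(V); its support is the
   complement of the union of the open sets on which it vanishes. *)
Definition radon_support (T : (V -> R) -> R) : set V :=
  ~` \bigcup_(O in [set O | open O /\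
        forall f, Cc f -> fun_support f `<=` O -> T f = 0]) O.

End Support.

(* Main.v *)
Require Import Defs.
From mathcomp Require Import all_boot all_order all_algebra all_fingroup.
From mathcomp Require Import complex ring lra zify.
From mathcomp Require Import all_classical all_reals all_analysis measurable_realfun.

(** The measure f |-> A^*(f)(X) is an average, with a positive weight, of the values of
    f e^(- rho) at the points HA (Z(X, w) k) for w in the ball B_q and k in U(q).  Hence
    its support is the closure of the set of these points, and two facts are needed.

    All these points lie in the hull C(X).  A theorem of Hardy-Littlewood-Polya type
    ([weyl_hull_wmaj]) describes C(X) by inequalities: every signed sum of r coordinates
    of h is at most the sum of the r largest |x_i|.  To prove them for the Iwasawa
    exponents, let T be the triangular factor of Z(X, w) k.  A form on pairs of vectors
    ([hform]) restricts to twice |Z(X, w) v|^2 on the diagonal.  In a suitable order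
    of the basis, e^(2 h_i) and e^(- 2 h_i) are lower bounds of its pivots, while the
    expansion factors e^(2|x_i|) bound it from above because w is a contraction.
    Comparing determinants of a compression to r basis vectors ([prod_pivot_le]) gives
    the inequality ([Zmx_wmaj]).

    Conversely every point of C(X) is attained for some w in the closed ball
    ([weyl_hull_attained]).  The point X is attained at w = 1.  The set of attained points
    is stable under transfers between neighbouring coordinates, by rotations of k in a
    coordinate plane ([attained_adj]), and under shrinking the last coordinate, by a
    change of w of rank one ([attained_last]).  These moves suffice to
    reach all of C(X) from X ([wmaj_in_closed]).

    It remains to pass from attained points to the support.  The exponents depend
    continuously on the matrix, being given by extremal problems ([iwasawa_near]), and w
    may be moved into the open ball.  Hence a bump at a point of C(X) has a transform
    that is bounded below for w in a small ball, since balls centred in U(q) have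
    positive Haar measure ([haar_ball_gt0]).  The transform is then positive as soon as
    the weight is integrable, that is if the power of det (1 - w^* w) in the density,
    whose exponent exceeds - 1, has a finite integral ([hermdet_powR_integral]).  The
    determinant is the product of the pivots of 1 - w^* w, and shrinking the columns
    of w one at a time shows that small values of each pivot are rare
    ([integral_low]).

    Over the quaternions, the determinant of the underlying real map replaces the
    determinant ([detR]), and the Hermitian determinant is recovered from the Cholesky
    factor by the spectral theorem ([hermdet_gram]). *)

Import Order.TTheory GRing.Theory Num.Theory.
Import numFieldNormedType.Exports.
Set Implicit Arguments.
Unset Strict Implicit.
Unset Printing Implicit Defensive.
Local Open Scope classical_set_scope.
Local Open Scope ring_scope.

(** * Real, complex and quaternionic scalars *)

Section ScalarTheory.
Variables (R : realType) (F : scalar_kind).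
Local Notation K := (Defs.scalar R F).
Implicit Types (x y z : K) (a b : R).

Lemma sconjD x y : sconj (x + y) = sconj x + sconj y.
Proof.
case: F x y => [|[a b] [c e]|[????] [????]] //=.
- by apply/eqP; rewrite eq_complex /= opprD !eqxx.
- by congr Quaternion => /=; rewrite opprD.
Qed.

Lemma sconjM x y : sconj (x * y) = sconj y * sconj x.
Proof.
case: F x y => [|[a b] [c e]|[????] [????]] /=.
- by move=> x y; rewrite mulrC.
- by apply/eqP; rewrite eq_complex /=; apply/andP; split; apply/eqP; ring.
- by congr Quaternion => /=; ring.
Qed.

Lemma sconjK x : sconj (sconj x) = x.
Proof.
case: F x => [|[a b]|[????]] //=; first by rewrite opprK.
by rewrite /conjq /= !opprK.
Qed.

Lemma of_realD a b : of_real F (a + b) = of_real F a + of_real F b.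
Proof.
case: F => //=.
- by apply/eqP; rewrite eq_complex /= addr0 !eqxx.
- by congr Quaternion => /=; rewrite addr0.
Qed.

Lemma of_realM a b : of_real F (a * b) = of_real F a * of_real F b.
Proof.
case: F => //=.
- by apply/eqP; rewrite eq_complex /=; apply/andP; split; apply/eqP; ring.
- by congr Quaternion => /=; ring.
Qed.

Lemma of_real1 : of_real F (1 : R) = 1.
Proof. by case: F. Qed.

Lemma of_realC a x : of_real F a * x = x * of_real F a.
Proof.
case: F x => [|[c e]|[????]] /=.
- by move=> x; rewrite mulrC.
- by apply/eqP; rewrite eq_complex /=; apply/andP; split; apply/eqP; ring.
- by congr Quaternion => /=; ring.
Qed.

Lemma sconj_real a : sconj (of_real F a) = of_real F a.
Proof. by case: F => //=; rewrite /conjq ?oppr0. Qed.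

Lemma sreD x y : sre (x + y) = sre x + sre y.
Proof. by case: F x y => [|[a b] [c e]|[????] [????]]. Qed.

Lemma sre_conj x : sre (sconj x) = sre x.
Proof. by case: F x => [|[a b]|[????]]. Qed.

Lemma sre_real a : sre (of_real F a) = a.
Proof. by case: F. Qed.

(** Scalars need not commute, but the real part is a trace. *)
Lemma sreC x y : sre (x * y) = sre (y * x).
Proof. by case: F x y => [|[a b] [c e]|[????] [????]] /= *; ring. Qed.

Lemma sreZ a x : sre (of_real F a * x) = a * sre x.
Proof. by case: F x => [|[c e]|[????]] //=; ring. Qed.

(** The squared absolute value. *)
Definition nsq x : R := sre (sconj x * x).

Lemma nsq_ge0 x : 0 <= nsq x.
Proof. by rewrite /nsq; case: F x => [|[a b]|[????]] /= *; nra. Qed.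

Lemma sconj_mul x : sconj x * x = of_real F (nsq x).
Proof.
rewrite /nsq; case: F x => [|[a b]|[????]] //=.
- by apply/eqP; rewrite eq_complex /=; apply/andP; split; apply/eqP; ring.
- by congr Quaternion => /=; ring.
Qed.

Lemma nsq_conj x : nsq (sconj x) = nsq x.
Proof. by rewrite /nsq sconjK sreC. Qed.

Lemma mul_sconj x : x * sconj x = of_real F (nsq x).
Proof. by rewrite -{1}(sconjK x) sconj_mul nsq_conj. Qed.

Lemma nsq0_eq0 x : nsq x = 0 -> x = 0.
Proof.
rewrite /nsq; case: F x => [|[a b]|[a b c e]] /= => [x|H|H].
- by move/eqP; rewrite mulf_eq0 orbb => /eqP.
- have [-> ->] : a = 0 /\ b = 0 by split; nra.
  by [].
- have [-> -> -> ->] : [/\ a = 0, b = 0, c = 0 & e = 0] by split; nra.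
  by [].
Qed.

Lemma sconj0 : sconj (0 : K) = 0.
Proof. by apply: (@addIr _ (sconj (0 : K))); rewrite -sconjD !add0r. Qed.
Lemma sconjN x : sconj (- x) = - sconj x.
Proof. by apply: (@addIr _ (sconj x)); rewrite -sconjD !addNr sconj0. Qed.
Lemma sconj1 : sconj (1 : K) = 1.
Proof. by rewrite -of_real1 sconj_real. Qed.
Lemma of_real0 : of_real F (0 : R) = 0.
Proof. by apply: (@addIr _ (of_real F (0 : R))); rewrite -of_realD !add0r. Qed.
Lemma of_realN a : of_real F (- a) = - of_real F a.
Proof. by apply: (@addIr _ (of_real F a)); rewrite -of_realD !addNr of_real0. Qed.
Lemma sre0 : sre (0 : K) = 0.
Proof. by rewrite -of_real0 sre_real. Qed.
Lemma sreN x : sre (- x) = - sre x.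
Proof. by apply: (@addIr _ (sre x)); rewrite -sreD !addNr sre0. Qed.

Lemma nsq_real a : nsq (of_real F a) = a ^+ 2.
Proof. by rewrite /nsq sconj_real sreZ sre_real. Qed.

Lemma nsqM x y : nsq (x * y) = nsq x * nsq y.
Proof.
by rewrite {1}/nsq sconjM mulrA -(mulrA (sconj y)) sconj_mul -of_realC -mulrA sreZ.
Qed.

Lemma nsq0 : nsq (0 : K) = 0.
Proof. by rewrite -of_real0 nsq_real expr0n. Qed.
Lemma nsq1 : nsq (1 : K) = 1.
Proof. by rewrite -of_real1 nsq_real expr1n. Qed.
Lemma nsqN x : nsq (- x) = nsq x.
Proof. by rewrite /nsq sconjN mulrNN. Qed.

Lemma nsqD x y : nsq (x + y) = nsq x + nsq y + 2 * sre (sconj x * y).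
Proof.
rewrite /nsq sconjD mulrDl !mulrDr !sreD.
have -> : sre (sconj y * x) = sre (sconj x * y).
  by rewrite -sre_conj sconjM sconjK.
by ring.
Qed.

Lemma sconj_sum I (r : seq I) (P : pred I) (f : I -> K) :
  sconj (\sum_(i <- r | P i) f i) = \sum_(i <- r | P i) sconj (f i).
Proof. by apply: (big_morph _ sconjD sconj0). Qed.
Lemma sre_sum I (r : seq I) (P : pred I) (f : I -> K) :
  sre (\sum_(i <- r | P i) f i) = \sum_(i <- r | P i) sre (f i).
Proof. by apply: (big_morph _ sreD sre0). Qed.
Lemma of_real_sum I (r : seq I) (P : pred I) (f : I -> R) :
  of_real F (\sum_(i <- r | P i) f i) = \sum_(i <- r | P i) of_real F (f i).
Proof. by apply: (big_morph _ of_realD of_real0). Qed.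

Lemma realV_mul a : a != 0 -> of_real F a^-1 * of_real F a = 1.
Proof. by move=> a0; rewrite -of_realM mulVf// of_real1. Qed.
End ScalarTheory.

(** * Adjoints and the Frobenius norm *)

Section MatrixNorm.
Variables (R : realType) (F : scalar_kind).
Local Notation K := (Defs.scalar R F).

Lemma adjmxE m n (A : 'M[K]_(m, n)) i j : adjmx A i j = sconj (A j i).
Proof. by rewrite !mxE. Qed.

Lemma adjmxK m n (A : 'M[K]_(m, n)) : adjmx (adjmx A) = A.
Proof. by apply/matrixP => i j; rewrite !adjmxE sconjK. Qed.

Lemma adjmxD m n (A B : 'M[K]_(m, n)) : adjmx (A + B) = adjmx A + adjmx B.
Proof. by apply/matrixP => i j; rewrite !mxE sconjD. Qed.

Lemma adjmxN m n (A : 'M[K]_(m, n)) : adjmx (- A) = - adjmx A.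
Proof. by apply/matrixP => i j; rewrite !mxE sconjN. Qed.

Lemma adjmxB m n (A B : 'M[K]_(m, n)) : adjmx (A - B) = adjmx A - adjmx B.
Proof. by rewrite adjmxD adjmxN. Qed.

Lemma adjmx0 m n : adjmx (0 : 'M[K]_(m, n)) = 0.
Proof. by apply/matrixP => i j; rewrite !mxE sconj0. Qed.

Lemma adjmx1 n : adjmx (1%:M : 'M[K]_n) = 1%:M.
Proof.
apply/matrixP => i j; rewrite !mxE eq_sym.
by case: eqP => _; rewrite ?sconj1 ?sconj0.
Qed.

Lemma adjmxM m n p (A : 'M[K]_(m, n)) (B : 'M[K]_(n, p)) :
  adjmx (A *m B) = adjmx B *m adjmx A.
Proof.
apply/matrixP => i j; rewrite !mxE sconj_sum; apply: eq_bigr => k _.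
by rewrite sconjM !adjmxE.
Qed.

(** The Euclidean inner product of the underlying real space: taking real parts
    keeps it real-valued and symmetric over the quaternions as well. *)
Definition ip m n (A B : 'M[K]_(m, n)) : R :=
  \sum_i \sum_j sre (sconj (A i j) * B i j).

Definition nrm2 m n (A : 'M[K]_(m, n)) : R := \sum_i \sum_j nsq (A i j).

Lemma nrm2E m n (A : 'M[K]_(m, n)) : nrm2 A = ip A A.
Proof. by []. Qed.

Lemma ipDr m n (A B C : 'M[K]_(m, n)) : ip A (B + C) = ip A B + ip A C.
Proof.
rewrite /ip -big_split; apply: eq_bigr => i _; rewrite -big_split /=.
by apply: eq_bigr => j _; rewrite mxE mulrDr sreD.
Qed.

Lemma ipC m n (A B : 'M[K]_(m, n)) : ip A B = ip B A.
Proof.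
rewrite /ip; apply: eq_bigr => i _; apply: eq_bigr => j _.
by rewrite -sre_conj sconjM sconjK.
Qed.

Lemma ipDl m n (A B C : 'M[K]_(m, n)) : ip (B + C) A = ip B A + ip C A.
Proof. by rewrite ipC ipDr !(ipC A). Qed.

Lemma ip0r m n (A : 'M[K]_(m, n)) : ip A 0 = 0.
Proof. by apply: (@addIr _ (ip A 0)); rewrite -ipDr !add0r. Qed.

Lemma ip0l m n (A : 'M[K]_(m, n)) : ip 0 A = 0.
Proof. by rewrite ipC ip0r. Qed.

Lemma ipNr m n (A B : 'M[K]_(m, n)) : ip A (- B) = - ip A B.
Proof. by apply: (@addIr _ (ip A B)); rewrite -ipDr !addNr ip0r. Qed.

Lemma ipNl m n (A B : 'M[K]_(m, n)) : ip (- A) B = - ip A B.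
Proof. by rewrite ipC ipNr ipC. Qed.

Lemma ipZr m n (A B : 'M[K]_(m, n)) a :
  ip A (of_real F a *: B) = a * ip A B.
Proof.
rewrite /ip mulr_sumr; apply: eq_bigr => i _; rewrite mulr_sumr.
by apply: eq_bigr => j _; rewrite mxE mulrA -of_realC -mulrA sreZ.
Qed.

Lemma ipZl m n (A B : 'M[K]_(m, n)) a :
  ip (of_real F a *: A) B = a * ip A B.
Proof. by rewrite ipC ipZr ipC. Qed.

Lemma nrm2_ge0 m n (A : 'M[K]_(m, n)) : 0 <= nrm2 A.
Proof. by apply: sumr_ge0 => i _; apply: sumr_ge0 => j _; apply: nsq_ge0. Qed.

Lemma nsq_le_nrm2 m n (A : 'M[K]_(m, n)) i j : nsq (A i j) <= nrm2 A.
Proof.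
rewrite /nrm2 (bigD1 i)//= (bigD1 j)//= -addrA lerDl addr_ge0//.
  by apply: sumr_ge0 => k _; apply: nsq_ge0.
by apply: sumr_ge0 => k _; apply: sumr_ge0 => l _; apply: nsq_ge0.
Qed.

Lemma nrm20_eq0 m n (A : 'M[K]_(m, n)) : nrm2 A = 0 -> A = 0.
Proof.
move=> A0; apply/matrixP => i j; rewrite mxE; apply: nsq0_eq0.
by apply/le_anti; rewrite nsq_ge0 -A0 nsq_le_nrm2.
Qed.

Lemma nrm2_gt0 m n (A : 'M[K]_(m, n)) : A != 0 -> 0 < nrm2 A.
Proof.
move=> A0; rewrite lt0r nrm2_ge0 andbT; apply: contra A0 => /eqP.
by move=> /nrm20_eq0 ->.
Qed.

Lemma nrm20 m n : nrm2 (0 : 'M[K]_(m, n)) = 0.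
Proof. by rewrite nrm2E ip0r. Qed.

Lemma nrm2D m n (A B : 'M[K]_(m, n)) :
  nrm2 (A + B) = nrm2 A + nrm2 B + 2 * ip A B.
Proof. by rewrite !nrm2E ipDl !ipDr (ipC B A); ring. Qed.

Lemma nrm2N m n (A : 'M[K]_(m, n)) : nrm2 (- A) = nrm2 A.
Proof. by rewrite !nrm2E ipNl ipNr opprK. Qed.

Lemma nrm2B m n (A B : 'M[K]_(m, n)) :
  nrm2 (A - B) = nrm2 A + nrm2 B - 2 * ip A B.
Proof. by rewrite nrm2D nrm2N ipNr mulrN. Qed.

Lemma nrm2Z m n (A : 'M[K]_(m, n)) a :
  nrm2 (of_real F a *: A) = a ^+ 2 * nrm2 A.
Proof. by rewrite !nrm2E ipZl ipZr mulrA expr2. Qed.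

Lemma nrm2_delta n (i : 'I_n) : nrm2 (delta_mx i 0 : 'cV[K]_n) = 1.
Proof.
rewrite /nrm2 (bigD1 i)//= big_ord1 mxE !eqxx nsq1 big1 ?addr0// => j ji.
by rewrite big_ord1 mxE (negPf ji) nsq0.
Qed.

Lemma ip_CS m n (A B : 'M[K]_(m, n)) : ip A B ^+ 2 <= nrm2 A * nrm2 B.
Proof.
have [->|B0] := eqVneq B 0; first by rewrite ip0r nrm20 mulr0 expr0n.
have B_gt0 := nrm2_gt0 B0.
have := nrm2_ge0 (A - of_real F (ip A B / nrm2 B) *: B).
rewrite nrm2B nrm2Z ipZr => H.
have : 0 <= (nrm2 A + (ip A B / nrm2 B) ^+ 2 * nrm2 B -
             2 * (ip A B / nrm2 B * ip A B)) * nrm2 B.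
  by rewrite mulr_ge0// ltW.
suff -> : (nrm2 A + (ip A B / nrm2 B) ^+ 2 * nrm2 B -
             2 * (ip A B / nrm2 B * ip A B)) * nrm2 B =
          nrm2 A * nrm2 B - ip A B ^+ 2 by rewrite subr_ge0.
by field; rewrite gt_eqF.
Qed.

Lemma nrm2D_le m n (A B : 'M[K]_(m, n)) :
  nrm2 (A + B) <= (Num.sqrt (nrm2 A) + Num.sqrt (nrm2 B)) ^+ 2.
Proof.
rewrite nrm2D sqrrD !sqr_sqrtr ?nrm2_ge0// [leRHS]addrAC lerD2l.
rewrite mulrC mulr_natr lerMn2r/= -sqrtrM ?nrm2_ge0//.
rewrite (le_trans (ler_norm _))// -sqrtr_sqr ler_wsqrtr//.
exact: ip_CS.
Qed.

(** The Frobenius norm. *)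
Definition nrm m n (A : 'M[K]_(m, n)) : R := Num.sqrt (nrm2 A).

Lemma nrm_ge0 m n (A : 'M[K]_(m, n)) : 0 <= nrm A.
Proof. exact: sqrtr_ge0. Qed.

Lemma nrmD m n (A B : 'M[K]_(m, n)) : nrm (A + B) <= nrm A + nrm B.
Proof.
rewrite /nrm -[leRHS]ger0_norm ?addr_ge0 ?sqrtr_ge0// -sqrtr_sqr.
by rewrite ler_wsqrtr// nrm2D_le.
Qed.

Lemma nrmN m n (A : 'M[K]_(m, n)) : nrm (- A) = nrm A.
Proof. by rewrite /nrm nrm2N. Qed.

Lemma nrmBC m n (A B : 'M[K]_(m, n)) : nrm (A - B) = nrm (B - A).
Proof. by rewrite -nrmN opprB. Qed.

Lemma nrm_sqr m n (A : 'M[K]_(m, n)) : nrm A ^+ 2 = nrm2 A.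
Proof. by rewrite sqr_sqrtr// nrm2_ge0. Qed.

Lemma nrmZ m n (A : 'M[K]_(m, n)) a : nrm (of_real F a *: A) = `|a| * nrm A.
Proof. by rewrite /nrm nrm2Z sqrtrM ?sqr_ge0// sqrtr_sqr. Qed.

Lemma nrm0 m n : nrm (0 : 'M[K]_(m, n)) = 0.
Proof. by rewrite /nrm nrm20 sqrtr0. Qed.

(** The Cauchy-Schwarz inequality for the scalar product A B follows from the real
    one after rotating the entries of A by the phase of A B. *)
Lemma nsq_mul_le n (A : 'rV[K]_n) (B : 'cV[K]_n) :
  nsq ((A *m B) 0 0) <= nrm2 A * nrm2 B.
Proof.
set x := (A *m B) 0 0.
have [->|x0] := eqVneq x 0.
  by rewrite nsq0 mulr_ge0// nrm2_ge0.
have xgt0 : 0 < nsq x.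
  by rewrite lt0r nsq_ge0 andbT; apply: contra x0 => /eqP/nsq0_eq0 ->.
rewrite -(ler_pM2l xgt0).
pose C : 'cV[K]_n := \col_i (sconj (A 0 i) * x).
have xE : nsq x = ip C B.
  rewrite {1}/nsq {2}/x mxE mulr_sumr sre_sum /ip; apply: eq_bigr => i _.
  by rewrite big_ord1 mxE sconjM sconjK mulrA.
have CE : nrm2 C = nsq x * nrm2 A.
  rewrite /nrm2 big_ord1 mulr_sumr; apply: eq_bigr => i _.
  by rewrite big_ord1 mxE nsqM nsq_conj mulrC.
by rewrite {1 2}xE -expr2 (le_trans (ip_CS _ _))// CE mulrA.
Qed.

Lemma nrm2_mul m n p (A : 'M[K]_(m, n)) (B : 'M[K]_(n, p)) :
  nrm2 (A *m B) <= nrm2 A * nrm2 B.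
Proof.
have -> : nrm2 A * nrm2 B =
    \sum_(i < m) \sum_(j < p) nrm2 (row i A) * nrm2 (col j B).
  rewrite {1}/nrm2 mulr_suml; apply: eq_bigr => i _.
  rewrite -mulr_sumr; congr (_ * _).
    by rewrite /nrm2 big_ord1; apply: eq_bigr => j _; rewrite mxE.
  rewrite /nrm2 exchange_big; apply: eq_bigr => j _.
  by apply: eq_bigr => k _; rewrite big_ord1 mxE.
apply: ler_sum => i _; apply: ler_sum => j _.
have -> : (A *m B) i j = (row i A *m col j B) 0 0.
  by rewrite !mxE; apply: eq_bigr => k _; rewrite !mxE.
exact: nsq_mul_le.
Qed.

Lemma nrm_mul m n p (A : 'M[K]_(m, n)) (B : 'M[K]_(n, p)) :
  nrm (A *m B) <= nrm A * nrm B.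
Proof. by rewrite /nrm -sqrtrM ?nrm2_ge0// ler_wsqrtr// nrm2_mul. Qed.

Lemma ip_adjr m n p (A : 'M[K]_(m, n)) (B : 'M[K]_(n, p)) (C : 'M[K]_(m, p)) :
  ip (A *m B) C = ip B (adjmx A *m C).
Proof.
rewrite /ip exchange_big [RHS]exchange_big; apply: eq_bigr => j _ /=.
under eq_bigr => i _ do rewrite mxE sconj_sum mulr_suml sre_sum.
rewrite exchange_big; apply: eq_bigr => i _ /=.
rewrite mxE mulr_sumr sre_sum; apply: eq_bigr => k _.
by rewrite adjmxE sconjM mulrA.
Qed.

Lemma ip_adjl m n p (A : 'M[K]_(m, n)) (B : 'M[K]_(n, p)) (C : 'M[K]_(m, p)) :
  ip C (A *m B) = ip (adjmx A *m C) B.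
Proof. by rewrite ipC ip_adjr ipC. Qed.

Lemma unitary_ip m n (k : 'M[K]_m) (A B : 'M[K]_(m, n)) :
  unitary_mx k -> ip (k *m A) (k *m B) = ip A B.
Proof. by move=> uk; rewrite ip_adjr mulmxA uk mul1mx. Qed.

Lemma unitary_nrm2 m n (k : 'M[K]_m) (A : 'M[K]_(m, n)) :
  unitary_mx k -> nrm2 (k *m A) = nrm2 A.
Proof. exact: unitary_ip. Qed.

Lemma unitary1 n : unitary_mx (1%:M : 'M[K]_n).
Proof. by rewrite /unitary_mx adjmx1 mul1mx. Qed.

Lemma unitaryM n (k l : 'M[K]_n) :
  unitary_mx k -> unitary_mx l -> unitary_mx (k *m l).
Proof.
move=> uk ul; rewrite /unitary_mx adjmxM mulmxA -(mulmxA (adjmx l)) uk mulmx1.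
exact: ul.
Qed.

Lemma sre_form n (A : 'M[K]_n) (v : 'cV[K]_n) :
  sre ((adjmx v *m A *m v) 0 0) = ip v (A *m v).
Proof.
rewrite -mulmxA mxE sre_sum /ip; apply: eq_bigr => i _.
by rewrite big_ord1 adjmxE.
Qed.

Lemma real_diagE n (h : 'rV[R]_n) i j :
  real_diag F h i j = if i == j then of_real F (h 0 i) else 0.
Proof. by rewrite !mxE; case: eqP => [->|]. Qed.

Lemma mul_real_diag n p (h : 'rV[R]_n) (A : 'M[K]_(n, p)) i j :
  (real_diag F h *m A) i j = of_real F (h 0 i) * A i j.
Proof.
rewrite mxE (bigD1 i)//= big1 ?addr0 ?real_diagE ?eqxx// => k /negPf ki.
by rewrite real_diagE eq_sym ki mul0r.
Qed.

Lemma mulr_real_diag n p (h : 'rV[R]_n) (A : 'M[K]_(p, n)) i j :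
  (A *m real_diag F h) i j = A i j * of_real F (h 0 j).
Proof.
rewrite mxE (bigD1 j)//= big1 ?addr0 ?real_diagE ?eqxx// => k /negPf ki.
by rewrite real_diagE ki mulr0.
Qed.

Lemma adj_real_diag n (h : 'rV[R]_n) : adjmx (real_diag F h) = real_diag F h.
Proof.
apply/matrixP => i j; rewrite adjmxE !real_diagE eq_sym.
by case: eqP => [->|_]; rewrite ?sconj_real ?sconj0.
Qed.

End MatrixNorm.

(** * Triangular matrices, pivots and Cholesky factors *)

Section Triangular.
Variables (R : realType) (F : scalar_kind).
Local Notation K := (Defs.scalar R F).

(** Over the quaternions no determinant is available to invert k.  Instead, each
    row of k has norm at most 1 while the n columns have norm 1, so that all the
    rows have norm 1. *)
Lemma unitary_mulmxV n (k : 'M[K]_n) : unitary_mx k -> k *m adjmx k = 1%:M.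
Proof.
move=> uk.
have unitE (i : 'I_n) : nrm2 (delta_mx i 0 : 'cV[K]_n) = 1 := nrm2_delta _ _ i.
pose r i := nrm2 (adjmx k *m (delta_mx i 0 : 'cV[K]_n)).
have r_le1 i : r i <= 1.
  have H := ip_CS (delta_mx i 0 : 'cV[K]_n) (k *m (adjmx k *m delta_mx i 0)).
  rewrite ip_adjl -nrm2E (unitary_nrm2 _ uk) unitE mul1r -/(r i) in H.
  by have := nrm2_ge0 (adjmx k *m (delta_mx i 0 : 'cV[K]_n)); rewrite -/(r i); nra.
have sum_r : \sum_i r i = n%:R.
  have -> : \sum_i r i = \sum_(j < n) nrm2 (k *m (delta_mx j 0 : 'cV[K]_n)).
    transitivity (\sum_(i < n) \sum_(j < n) nsq (k i j)).
      apply: eq_bigr => i _; rewrite /r /nrm2; apply: eq_bigr => j _.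
      rewrite big_ord1 -colE mxE adjmxE nsq_conj //.
    rewrite exchange_big; apply: eq_bigr => j _; rewrite /nrm2.
    by apply: eq_bigr => i _; rewrite big_ord1 -colE mxE.
  under eq_bigr => i _ do rewrite (unitary_nrm2 _ uk) unitE.
  by rewrite sumr_const card_ord.
have r1 i : r i = 1.
  apply/eqP; rewrite eq_sym -subr_eq0; apply/eqP.
  have /psumr_eq0P H : \sum_i (1 - r i) = 0.
    by rewrite sumrB sum_r sumr_const card_ord subrr.
  by apply: H => // j _; rewrite subr_ge0.
suff H (i : 'I_n) : k *m (adjmx k *m delta_mx i 0) = delta_mx i 0 :> 'cV[K]_n.
  apply/matrixP => a b; have /matrixP/(_ a 0) := H b.
  by rewrite mulmxA -colE !mxE eqxx andbT.
apply/subr0_eq/nrm20_eq0.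
rewrite nrm2B (unitary_nrm2 _ uk) -/(r i) r1 unitE ipC ip_adjl -nrm2E.
by rewrite -/(r i) r1; ring.
Qed.

Lemma unitary_adj n (k : 'M[K]_n) : unitary_mx k -> unitary_mx (adjmx k).
Proof. by move=> uk; rewrite /unitary_mx adjmxK unitary_mulmxV. Qed.

(** The diagonal is recorded as a real vector because it becomes e^h in the Iwasawa
    decomposition. *)
Definition utri n (T : 'M[K]_n) (t : 'I_n -> R) :=
  [/\ forall i, T i i = of_real F (t i),
      forall i j : 'I_n, (j < i)%N -> T i j = 0 & forall i, 0 < t i].

(** Normalized vectors of the j-th step of the standard flag.  The least norm that T
    gives to such a vector is the j-th diagonal entry of T, which makes diagonal
    entries accessible to inequalities between norms. *)
Definition flagv n (j : 'I_n) (v : 'cV[K]_n) :=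
  v j 0 = 1 /\ forall i : 'I_n, (j < i)%N -> v i 0 = 0.

Lemma utri_mul_coord n (T : 'M[K]_n) t (j : 'I_n) (v : 'cV[K]_n) :
  utri T t -> (forall i : 'I_n, (j < i)%N -> v i 0 = 0) ->
  (T *m v) j 0 = of_real F (t j) * v j 0.
Proof.
move=> [Td Tl _] vj; rewrite mxE (bigD1 j)//= Td big1 ?addr0// => i ij.
have [/Tl -> |] := ltnP i j; first by rewrite mul0r.
by rewrite leq_eqVlt eq_sym -[_ == _]/(i == j) (negPf ij) => /vj ->; rewrite mulr0.
Qed.

Lemma utri_lower n (T : 'M[K]_n) t (j : 'I_n) (v : 'cV[K]_n) :
  utri T t -> flagv j v -> t j ^+ 2 <= nrm2 (T *m v).
Proof.
move=> Tt [vj vi]; apply: le_trans (nsq_le_nrm2 _ j 0).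
by rewrite (utri_mul_coord Tt vi) vj mulr1 nsq_real.
Qed.

(** Back substitution, which also preserves the steps of the standard flag. *)
Lemma utri_solve n (T : 'M[K]_n) t (m : nat) (b : 'cV[K]_n) :
  utri T t -> (forall i : 'I_n, (m <= i)%N -> b i 0 = 0) ->
  exists2 x : 'cV[K]_n, T *m x = b &
    forall i : 'I_n, (m <= i)%N -> x i 0 = 0.
Proof.
move=> Tt; elim: m b => [b b0|m IH b bm].
  exists 0 => [|i _]; last by rewrite mxE.
  by apply/matrixP => i j; rewrite mulmx0 mxE ord1 b0.
have [nm|mn] := leqP n m.
  have [i mi|x Tx xm] := IH b; last by exists x => // i /ltnW/xm.
  by have := leq_trans nm mi; rewrite leqNgt ltn_ord.
pose j := Ordinal mn; pose x0 : 'cV[K]_n := delta_mx j 0 *m (of_real F (t j)^-1 * b j 0)%:M.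
have x0E i : x0 i 0 = if i == j then of_real F (t j)^-1 * b j 0 else 0.
  rewrite mxE big_ord1 !mxE eqxx andbT mulr1n.
  by case: eqP => _; rewrite ?mul1r ?mul0r.
have [|x Tx xm] := IH (b - T *m x0).
  move=> i mi; rewrite [LHS]mxE [X in _ + X]mxE.
  have jx0 (l : 'I_n) : (j < l)%N -> x0 l 0 = 0.
    by rewrite x0E; case: eqP => // ->; rewrite ltnn.
  have [<-|ji] := eqVneq j i.
    rewrite (utri_mul_coord Tt jx0) x0E eqxx mulrA -of_realM divff ?of_real1.
      by rewrite mul1r subrr.
    by case: Tt => _ _ /(_ j); rewrite lt0r => /andP[].
  have {}mi : (m < i)%N.
    by rewrite ltn_neqAle mi andbT; apply: contra ji => /eqP ji; apply/eqP/val_inj.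
  rewrite (bm i)// sub0r (@utri_mul_coord _ _ t)//.
    by rewrite x0E eq_sym (negPf ji) mulr0 oppr0.
  by move=> l il; apply: jx0; apply: ltn_trans il.
exists (x + x0); first by rewrite mulmxDr Tx subrK.
move=> i mi; rewrite mxE xm 1?ltnW// add0r x0E; case: eqP => // ij.
by move: mi; rewrite ij ltnn.
Qed.

(** Up to scaling, x is the vector of the j-th step on which T is smallest. *)
Lemma utri_preimage_delta n (T : 'M[K]_n) t (j : 'I_n) : utri T t ->
  exists x : 'cV[K]_n, [/\ T *m x = delta_mx j 0,
    x j 0 = of_real F (t j)^-1 & forall i : 'I_n, (j < i)%N -> x i 0 = 0].
Proof.
move=> Tt; have [i ji|x Tx xj] := @utri_solve _ T t j.+1 (delta_mx j 0) Tt.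
  by rewrite mxE; case: eqP => // ij; move: ji; rewrite ij ltnn.
exists x; split => //; have := utri_mul_coord Tt xj.
have tj0 : t j != 0 by case: Tt => _ _ /(_ j); rewrite lt0r => /andP[].
rewrite Tx mxE !eqxx => /(congr1 (fun y => of_real F (t j)^-1 * y)).
by rewrite mulr1 mulrA realV_mul// mul1r.
Qed.

Lemma utri_attain n (T : 'M[K]_n) t (j : 'I_n) : utri T t ->
  exists2 v : 'cV[K]_n, flagv j v & nrm2 (T *m v) = t j ^+ 2.
Proof.
move=> Tt; have [x [Tx xj xi]] := utri_preimage_delta j Tt.
have tj0 : t j != 0 by case: Tt => _ _ /(_ j); rewrite lt0r => /andP[].
exists (x *m (of_real F (t j))%:M).
  split => [|i ji]; rewrite mxE big_ord1 !mxE eqxx mulr1n.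
    by rewrite xj realV_mul.
  by rewrite xi// mul0r.
rewrite mulmxA Tx /nrm2 (bigD1 j)//= big_ord1 mxE big_ord1 !mxE !eqxx mulr1n.
rewrite mul1r nsq_real big1 ?addr0// => i ij.
by rewrite big_ord1 mxE big_ord1 mxE (negPf ij) mul0r nsq0.
Qed.

(** Diagonal entries are least norms over the same set of vectors for both matrices. *)
Lemma utri_le n (T T' : 'M[K]_n) t t' c : utri T t -> utri T' t' ->
  (forall v : 'cV[K]_n, nrm2 (T *m v) <= c * nrm2 (T' *m v)) ->
  forall j, t j ^+ 2 <= c * t' j ^+ 2.
Proof.
move=> Tt Tt' H j; have [v fv <-] := utri_attain j Tt'.
exact: le_trans (utri_lower Tt fv) (H v).
Qed.

Lemma utri_gram_uniq n (T T' : 'M[K]_n) t t' : utri T t -> utri T' t' ->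
  adjmx T *m T = adjmx T' *m T' -> t = t'.
Proof.
move=> Tt Tt' E; apply/funext => j.
have E' (v : 'cV[K]_n) : nrm2 (T *m v) = nrm2 (T' *m v).
  by rewrite !nrm2E !ip_adjr !mulmxA E.
have t0 : 0 < t j by case: Tt.
have t'0 : 0 < t' j by case: Tt'.
apply/eqP; rewrite -(eqrXn2 (n := 2))// ?ltW//; apply/eqP/le_anti.
apply/andP; split; rewrite -[leRHS]mul1r.
  by apply: (utri_le Tt Tt') => v; rewrite mul1r E'.
by apply: (utri_le Tt' Tt) => v; rewrite mul1r E'.
Qed.

Lemma utri_invertible n (T : 'M[K]_n) t : utri T t ->
  exists2 S : 'M[K]_n, T *m S = 1%:M & S *m T = 1%:M.
Proof.
move=> Tt.
have /choice[x xP] (j : 'I_n) := utri_preimage_delta j Tt.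
pose S : 'M[K]_n := \matrix_(i, j) x j i 0.
have TS : T *m S = 1%:M.
  apply/matrixP => i j; have [/matrixP/(_ i 0)] := xP j.
  rewrite !mxE eqxx andbT => <- _ _; apply: eq_bigr => k _; rewrite mxE//.
exists S => //.
suff inj (v : 'cV[K]_n) : T *m v = 0 -> v = 0.
  apply/matrixP => i j.
  have : T *m ((S *m T - 1%:M) *m delta_mx j 0) = 0 :> 'cV[K]_n.
    by rewrite mulmxA mulmxBr mulmxA TS mul1mx mulmx1 subrr mul0mx.
  move=> /inj/matrixP/(_ i 0); rewrite -colE mxE [RHS]mxE [LHS]mxE => /eqP.
  by rewrite [X in _ + X]mxE subr_eq0 => /eqP.
move=> Tv; apply/matrixP => i j; rewrite ord1 [RHS]mxE.
have [m] := ubnP (n - i); elim: m i => // m IH i im.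
have vi (l : 'I_n) : (i < l)%N -> v l 0 = 0.
  by move=> il; apply: IH; have := ltn_ord l; have := ltn_ord i; lia.
have := utri_mul_coord Tt vi; rewrite Tv mxE.
have ti0 : t i != 0 by case: Tt => _ _ /(_ i); rewrite lt0r => /andP[].
move=> /(congr1 (fun y => of_real F (t i)^-1 * y)).
by rewrite mulr0 mulrA realV_mul// mul1r => <-.
Qed.

Lemma sconj_fixed (x : K) : sconj x = x -> x = of_real F (sre x).
Proof.
case: F x => [//|[a b]|[a b c e]] /=.
- by case=> H; congr Complex; lra.
- by case=> H1 H2 H3; congr Quaternion; lra.
Qed.

Lemma ip_col_mx m n (a c : 'cV[K]_m) (b e : 'cV[K]_n) :
  ip (col_mx a b) (col_mx c e) = ip a c + ip b e.
Proof.
rewrite /ip big_split_ord /=; congr (_ + _); apply: eq_bigr => i _.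
  by rewrite !big_ord1 !col_mxEu.
by rewrite !big_ord1 !col_mxEd.
Qed.

Lemma adjmx_block m1 m2 n1 n2 (A : 'M[K]_(m1, n1)) B C (D : 'M[K]_(m2, n2)) :
  adjmx (block_mx A B C D) =
  block_mx (adjmx A) (adjmx C) (adjmx B) (adjmx D).
Proof. by rewrite /adjmx tr_block_mx map_block_mx. Qed.

Lemma posdefP n (A : 'M[K]_n) : posdefmx A <->
  adjmx A = A /\ forall v : 'cV[K]_n, v != 0 -> 0 < ip v (A *m v).
Proof.
by split=> -[? H]; split=> // v /H; rewrite sre_form.
Qed.

(** The Schur complement of the upper left entry is again positive definite. *)
Lemma cholesky n (A : 'M[K]_n) : posdefmx A ->
  exists T t, utri T t /\ adjmx T *m T = A.
Proof.
elim: n A => [|n IH] A.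
  move=> _; exists 0, (fun=> 1); split; first by split=> -[].
  by apply/matrixP => -[].
change n.+1 with (1 + n)%N in A |- *; rewrite -[A]submxK.
set a := ulsubmx A; set b := ursubmx A; set c := dlsubmx A; set e := drsubmx A.
move=> /posdefP[+ pd]; rewrite adjmx_block => /eq_block_mx[aE _ cE eE].
pose al := sre (a 0 0).
have {}aE : a = (of_real F al)%:M.
  apply/matrixP => i j; rewrite !ord1 [RHS]mxE eqxx mulr1n; apply: sconj_fixed.
  by move: aE => /matrixP/(_ 0 0); rewrite adjmxE.
have nzl m1 m2 (x : 'cV[K]_m1) (y : 'cV[K]_m2) : (x != 0) || (y != 0) -> col_mx x y != 0.
  by rewrite col_mx_eq0 negb_and.
have al0 : 0 < al.
  have := pd (col_mx 1%:M 0); rewrite nzl ?matrix_nonzero1// => /(_ isT).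
  rewrite mul_block_col !mulmx0 !addr0 !mulmx1 ip_col_mx ip0l addr0.
  by rewrite /ip !big_ord1 mxE eqxx sconj1 mul1r.
have scE m (s : K) (x : 'rV[K]_m) : s%:M *m x = s *: x by rewrite mul_scalar_mx.
have []// := IH (e - c *m (of_real F al^-1 *: b)).
  apply/posdefP; split.
    rewrite adjmxB eE adjmxM -cE adjmxK; congr (_ - _).
    rewrite -!scE adjmxM !mulmxA; congr (_ *m _).
    have adjr : adjmx (of_real F al^-1)%:M = (of_real F al^-1)%:M :> 'M[K]_1.
      by apply/matrixP => i j; rewrite !mxE !ord1 eqxx sconj_real.
    by rewrite adjr.
  move=> v v0; have := pd (col_mx (- (of_real F al^-1 *: (b *m v))) v).
  rewrite nzl ?v0 ?orbT// => /(_ isT).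
  rewrite mul_block_col ip_col_mx aE mulmxN mul_scalar_mx scalerA -of_realM.
  rewrite divff ?gt_eqF// of_real1 scale1r addNr ip0r add0r.
  by rewrite mulmxBl -mulmxA mulmxN -scalemxAl addrC.
(* T is the Cholesky factor of the Schur complement e - c a^-1 b *)
move=> T [t [[Td Tl Tp] TE]].
pose r := Num.sqrt al.
have r0 : 0 < r by rewrite sqrtr_gt0.
have rE : r * r = al by rewrite -expr2 sqr_sqrtr// ltW.
exists (block_mx (of_real F r)%:M (of_real F r^-1 *: b) 0 T).
exists (fun i => if fintype.split (i : 'I_(1 + n)) is inr j then t j else r).
split.
  split.
  - move=> i; case: (split_ordP i) => j ->.
      by rewrite (ord1 j) block_mxEul mxE eqxx mulr1n.
    by rewrite block_mxEdr Td.
  - move=> i j; case: (split_ordP i) => k ->; case: (split_ordP j) => l ->.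
    + by rewrite !ord1 ltnn.
    + by rewrite (ord1 k) /= ltn0.
    + by rewrite block_mxEdl mxE.
    + by rewrite /= ltn_add2l => /Tl; rewrite block_mxEdr.
  - by move=> i; case: splitP.
rewrite adjmx_block mulmx_block TE adjmx0 !mul0mx !mulmx0 !addr0.
have adjs s m (x : 'rV[K]_m) : adjmx (of_real F s *: x) = adjmx x *m (of_real F s)%:M.
  apply/matrixP => i j; rewrite adjmxE mxE [RHS]mxE big_ord1 adjmxE mxE !ord1.
  by rewrite eqxx mulr1n sconjM sconj_real.
have adjr s : adjmx (of_real F s)%:M = (of_real F s)%:M :> 'M[K]_1.
  by apply/matrixP => i j; rewrite !mxE !ord1 eqxx sconj_real.
rewrite adjr adjs -cE; congr block_mx.
- by rewrite aE mul_scalar_mx scale_scalar_mx -of_realM rE.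
- by rewrite mul_scalar_mx scalerA -of_realM divff ?gt_eqF// of_real1 scale1r.
- by rewrite -mulmxA mul_scalar_mx scale_scalar_mx realV_mul ?gt_eqF// mulmx1.
- rewrite -mulmxA mul_scalar_mx scalerA -of_realM -invfM rE.
  by rewrite addrC subrK.
Qed.

Lemma posdef_gram m n (g : 'M[K]_(m, n)) :
  (forall v : 'cV[K]_n, v != 0 -> 0 < nrm2 (g *m v)) -> posdefmx (adjmx g *m g).
Proof.
move=> H; apply/posdefP; split; first by rewrite adjmxM adjmxK.
by move=> v v0; rewrite -mulmxA -ip_adjr; apply: H.
Qed.

Lemma gram_nrm2 m n p (g : 'M[K]_(m, n)) (T : 'M[K]_(p, n)) (v : 'cV[K]_n) :
  adjmx T *m T = adjmx g *m g -> nrm2 (T *m v) = nrm2 (g *m v).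
Proof. by move=> E; rewrite !nrm2E !ip_adjr !mulmxA E. Qed.

End Triangular.

(** * The hull of a Weyl orbit as weak majorization *)

Section Majorization.
Variables (R : realType) (q : nat).
Implicit Types (h x X : 'rV[R]_q) (S : set 'rV[R]_q) (s : 'S_q).

Definition upd1 h (i : 'I_q) (a : R) : 'rV[R]_q :=
  \row_k if k == i then a else h 0 k.
Definition upd2 h (i j : 'I_q) (a b : R) : 'rV[R]_q :=
  \row_k if k == i then a else if k == j then b else h 0 k.

Definition between (a b c : R) := (a <= c <= b) || (b <= c <= a).

(** Transfers between neighbouring coordinates, the pair staying on the segment from
    itself to its transpose.  These moves and those of [last_closed] are the ones that
    can be realized on the set of attained exponents. *)
Definition adj_closed S := forall h (i j : 'I_q) a, S h -> j = i.+1 :> nat ->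
  between (h 0 i) (h 0 j) a -> S (upd2 h i j a (h 0 i + h 0 j - a)).
Definition last_closed S := forall h (i : 'I_q) a, S h -> i.+1 = q ->
  `|a| <= `|h 0 i| -> S (upd1 h i a).

(** Swapping neighbours is an extreme transfer: it brings the second index next to
    the first one and back. *)
Lemma pair_closed_lt S h (i j : 'I_q) a : adj_closed S -> S h -> (i < j)%N ->
  between (h 0 i) (h 0 j) a -> S (upd2 h i j a (h 0 i + h 0 j - a)).
Proof.
move=> Sadj; have [n] := ubnP (j - i)%N; elim: n h j => // n IH h j jin Sh ij.
have [ji|ji] := eqVneq (j : nat) i.+1; first exact: Sadj.
have j1q : (j.-1 < q)%N by have := ltn_ord j; lia.
pose l := Ordinal j1q.
have jl : j = l.+1 :> nat by rewrite /= prednK//; lia.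
have li : l != i by rewrite -val_eqE /=; lia.
have jlN : j != l by rewrite -val_eqE /=; lia.
have jiN : j != i by rewrite -val_eqE /=; lia.
have swap g : S g -> S (upd2 g l j (g 0 j) (g 0 l)).
  move=> Sg; have := Sadj g l j (g 0 j) Sg jl.
  by rewrite addrK; apply; rewrite /between !lexx /= !andbT; exact: le_total.
move=> bw; have Sh1 := swap _ Sh; set h1 := upd2 _ _ _ _ _ in Sh1.
have h1i : h1 0 i = h 0 i.
  by rewrite mxE eq_sym (negPf li) eq_sym (negPf jiN).
have h1l : h1 0 l = h 0 j by rewrite mxE eqxx.
have := IH h1 l; rewrite h1i h1l => /(_ _ Sh1 _ bw) H.
have {H} : S (upd2 h1 i l a (h 0 i + h 0 j - a)) by apply: H => /=; lia.
move=> /swap; congr S; apply/rowP => k; rewrite !mxE.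
have [->|kl] := eqVneq k l.
  by rewrite (negPf jiN) (negPf jlN) eqxx (negPf li) eq_sym (negPf jlN).
have [->|kj] := eqVneq k j; first by rewrite (negPf jiN) (negPf li) eqxx.
by case: eqP.
Qed.

Lemma pair_closed S h (i j : 'I_q) a : adj_closed S -> S h -> i != j ->
  between (h 0 i) (h 0 j) a -> S (upd2 h i j a (h 0 i + h 0 j - a)).
Proof.
move=> Sadj Sh; rewrite -val_eqE neq_ltn => /orP[ij|ji] bw.
  exact: pair_closed_lt.
have := @pair_closed_lt S h j i (h 0 i + h 0 j - a) Sadj Sh ji.
have -> : h 0 j + h 0 i - (h 0 i + h 0 j - a) = a by ring.
have ijN : i != j by rewrite -val_eqE neq_ltn ji orbT.
have bw' : between (h 0 j) (h 0 i) (h 0 i + h 0 j - a).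
  by move: bw; rewrite /between => /orP[/andP[? ?]|/andP[? ?]]; apply/orP;
    [right|left]; apply/andP; split; lra.
move=> /(_ bw'); congr S; apply/rowP => k; rewrite !mxE.
by have [->|//] := eqVneq k j; rewrite eq_sym (negPf ijN).
Qed.

Lemma perm_closed S h s : adj_closed S -> S h -> S (\row_k h 0 (s k)).
Proof.
move=> Sadj; have [ts -> _] := prod_tpermP s; elim: ts h => [|[i j] ts IH] h Sh.
  by rewrite big_nil; congr S: Sh; apply/rowP => k; rewrite mxE perm1.
rewrite big_cons; have := IH h Sh; set g := \row_k _; move=> Sg.
have [->|ij] := eqVneq i j.
  by congr S: Sg; apply/rowP => k; rewrite !mxE permM tperm1 perm1.
have := @pair_closed S g i j (g 0 j) Sadj Sg ij; rewrite addrK.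
rewrite /between !lexx /= !andbT le_total => /(_ isT).
congr S; apply/rowP => k; rewrite [RHS]mxE permM [LHS]mxE /=.
case: tpermP => [->|->|].
- by rewrite eqxx mxE.
- by rewrite eq_sym (negPf ij) eqxx mxE.
- by move=> /eqP/negPf-> /eqP/negPf->; rewrite mxE.
Qed.

Lemma coord_closed S h (i : 'I_q) a : adj_closed S -> last_closed S -> S h ->
  `|a| <= `|h 0 i| -> S (upd1 h i a).
Proof.
move=> Sadj Slast Sh ai.
have q0 : (0 < q)%N by have := ltn_ord i; lia.
have lq : (q.-1 < q)%N by rewrite prednK.
pose l := Ordinal lq.
have := Slast _ l a (perm_closed (tperm i l) Sadj Sh).
rewrite /= prednK// mxE tpermR => /(_ erefl ai) /(perm_closed (tperm i l) Sadj).
congr S; apply/rowP => k; rewrite !mxE tpermK.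
by have [->|ki] := eqVneq k i; [rewrite tpermL eqxx|
  rewrite -[X in _ == X](tpermL i l) (inj_eq perm_inj) (negPf ki)].
Qed.

(** Each step of the two inductions below makes at least one more coordinate agree. *)
Definition mismatch h x := #|[pred i | x 0 i != h 0 i]|.

Lemma shrink_closed S h x : adj_closed S -> last_closed S -> S x ->
  (forall i, `|h 0 i| <= `|x 0 i|) -> S h.
Proof.
move=> Sadj Slast; have [n] := ubnP (mismatch h x); elim: n x => // n IH x xn Sx hx.
have [/forallP xh|] := boolP [forall i, x 0 i == h 0 i].
  by congr S: Sx; apply/rowP => i; apply/eqP.
rewrite negb_forall => /existsP[i xi].
apply: (IH (upd1 x i (h 0 i))); last 2 first.
- exact: coord_closed.
- by move=> j; rewrite mxE; case: eqP => // ->.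
rewrite -ltnS; apply: leq_trans xn; rewrite ltnS; apply: proper_card.
apply/properP; split.
  apply/fintype.subsetP => j; rewrite !inE mxE.
  by have [->|//] := eqVneq j i; rewrite eqxx.
by exists i; rewrite !inE// mxE !eqxx.
Qed.

(** Hardy, Littlewood and Polya: weak majorization is realized by finitely many
    transfers between two coordinates followed by shrinking coordinates. *)
Lemma hlp_closed S h x : adj_closed S -> last_closed S -> S x ->
  (forall i, 0 <= h 0 i) ->
  (forall i j : 'I_q, (i <= j)%N -> h 0 j <= h 0 i) ->
  (forall r, \sum_(i < q | (i < r)%N) h 0 i <= \sum_(i < q | (i < r)%N) x 0 i) ->
  S h.
Proof.
move=> Sadj Slast + h0 hnd.
have [n] := ubnP (mismatch h x); elim: n x => // n IH x xn Sx hx.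
have [/forallP xh|] := boolP [forall i, h 0 i <= x 0 i].
  apply: shrink_closed Sx _ => // i.
  by rewrite !ger0_norm// (le_trans (h0 i)).
rewrite negb_forall => /existsP[i0]; rewrite -ltNge => xi0.
(* i is the first index where h exceeds x, and j the last index before i where
   x exceeds h; such a j exists because of the partial sum up to i *)
have [i xi imin] := @arg_minnP _ i0 (fun i => x 0 i < h 0 i) (fun i => i : nat) xi0.
have {imin i0 xi0} imin (l : 'I_q) : (l < i)%N -> h 0 l <= x 0 l.
  by rewrite leNgt; apply: contraTN => /imin; rewrite -leqNgt.
have [j0 /andP[j0i xj0]] : exists j : 'I_q, (j < i)%N && (h 0 j < x 0 j).
  apply/existsP; apply: contraT; rewrite negb_exists => /forallP H.
  have := hx i.+1; rewrite [leRHS](bigD1 i)//= [leLHS](bigD1 i)//= leNgt.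
  apply: contraNT => _.
  apply: ltr_leD => //; apply: ler_sum => l /andP[li lN].
  have {}li : (l < i)%N by rewrite ltn_neqAle -ltnS li andbT.
  by have := H l; rewrite li /= -leNgt.
have [j /andP[ji xj] jmax] := @arg_maxnP _ j0
  (fun j => (j < i)%N && (h 0 j < x 0 j)) (fun j => j : nat) (introT andP (conj j0i xj0)).
have {jmax} jmax (l : 'I_q) : (j < l)%N -> (l < i)%N -> x 0 l = h 0 l.
  move=> jl li; apply/le_anti; rewrite imin// andbT leNgt; apply/negP => hl.
  by have := jmax l; rewrite li hl /= => /(_ isT); rewrite leqNgt jl.
have ijN : i != j by rewrite -val_eqE neq_ltn ji orbT.
(* the largest transfer that keeps x above h at j and below h at i; it makes
   x agree with h at one of these indices *)
pose de := Num.min (x 0 j - h 0 j) (h 0 i - x 0 i).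
have de1 : de <= x 0 j - h 0 j by rewrite /de ge_min lexx.
have de2 : de <= h 0 i - x 0 i by rewrite /de ge_min lexx orbT.
have de0 : 0 < de by rewrite /de lt_min !subr_gt0 xj.
have hij := hnd j i (ltnW ji).
pose x' := upd2 x j i (x 0 j - de) (x 0 i + de).
have x'j : x' 0 j = x 0 j - de by rewrite mxE eqxx.
have x'i : x' 0 i = x 0 i + de by rewrite mxE (negPf ijN) eqxx.
have x'o k : k != i -> k != j -> x' 0 k = x 0 k.
  by move=> ki kj; rewrite mxE (negPf kj) (negPf ki).
apply: (IH x').
- rewrite -ltnS; apply: leq_trans xn; rewrite ltnS; apply: proper_card.
  have sub : [pred k | x' 0 k != h 0 k] \subset [pred k | x 0 k != h 0 k].
    apply/fintype.subsetP => k; rewrite !inE.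
    have [->|ki] := eqVneq k i; first by move=> _; rewrite lt_eqF.
    have [->|kj] := eqVneq k j; first by move=> _; rewrite gt_eqF.
    by rewrite x'o.
  apply/properP; split => //.
  have [dE|dE] := leP (x 0 j - h 0 j) (h 0 i - x 0 i).
    exists j; first by rewrite inE gt_eqF.
    by rewrite inE negbK x'j /de min_l// opprB addrC subrK.
  exists i; first by rewrite inE lt_eqF.
  by rewrite inE negbK x'i /de min_r ?ltW// addrC subrK.
- have := @pair_closed S x j i (x 0 j - de) Sadj Sx; rewrite eq_sym ijN => /(_ isT).
  have -> : x 0 j + x 0 i - (x 0 j - de) = x 0 i + de by ring.
  by apply; apply/orP; right; apply/andP; split; lra.
- move=> r; have [ri|ri] := leqP r i.
    apply: ler_sum => l lr.
    have li : (l < i)%N by apply: leq_trans ri.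
    have lN : l != i by rewrite -val_eqE neq_ltn li.
    have [->|lj] := eqVneq l j; first by rewrite x'j; lra.
    by rewrite x'o// imin.
  suff -> : \sum_(l < q | (l < r)%N) x' 0 l = \sum_(l < q | (l < r)%N) x 0 l by [].
  have jr : (j < r)%N by apply: ltn_trans ri.
  rewrite (bigD1 i)//= (bigD1 j)/=; last by rewrite jr eq_sym.
  rewrite [RHS](bigD1 i)//= [X in _ = _ + X](bigD1 j)/=; last by rewrite jr eq_sym.
  rewrite x'i x'j !addrA; congr (_ + _); first by ring.
  by apply: eq_bigr => l /andP[/andP[_ li] lj]; rewrite x'o.
Qed.

Lemma sort_perm (y : 'I_q -> R) :
  exists s : 'S_q, forall i j : 'I_q, (i <= j)%N -> y (s j) <= y (s i).
Proof.
have [q0|q0] := posnP q; first by exists 1%g => i; have := ltn_ord i; rewrite {2}q0.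
pose i0 := Ordinal q0; pose le i j := y j <= y i.
pose l := sort le (enum 'I_q).
have sl : size l = q by rewrite size_sort size_enum_ord.
have inj : injective (fun i : 'I_q => nth i0 l i).
  move=> i j /eqP; rewrite nth_uniq ?sl//; last by rewrite sort_uniq enum_uniq.
  by move=> /eqP/val_inj.
exists (perm inj) => i j ij; rewrite !permE.
apply: (sorted_leq_nth (leT := le)) => //; rewrite ?inE ?sl//.
- by move=> a b c; rewrite /le => ba cb; exact: le_trans cb ba.
- by move=> a; rewrite /le.
- by apply: sort_sorted => a b; rewrite /le le_total.
Qed.

(** After subtracting the threshold value c at index r, both partial sums compare
    with the sum of the positive parts of all y_i - c, which is invariant under
    permutations; the right-hand sum equals it. *)
Lemma top_sum_max (y : 'I_q -> R) (s : 'S_q) r :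
  (forall i j : 'I_q, (i <= j)%N -> y j <= y i) ->
  \sum_(i < q | (i < r)%N) y (s i) <= \sum_(i < q | (i < r)%N) y i.
Proof.
move=> ynd; have [qr|rq] := leqP q r.
  have T (i : 'I_q) : (i < r)%N by apply: leq_trans qr.
  under eq_bigl => i do rewrite T; under [leRHS]eq_bigl => i do rewrite T.
  by rewrite [leRHS](reindex_inj (@perm_inj _ s)).
pose c := y (Ordinal rq).
rewrite -subr_le0 -sumrB.
have -> : \sum_(i < q | (i < r)%N) (y (s i) - y i) =
    \sum_(i < q | (i < r)%N) (y (s i) - c) - \sum_(i < q | (i < r)%N) (y i - c).
  by rewrite -sumrB; apply: eq_bigr => i _; ring.
rewrite subr_le0.
apply: (@le_trans _ _ (\sum_i Num.max (y (s i) - c) 0)).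
  rewrite big_mkcond; apply: ler_sum => i _; case: ifP => _.
    by rewrite le_max lexx.
  by rewrite le_max lexx orbT.
have -> : \sum_i Num.max (y (s i) - c) 0 = \sum_i Num.max (y i - c) 0.
  by rewrite [RHS](reindex_inj (@perm_inj _ s)).
rewrite [leRHS]big_mkcond; apply: ler_sum => i _; case: ltnP => ir.
  by rewrite max_l// subr_ge0 ynd// ltnW.
by rewrite max_r// subr_le0 ynd.
Qed.


Definition sorting X s :=
  forall i j : 'I_q, (i <= j)%N -> `|X 0 (s j)| <= `|X 0 (s i)|.

Lemma sortingP X : exists s, sorting X s.
Proof. exact: (sort_perm (fun i => `|X 0 i|)). Qed.

(** For s sorting X: every signed partial sum of r coordinates of h is at most the
    sum of the r largest |x_i|.  These are the inequalities that cut out the hull. *)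
Definition wmaj X s h := forall r (u : 'S_q) (e : 'I_q -> bool),
  \sum_(i < q | (i < r)%N) (-1) ^+ e i * h 0 (u i) <=
  \sum_(i < q | (i < r)%N) `|X 0 (s i)|.

(** Pass to the decreasing rearrangements of |X| and |h|, which [hlp_closed] relates,
    and then permute and restore signs. *)
Lemma wmaj_in_closed S X s h : sorting X s -> adj_closed S -> last_closed S ->
  S X -> wmaj X s h -> S h.
Proof.
move=> sX Sadj Slast SX hX.
have [u uh] := sortingP h.
have SX' : S (\row_i `|X 0 (s i)|).
  apply: (shrink_closed Sadj Slast (perm_closed s Sadj SX)) => i.
  by rewrite !mxE normr_id.
have : S (\row_i `|h 0 (u i)|).
  apply: (hlp_closed Sadj Slast SX') => [i|i j ij|r].
  - by rewrite mxE.
  - by rewrite !mxE uh.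
  have -> : \sum_(i < q | (i < r)%N) (\row_i `|h 0 (u i)|) 0 i =
      \sum_(i < q | (i < r)%N) (-1) ^+ (h 0 (u i) < 0)%R * h 0 (u i).
    by apply: eq_bigr => i _; rewrite mxE normrEsign.
  have -> : \sum_(i < q | (i < r)%N) (\row_i `|X 0 (s i)|) 0 i =
      \sum_(i < q | (i < r)%N) `|X 0 (s i)|.
    by apply: eq_bigr => i _; rewrite mxE.
  exact: hX.
move=> /(perm_closed u^-1%g Sadj) H; apply: (shrink_closed Sadj Slast H) => i.
by rewrite !mxE permKV normr_id.
Qed.

Lemma wmaj_self X s : sorting X s -> wmaj X s X.
Proof.
move=> sX r u e; apply: (@le_trans _ _ (\sum_(i < q | (i < r)%N) `|X 0 (u i)|)).
  apply: ler_sum => i _; apply: le_trans (ler_norm _) _.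
  by rewrite normrM normrX normrN1 expr1n mul1r.
have := @top_sum_max (fun i => `|X 0 (s i)|) (u * s^-1)%g r sX.
by under [leLHS]eq_bigr => i _ do rewrite permM permKV.
Qed.

Lemma wmaj_weyl X s h (u : 'S_q) (e : 'I_q -> bool) : wmaj X s h ->
  wmaj X s (\row_i ((-1) ^+ e i * h 0 (u i))).
Proof.
move=> hX r v f; have := hX r (v * u)%g (fun i => f i (+) e (v i)).
apply: le_trans; apply: ler_sum => i _.
by rewrite mxE permM signr_addb mulrA.
Qed.

Lemma wmaj_conv X s h g (a b : R) : wmaj X s h -> wmaj X s g ->
  0 <= a -> 0 <= b -> a + b = 1 -> wmaj X s (a *: h + b *: g).
Proof.
move=> hX gX a0 b0 ab r u e; set M := leRHS.
have -> : M = a * M + b * M by rewrite -mulrDl ab mul1r.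
have -> : \sum_(i < q | (i < r)%N) (-1) ^+ e i * (a *: h + b *: g) 0 (u i) =
  a * \sum_(i < q | (i < r)%N) (-1) ^+ e i * h 0 (u i) +
  b * \sum_(i < q | (i < r)%N) (-1) ^+ e i * g 0 (u i).
  rewrite !mulr_sumr -big_split /=; apply: eq_bigr => i _; rewrite !mxE; ring.
by apply: lerD; apply: ler_wpM2l.
Qed.

Definition weyl_row (u : 'S_q) (e : 'I_q -> bool) (h : 'rV[R]_q) : 'rV[R]_q :=
  \row_i ((-1) ^+ e i * h 0 (u i)).

Lemma convE (h g : convex_lmodType 'rV[R]_q) (k : {i01 R}) :
  conv k h g = k%:num *: (h : 'rV[R]_q) + (1 - k%:num) *: (g : 'rV[R]_q).
Proof. by []. Qed.

Lemma convex_setP S : @convex_set R 'rV[R]_q S <->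
  forall h g a b, S h -> S g -> 0 <= a -> 0 <= b -> a + b = 1 ->
    S (a *: h + b *: g).
Proof.
split=> [cS h g a b Sh Sg a0 b0 ab|cS h g k].
  have a1 : a <= 1 by rewrite -ab lerDl.
  have := cS h g (Itv01 a0 a1); rewrite !inE => /(_ Sh Sg).
  by rewrite convE /= (_ : 1 - a = b)//; lra.
rewrite !inE convE => Sh Sg; apply: cS => //.
by rewrite addrC subrK.
Qed.

Lemma weyl_hull_convex X : @convex_set R 'rV[R]_q (weyl_hull X).
Proof.
apply/convex_setP => h g a b Xh Xg a0 b0 ab M [cM oM].
have /convex_setP := cM; apply=> //; [exact: Xh|exact: Xg].
Qed.

Lemma weyl_hull_row X u e h : weyl_hull X h -> weyl_hull X (weyl_row u e h).
Proof.
apply: (@smallest_sub _ _ _ [set h | weyl_hull X (weyl_row u e h)]); last first.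
  move=> _ [v [f ->]]; apply: sub_gen_smallest; exists (u * v)%g.
  exists (fun i => e i (+) f (u i)); apply/rowP => i.
  by rewrite !mxE permM signr_addb mulrA.
apply/convex_setP => g g' a b Xg Xg' a0 b0 ab /=.
have /convex_setP/(_ _ _ a b Xg Xg' a0 b0 ab) := @weyl_hull_convex X.
congr (weyl_hull X); apply/rowP => i; rewrite !mxE; ring.
Qed.

Lemma weyl_hull_self X : weyl_hull X X.
Proof.
apply: sub_gen_smallest; exists 1%g, (fun=> false); apply/rowP => i.
by rewrite mxE perm1 mul1r.
Qed.

Lemma between_conv a b c : between a b c ->
  exists t, [/\ 0 <= t, t <= 1 & c = t * a + (1 - t) * b].
Proof.
have [->|ab] := eqVneq a b.
  rewrite /between orbb => /le_anti ->; exists 1; split => //; ring.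
have ab' : a - b != 0 by rewrite subr_eq0.
move=> bw; exists ((c - b) / (a - b)).
have cE : c = (c - b) / (a - b) * a + (1 - (c - b) / (a - b)) * b by field.
move: cE; set t := _ / _ => cE; split => //; move: bw ab; rewrite neq_lt;
  rewrite /between => /orP[|] /andP[? ?] /orP[|] ?; nra.
Qed.

Lemma weyl_hull_adj X : adj_closed (weyl_hull X).
Proof.
move=> h i j a Xh ji /between_conv[t [t0 t1 aE]].
have Xh' := weyl_hull_row (tperm i j) (fun=> false) Xh.
have t1' : 0 <= 1 - t by rewrite subr_ge0.
have /convex_setP/(_ _ _ t (1 - t) Xh Xh' t0 t1') := @weyl_hull_convex X.
rewrite addrC subrK => /(_ erefl); congr (weyl_hull X); apply/rowP => k.
rewrite !mxE mul1r; have [->|ki] := eqVneq k i; first by rewrite tpermL aE.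
have [->|kj] := eqVneq k j; first by rewrite tpermR aE; ring.
by rewrite tpermD 1?eq_sym//; ring.
Qed.

Lemma weyl_hull_last X : last_closed (weyl_hull X).
Proof.
move=> h i a Xh _ ai.
have /between_conv[t [t0 t1 aE]] : between (h 0 i) (- h 0 i) a.
  move: ai; rewrite ler_norml /between; have [h0|h0] := leP 0 (h 0 i).
    by rewrite ger0_norm// => ->; rewrite orbT.
  by rewrite ltr0_norm// opprK => ->.
have Xh' := weyl_hull_row 1%g (fun k => k == i) Xh.
have t1' : 0 <= 1 - t by rewrite subr_ge0.
have /convex_setP/(_ _ _ t (1 - t) Xh Xh' t0 t1') := @weyl_hull_convex X.
rewrite addrC subrK => /(_ erefl); congr (weyl_hull X); apply/rowP => k.
rewrite !mxE perm1; have [->|ki] := eqVneq k i.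
  by rewrite aE expr1 mulN1r.
by rewrite mul1r -mulrDl addrC subrK mul1r.
Qed.

(** The inequalities define a convex set that contains the orbit.  Conversely the
    hull, being convex and invariant, admits the moves of [adj_closed] and
    [last_closed], which reach every solution of the inequalities. *)
Lemma weyl_hull_wmaj X s : sorting X s -> weyl_hull X = [set h | wmaj X s h].
Proof.
move=> sX; apply/seteqP; split => h /=.
  apply: (@smallest_sub _ _ _ [set h | wmaj X s h]); last by move=> _ [u [e ->]]; apply/wmaj_weyl/wmaj_self.
  by apply/convex_setP => h1 h2 a b H1 H2 a0 b0 ab; exact: wmaj_conv.
apply: wmaj_in_closed sX _ _ _; last exact: weyl_hull_self.
- exact: weyl_hull_adj.
- exact: weyl_hull_last.
Qed.

Lemma weyl_hull_closed X : closed (weyl_hull X).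
Proof.
have [s sX] := sortingP X; rewrite (weyl_hull_wmaj sX).
have -> : [set h | wmaj X s h] = \bigcap_(r in setT) \bigcap_(u in setT)
    \bigcap_(e in setT) [set h : 'rV[R]_q |
      \sum_(i < q | (i < r)%N) (-1) ^+ (e : 'I_q -> bool) i * h 0 ((u : 'S_q) i) <=
      \sum_(i < q | (i < r)%N) `|X 0 (s i)|].
  by apply/seteqP; split => h /= H r; [move=> _ u _ e _|move=> u e]; exact: H.
apply: closed_bigI => r _; apply: closed_bigI => u _; apply: closed_bigI => e _.
apply: (@closed_comp _ _ (fun h : 'rV[R]_q =>
    \sum_(i < q | (i < r)%N) (-1) ^+ (e : 'I_q -> bool) i * h 0 ((u : 'S_q) i))
  [set y | y <= \sum_(i < q | (i < r)%N) `|X 0 (s i)|]) => [h _|].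
  apply: continuous_big => [|i _ x]; first exact: add_continuous.
  apply: (@continuousM _ _ (cst ((-1) ^+ (e : 'I_q -> bool) i))
    (fun h : 'rV[R]_q => h 0 ((u : 'S_q) i))); first exact: cst_continuous.
  exact: coord_continuous.
exact: closed_le.
Qed.

End Majorization.

(** * Determinants of real forms *)

Section RealEmbedding.
Variables (R : realType) (F : scalar_kind).
Local Notation K := (Defs.scalar R F).
Local Notation d := (sdim F).

Lemma sdim_gt0 : (0 < d)%N. Proof. by case: F. Qed.

(** The standard real basis 1, i, j, k, truncated to the dimension. *)
Definition sbasis (k : nat) : K := of_coords F (fun l => (l == k)%:R).

Definition scoord (x : K) (k : nat) : R := sre (sconj (sbasis k) * x).

Lemma scoord_basis (k l : nat) : (k < d)%N -> (l < d)%N ->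
  scoord (sbasis l) k = (k == l)%:R.
Proof.
rewrite /scoord /sbasis; case: F => /=.
- by case: k l => [|//] [|//] _ _; rewrite mulr1.
- by move: k l => [|[|//]] [|[|//]] _ _ /=; ring.
- by move: k l => [|[|[|[|//]]]] [|[|[|[|//]]]] _ _ /=; ring.
Qed.

Lemma scoord_expand (x : K) : x = \sum_(k < d) sbasis k * of_real F (scoord x k).
Proof.
rewrite /scoord /sbasis; case: F x => /= [x|[a b]|[a b c e]].
- by rewrite big_ord1 /= !mul1r.
- rewrite !big_ord_recl big_ord0 /=.
  by apply/eqP; rewrite eq_complex /=; apply/andP; split; apply/eqP; ring.
- by rewrite !big_ord_recl big_ord0 /=; congr Quaternion => /=; ring.
Qed.

Lemma scoordD x y k : scoord (x + y) k = scoord x k + scoord y k.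
Proof. by rewrite /scoord mulrDr sreD. Qed.

Lemma scoord_sum I (r : seq I) (P : pred I) (f : I -> K) k :
  scoord (\sum_(i <- r | P i) f i) k = \sum_(i <- r | P i) scoord (f i) k.
Proof. by rewrite /scoord mulr_sumr sre_sum. Qed.

Lemma scoordZ x a k : scoord (x * of_real F a) k = scoord x k * a.
Proof. by rewrite /scoord mulrA -of_realC sreZ mulrC. Qed.

Lemma scoord_inj x y : (forall k, (k < d)%N -> scoord x k = scoord y k) -> x = y.
Proof.
move=> xy; rewrite (scoord_expand x) (scoord_expand y).
by apply: eq_bigr => k _; rewrite xy.
Qed.

(** The real matrix of left multiplication by x. *)
Definition smat (x : K) (k l : nat) : R := scoord (x * sbasis l) k.

Lemma smatM x y k l : smat (x * y) k l = \sum_(m < d) smat x k m * smat y m l.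
Proof.
rewrite /smat -mulrA {1}(scoord_expand (y * sbasis l)) mulr_sumr scoord_sum.
by apply: eq_bigr => m _; rewrite mulrA scoordZ.
Qed.

Lemma smatD x y k l : smat (x + y) k l = smat x k l + smat y k l.
Proof. by rewrite /smat mulrDl scoordD. Qed.

Lemma smat_sum I (r : seq I) (P : pred I) (f : I -> K) k l :
  smat (\sum_(i <- r | P i) f i) k l = \sum_(i <- r | P i) smat (f i) k l.
Proof. by rewrite /smat mulr_suml scoord_sum. Qed.

Lemma smat_conj x k l : smat (sconj x) k l = smat x l k.
Proof.
rewrite /smat /scoord mulrA -sconjM -sre_conj sconjM sconjK //.
Qed.

Lemma smat_real a k l : (k < d)%N -> (l < d)%N ->
  smat (of_real F a) k l = if k == l then a else 0.
Proof.
move=> kd ld; rewrite /smat of_realC scoordZ scoord_basis//.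
by case: eqP; rewrite ?mul1r ?mul0r.
Qed.

Section Index.
Variable n : nat.
Lemma odiv_subproof (i : 'I_(n * d)) : (i %/ d < n)%N.
Proof. by rewrite ltn_divLR ?sdim_gt0. Qed.
Definition odiv (i : 'I_(n * d)) : 'I_n := Ordinal (odiv_subproof i).
Definition omod (i : 'I_(n * d)) : 'I_d := Ordinal (ltn_pmod i sdim_gt0).
Lemma opair_subproof (a : 'I_n) (k : 'I_d) : (a * d + k < n * d)%N.
Proof.
apply: (@leq_trans (a.+1 * d)); first by rewrite mulSn addnC ltn_add2r.
by rewrite leq_mul2r ltn_ord orbT.
Qed.
Definition opair a k : 'I_(n * d) := Ordinal (opair_subproof a k).
Lemma odivK a k : odiv (opair a k) = a.
Proof. by apply: val_inj; rewrite /= divnMDl ?sdim_gt0// divn_small ?addn0. Qed.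
Lemma omodK a k : omod (opair a k) = k.
Proof. by apply: val_inj; rewrite /= modnMDl modn_small. Qed.
Lemma opairK i : opair (odiv i) (omod i) = i.
Proof. by apply: val_inj; rewrite /= -divn_eq. Qed.

Lemma big_odiv (T : Type) (idx : T) (op : Monoid.com_law idx) (f : 'I_n -> 'I_d -> T) :
  \big[op/idx]_(i < n * d) f (odiv i) (omod i) =
  \big[op/idx]_(a < n) \big[op/idx]_(k < d) f a k.
Proof.
rewrite pair_bigA /= (reindex (fun p : 'I_n * 'I_d => opair p.1 p.2)) /=.
  by apply: eq_bigr => -[a k] _; rewrite odivK omodK.
exists (fun i => (odiv i, omod i)) => [[a k] _|i _] /=; first by rewrite odivK omodK.
exact: opairK.
Qed.
End Index.

(** The real matrix of left multiplication by A on column vectors. *)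
Definition realify m n (A : 'M[K]_(m, n)) : 'M[R]_(m * d, n * d) :=
  \matrix_(i, j) smat (A (odiv i) (odiv j)) (omod i) (omod j).

Lemma realifyM m n p (A : 'M[K]_(m, n)) (B : 'M[K]_(n, p)) :
  realify (A *m B) = realify A *m realify B.
Proof.
apply/matrixP => i j; rewrite !mxE smat_sum.
transitivity (\sum_(a < n) \sum_(k < d)
    smat (A (odiv i) a) (omod i) k * smat (B a (odiv j)) k (omod j)).
  by apply: eq_bigr => a _; rewrite smatM.
by rewrite -big_odiv; apply: eq_bigr => k _; rewrite !mxE.
Qed.

Lemma realifyD m n (A B : 'M[K]_(m, n)) : realify (A + B) = realify A + realify B.
Proof. by apply/matrixP => i j; rewrite !mxE smatD. Qed.

Lemma realify_adj m n (A : 'M[K]_(m, n)) : realify (adjmx A) = (realify A)^T.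
Proof. by apply/matrixP => i j; rewrite !mxE smat_conj. Qed.

Lemma realify1 n : realify (1%:M : 'M[K]_n) = 1%:M.
Proof.
apply/matrixP => i j; rewrite !mxE.
have [<-|ij] := eqVneq i j.
  by rewrite eqxx -of_real1 smat_real// eqxx.
have [E|_] := eqVneq (odiv i) (odiv j); last by rewrite mulr0n -of_real0 smat_real//; case: eqP.
rewrite -of_real1 smat_real//; case: eqP => // /val_inj E'.
by move: ij; rewrite -(opairK i) -(opairK j) E E' eqxx.
Qed.

(** The determinant of the underlying real map replaces the determinant, which is not
    defined over the quaternions; all identities acquire an exponent d. *)
Definition detR n (A : 'M[K]_n) : R := \det (realify A).

Lemma detRM n (A B : 'M[K]_n) : detR (A *m B) = detR A * detR B.
Proof. by rewrite /detR realifyM det_mulmx. Qed.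

Lemma detR_adj n (A : 'M[K]_n) : detR (adjmx A) = detR A.
Proof. by rewrite /detR realify_adj det_tr. Qed.

Lemma detR1 n : detR (1%:M : 'M[K]_n) = 1.
Proof. by rewrite /detR realify1 det1. Qed.

Lemma detR_upper n (T : 'M[K]_n) (t : 'I_n -> R) :
  (forall i, T i i = of_real F (t i)) ->
  (forall i j : 'I_n, (j < i)%N -> T i j = 0) -> detR T = \prod_i t i ^+ d.
Proof.
move=> Td Tl; rewrite /detR -det_tr det_trig.
  transitivity (\prod_(i < n * d) t (odiv i)).
    by apply: eq_bigr => i _; rewrite !mxE Td smat_real// eqxx.
  rewrite (big_odiv _ (fun a _ => t a)) /=.
  by apply: eq_bigr => a _; rewrite prodr_const card_ord.
apply/is_trig_mxP => i j ij; rewrite !mxE.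
have : (odiv i <= odiv j)%N by rewrite leq_div2r// ltnW.
rewrite leq_eqVlt => /orP[/eqP/val_inj E|/Tl ->]; last first.
  by rewrite -of_real0 smat_real//; case: eqP.
rewrite -E Td smat_real//; case: eqP => // /val_inj E'.
by move: ij; rewrite -(opairK i) -(opairK j) E E' ltnn.
Qed.

Lemma detR_gram_utri n (T : 'M[K]_n) t : utri T t ->
  detR (adjmx T *m T) = \prod_i (t i ^+ 2) ^+ d.
Proof.
move=> [Td Tl _]; rewrite detRM detR_adj (detR_upper Td Tl) -big_split.
by apply: eq_bigr => i _ /=; rewrite exprAC expr2.
Qed.

Lemma det_sylvester n (A B : 'M[R]_n) : \det (1%:M + A *m B) = \det (1%:M + B *m A).
Proof.
have E1 : block_mx 1%:M (- A) B 1%:M *m block_mx 1%:M A 0 1%:M =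
    block_mx 1%:M 0 B (1%:M + B *m A).
  rewrite mulmx_block !mul1mx !mulmx1 !mulmx0 !addr0; congr block_mx.
    by rewrite subrr.
  by rewrite addrC.
have E2 : block_mx 1%:M A 0 1%:M *m block_mx 1%:M (- A) B 1%:M =
    block_mx (1%:M + A *m B) 0 B 1%:M.
  rewrite mulmx_block !mul1mx !mulmx1 !mul0mx !add0r; congr block_mx.
  by rewrite addNr.
have := congr1 determinant E1; rewrite det_mulmx mulrC -det_mulmx E2.
by rewrite !det_lblock !det1 !mulr1 mul1r.
Qed.

Lemma detR_sylvester n (A B : 'M[K]_n) :
  detR (1%:M + A *m B) = detR (1%:M + B *m A).
Proof.
by rewrite /detR !realifyD !realify1 !realifyM det_sylvester.
Qed.

(** The squared diagonal entries of the Cholesky factor are minima of the form over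
    normalized flag vectors, and their product is the determinant. *)
Lemma detR_ge_pivots n (U : 'M[K]_n) (c : 'I_n -> R) : posdefmx U ->
  (forall j, 0 <= c j) ->
  (forall j v, flagv j v -> c j <= ip v (U *m v)) ->
  \prod_i c i ^+ d <= detR U.
Proof.
move=> /cholesky[T [t [Tt <-]]] c0 cU; rewrite (detR_gram_utri Tt).
apply: ler_prod => i _; rewrite exprn_ge0//=.
apply: lerXn2r; rewrite ?nnegrE// ?sqr_ge0//.
have [v fv <-] := utri_attain i Tt.
by rewrite nrm2E ip_adjr mulmxA; exact: cU.
Qed.

(** Hadamard's inequality. *)
Lemma detR_le_diag n (U : 'M[K]_n) (c : 'I_n -> R) : posdefmx U ->
  (forall j, sre (U j j) <= c j) -> detR U <= \prod_i c i ^+ d.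
Proof.
move=> /cholesky[T [t [Tt UE]]] cU; rewrite -UE (detR_gram_utri Tt).
apply: ler_prod => i _; rewrite exprn_ge0 ?sqr_ge0//=.
have tc : t i ^+ 2 <= c i.
  apply: le_trans (cU i); rewrite -UE mxE sre_sum (bigD1 i)//=.
  have -> : sre (adjmx T i i * T i i) = t i ^+ 2.
    by rewrite adjmxE; case: Tt => -> _ _; exact: nsq_real.
  rewrite lerDl; apply: sumr_ge0 => k _; rewrite adjmxE; exact: nsq_ge0.
by apply: lerXn2r; rewrite ?nnegrE// ?sqr_ge0// (le_trans _ tc)// sqr_ge0.
Qed.

(** Cauchy-Schwarz applied to |G^* u|^2 = <u, G G^* u>. *)
Lemma contraction_adj n m (G : 'M[K]_(m, n)) :
  (forall v : 'cV[K]_n, nrm2 (G *m v) <= nrm2 v) ->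
  forall u : 'cV[K]_m, nrm2 (adjmx G *m u) <= nrm2 u.
Proof.
move=> H u; have := ip_CS u (G *m (adjmx G *m u)).
rewrite ip_adjl -nrm2E; have := H (adjmx G *m u).
have := nrm2_ge0 (adjmx G *m u); have := nrm2_ge0 u.
by move: (nrm2 _) (nrm2 _) (nrm2 _) => a b c; nra.
Qed.

(** With D^2 the diagonal matrix of e, Sylvester's identity turns the determinant into
    that of 1 + D G G^* D, whose diagonal entries are at most 1 + e_i, and
    Hadamard's inequality applies. *)
Lemma detR_contraction_le n (G : 'M[K]_n) (e : 'I_n -> R) :
  (forall v : 'cV[K]_n, nrm2 (G *m v) <= nrm2 v) -> (forall i, 0 <= e i) ->
  detR (1%:M + adjmx G *m (real_diag F (\row_i e i) *m G)) <=
  \prod_i (1 + e i) ^+ d.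
Proof.
move=> HG e0; pose D := real_diag F (\row_i Num.sqrt (e i)).
have -> : real_diag F (\row_i e i) = D *m D.
  apply/matrixP => i j; rewrite mul_real_diag !real_diagE; case: eqP => [->|_].
    by rewrite !mxE -of_realM -expr2 sqr_sqrtr.
  by rewrite mulr0.
rewrite -mulmxA mulmxA detR_sylvester.
set U := 1%:M + _.
have UE : U = 1%:M + adjmx (adjmx G *m D) *m (adjmx G *m D).
  by rewrite /U adjmxM adjmxK adj_real_diag.
have formE v : ip v (U *m v) = nrm2 v + nrm2 (adjmx G *m D *m v).
  by rewrite UE mulmxDl mul1mx ipDr -mulmxA -ip_adjr.
apply: detR_le_diag.
  apply/posdefP; split; first by rewrite UE adjmxD adjmx1 adjmxM !adjmxK.
  by move=> v v0; rewrite formE ltr_pwDl ?nrm2_gt0 ?nrm2_ge0.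
move=> j; pose v : 'cV[K]_n := delta_mx j 0.
have v1 : nrm2 v = 1 by exact: nrm2_delta.
have -> : sre (U j j) = ip v (U *m v).
  rewrite -colE /ip [RHS](bigD1 j)//= big_ord1 [v j 0]mxE [col j U j 0]mxE.
  rewrite !eqxx sconj1 mul1r [X in _ = _ + X]big1 ?addr0// => i ij.
  by rewrite big_ord1 [v i 0]mxE (negPf ij) sconj0 mul0r sre0.
rewrite formE v1 lerD2l -mulmxA.
apply: le_trans (contraction_adj HG _) _.
have -> : D *m v = of_real F (Num.sqrt (e j)) *: v.
  apply/matrixP => i l; rewrite mul_real_diag !mxE.
  by case: eqP => [->//|_]; rewrite !mulr0.
by rewrite nrm2Z v1 mulr1 sqr_sqrtr.
Qed.

End RealEmbedding.

(** * The hyperbolic form of Z(X, w) *)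

Lemma sre_conjZ (R : realType) F (g h : R) (a b : Defs.scalar R F) :
  sre (sconj (of_real F g * a) * (of_real F h * b)) = g * h * sre (sconj a * b).
Proof.
rewrite sconjM sconj_real -(of_realC g) -mulrA sreZ mulrA -(of_realC h).
by rewrite -mulrA sreZ mulrA.
Qed.

Section UpperBound.
Variables (R : realType) (F : scalar_kind) (q : nat).
Local Notation K := (Defs.scalar R F).
Local Notation d := (sdim F).

Definition mx_contraction n (w : 'M[K]_n) := forall v : 'cV[K]_n, nrm2 (w *m v) <= nrm2 v.

Lemma cosh2_sinh2 (x : R) : Defs.cosh x ^+ 2 - Defs.sinh x ^+ 2 = 1.
Proof.
rewrite /Defs.cosh /Defs.sinh expRN; have : expR x != 0 by rewrite gt_eqF ?expR_gt0.
by move: (expR x) => y y0; field.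
Qed.

(** The left-hand side is e^(2|x|) |a + s b|^2 / 2 + e^(-2|x|) |a - s b|^2 / 2 for s
    the sign of x.  Here e^(-2|x|) is at most t, and only the excess of e^(2|x|)
    over t is kept apart. *)
Lemma cosh_sinh_form (x : R) (a b : K) t : 1 <= t ->
  nsq (of_real F (Defs.cosh x) * a + of_real F (Defs.sinh x) * b) +
  nsq (of_real F (Defs.sinh x) * a + of_real F (Defs.cosh x) * b) <=
  t * (nsq a + nsq b) + Num.max (expR (2 * `|x|) - t) 0 *
    (nsq (a + of_real F (Num.sg x) * b) / 2).
Proof.
move=> t1; rewrite !nsqD !nsqM !nsq_real !sre_conjZ.
set sab := sre (sconj a * (of_real F (Num.sg x) * b)).
have -> : sab = Num.sg x * sre (sconj a * b).
  by rewrite /sab mulrA -of_realC -mulrA sreZ.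
have abl : `|2 * sre (sconj a * b)| <= nsq a + nsq b.
  rewrite ler_norml; apply/andP; split.
    by have := nsq_ge0 (a + b); rewrite nsqD; lra.
  by have := nsq_ge0 (a - b); rewrite nsqD nsqN mulrN sreN; lra.
move: (nsq_ge0 a) (nsq_ge0 b) abl {sab}.
move: (nsq a) (nsq b) (sre _) => A B m A0 B0; rewrite ler_norml => /andP[m1 m2].
rewrite /Defs.cosh /Defs.sinh.
have [->|] := eqVneq x 0; last (rewrite neq_lt => /orP[x0|x0]).
- rewrite oppr0 normr0 mulr0 !expR0 sgr0.
  have : 0 <= Num.max (1 - t) 0 by rewrite le_max lexx orbT.
  by nra.
- rewrite ltr0_norm// ltr0_sg//.
  have E1 : 1 < expR (- x) by rewrite expR_gt1 oppr_gt0.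
  have : expR x * expR (- x) = 1 by rewrite -expRD addrN expR0.
  have -> : expR (2 * - x) = expR (- x) ^+ 2 by rewrite -expRM_natl mulr_natl.
  move: (expR (- x)) E1 (expR x) (expR_gt0 x) => y y1 z z0 zy.
  have : y ^+ 2 - t <= Num.max (y ^+ 2 - t) 0 by rewrite le_max lexx.
  have : 0 <= Num.max (y ^+ 2 - t) 0 by rewrite le_max lexx orbT.
  move: (Num.max _ _) => M M0 Mt.
  have -> : ((z + y) / 2) ^+ 2 * A + ((z - y) / 2) ^+ 2 * B + 2 *
     ((z + y) / 2 * ((z - y) / 2) * m) + (((z - y) / 2) ^+ 2 * A + ((z + y) / 2) ^+ 2 * B +
      2 * ((z - y) / 2 * ((z + y) / 2) * m)) =
    y ^+ 2 * ((A + B - 2 * m) / 2) + z ^+ 2 * ((A + B + 2 * m) / 2) by field.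
  have -> : A + (-1) ^+ 2 * B + 2 * (-1 * m) = A + B - 2 * m by ring.
  have z1 : z ^+ 2 <= t by nra.
  by nra.
- rewrite gtr0_norm// gtr0_sg//.
  have E1 : 1 < expR x by rewrite expR_gt1.
  have : expR x * expR (- x) = 1 by rewrite -expRD addrN expR0.
  have -> : expR (2 * x) = expR x ^+ 2 by rewrite -expRM_natl mulr_natl.
  move: (expR x) E1 (expR (- x)) (expR_gt0 (- x)) => y y1 z z0 zy.
  have : y ^+ 2 - t <= Num.max (y ^+ 2 - t) 0 by rewrite le_max lexx.
  have : 0 <= Num.max (y ^+ 2 - t) 0 by rewrite le_max lexx orbT.
  move: (Num.max _ _) => M M0 Mt.
  have -> : ((y + z) / 2) ^+ 2 * A + ((y - z) / 2) ^+ 2 * B + 2 *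
     ((y + z) / 2 * ((y - z) / 2) * m) + (((y - z) / 2) ^+ 2 * A + ((y + z) / 2) ^+ 2 * B +
      2 * ((y - z) / 2 * ((y + z) / 2) * m)) =
    y ^+ 2 * ((A + B + 2 * m) / 2) + z ^+ 2 * ((A + B - 2 * m) / 2) by field.
  have z1 : z ^+ 2 <= t by nra.
  by nra.
Qed.

Section Form.
Variables (X : 'rV[R]_q) (w : 'M[K]_q).
Hypothesis wc : mx_contraction w.
Local Notation C := (real_diag F (map_mx (@Defs.cosh R) X)).
Local Notation S := (real_diag F (map_mx (@Defs.sinh R) X)).

Lemma ip_real_diag n (g h : 'rV[R]_n) (a b : 'cV[K]_n) :
  ip (real_diag F g *m a) (real_diag F h *m b) =
  \sum_i g 0 i * h 0 i * sre (sconj (a i 0) * b i 0).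
Proof. by apply: eq_bigr => i _; rewrite big_ord1 !mul_real_diag sre_conjZ. Qed.

Definition Pv (a b : 'cV[K]_q) := C *m a + S *m b.
Definition Nv (a b : 'cV[K]_q) := S *m a + C *m b.

(** The hyperbolic rotation preserves the form |a|^2 - |b|^2. *)
Lemma hyperbolic_isometry a b a' b' :
  ip (Pv a b) (Pv a' b') - ip (Nv a b) (Nv a' b') = ip a a' - ip b b'.
Proof.
rewrite /Pv /Nv !ipDl !ipDr !ip_real_diag /ip -!sumrB -!big_split -!sumrB /=.
apply: eq_bigr => i _; rewrite !big_ord1 !mxE.
have := cosh2_sinh2 (X 0 i); move: (Defs.cosh _) (Defs.sinh _) => c s cs.
have -> : sre (sconj (a i 0) * a' i 0) - sre (sconj (b i 0) * b' i 0) =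
  (c ^+ 2 - s ^+ 2) * (sre (sconj (a i 0) * a' i 0) - sre (sconj (b i 0) * b' i 0)).
  by rewrite cs mul1r.
by ring.
Qed.

(** A form on pairs that extends twice the form |Z(X, w) v|^2 from the diagonal.  For a
    contraction w it is positive, and it also controls the inverse of Z(X, w):
    see [hform_ge]. *)
Definition hform (x y : 'cV[K]_q) :=
  nrm2 (Pv x (w *m y)) + nrm2 (Nv x (w *m y)) + (nrm2 y - nrm2 (w *m y)).

Lemma Pv_Zmx x : Pv x (w *m x) = Zmx X w *m x.
Proof. by rewrite /Pv mulmxDl mulmxA. Qed.

Lemma hform_diag x : hform x x = 2 * nrm2 (Zmx X w *m x).
Proof.
rewrite /hform -Pv_Zmx; have := hyperbolic_isometry x (w *m x) x (w *m x).
rewrite -!nrm2E; lra.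
Qed.

Lemma PvE a b i j : Pv a b i j =
  of_real F (Defs.cosh (X 0 i)) * a i j + of_real F (Defs.sinh (X 0 i)) * b i j.
Proof. by rewrite mxE !mul_real_diag !mxE. Qed.

Lemma NvE a b i j : Nv a b i j =
  of_real F (Defs.sinh (X 0 i)) * a i j + of_real F (Defs.cosh (X 0 i)) * b i j.
Proof. by rewrite mxE !mul_real_diag !mxE. Qed.

Lemma mulmxZr n m p (A : 'M[K]_(n, m)) (B : 'M[K]_(m, p)) s :
  A *m (of_real F s *: B) = of_real F s *: (A *m B).
Proof.
apply/matrixP => i j; rewrite !mxE mulr_sumr; apply: eq_bigr => k _.
by rewrite mxE !mulrA of_realC.
Qed.

(** The hyperbolic isometry turns <x, x'> - <y, y'> into a difference of inner products
    of P and N parts; hence it is bounded by a Cauchy-Schwarz argument for the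
    form in which the sign of the N part is reversed. *)
Lemma hform_ge x y x' y' : hform x' y' = 1 ->
  (ip x x' - ip y y') ^+ 2 <= hform x y.
Proof.
move=> h1; set s := ip x x' - ip y y'.
have H1 := nrm2_ge0 (Pv x (w *m y) - of_real F s *: Pv x' (w *m y')).
have H2 := nrm2_ge0 (Nv x (w *m y) + of_real F s *: Nv x' (w *m y')).
have H3 : 0 <= nrm2 (y + of_real F s *: y') - nrm2 (w *m (y + of_real F s *: y')).
  by rewrite subr_ge0.
have := hyperbolic_isometry x (w *m y) x' (w *m y').
move: h1 H1 H2 H3; rewrite /hform mulmxDr mulmxZr.
move: (Pv x _) (Pv x' _) (Nv x _) (Nv x' _) => P P' N N'.
rewrite nrm2B !nrm2D !nrm2Z !ipZr => h1 H1 H2 H3 H4.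
have E1 : s * ip P P' - s * ip N N' = s * ip x x' - s * ip (w *m y) (w *m y').
  by rewrite -!mulrBr H4.
have E2 : s ^+ 2 = s * ip x x' - s * ip y y' by rewrite -mulrBr.
have E3 : s ^+ 2 * nrm2 P' + s ^+ 2 * nrm2 N' + (s ^+ 2 * nrm2 y' -
    s ^+ 2 * nrm2 (w *m y')) = s ^+ 2.
  by rewrite -mulrBr -!mulrDr h1 mulr1.
lra.
Qed.

Lemma hform_le x y t : 1 <= t ->
  hform x y <= t * (nrm2 x + nrm2 y) +
    \sum_i Num.max (expR (2 * `|X 0 i|) - t) 0 *
      (nsq (x i 0 + of_real F (Num.sg (X 0 i)) * (w *m y) i 0) / 2).
Proof.
move=> t1; have Hw := wc y.
suff H : nrm2 (Pv x (w *m y)) + nrm2 (Nv x (w *m y)) <=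
    t * (nrm2 x + nrm2 (w *m y)) + \sum_i Num.max (expR (2 * `|X 0 i|) - t) 0 *
      (nsq (x i 0 + of_real F (Num.sg (X 0 i)) * (w *m y) i 0) / 2).
  by rewrite /hform; move: H; set M := \sum_i _; nra.
rewrite /nrm2 -!big_split /= mulr_sumr -big_split /=.
apply: ler_sum => i _; rewrite !big_ord1 PvE NvE.
exact: cosh_sinh_form.
Qed.

End Form.

End UpperBound.

(** * Iwasawa exponents are weakly majorized *)

Section WeakMajorization.
Variables (R : realType) (F : scalar_kind) (q : nat).
Local Notation K := (Defs.scalar R F).
Local Notation d := (sdim F).

(** The order of the isotropic flag: e_1, ..., e_q, then the dual vectors in
    reverse order. *)
Definition flag_lt (x y : bool * 'I_q) :=
  match x, y with
  | (false, i), (false, j) => (i < j)%N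
  | (true, i), (true, j) => (j < i)%N
  | (false, _), (true, _) => true
  | (true, _), (false, _) => false
  end.

Section Frame.
Variables (X : 'rV[R]_q) (w k T : 'M[K]_q) (tau : 'I_q -> R) (s : 'S_q).
Hypotheses (wc : mx_contraction w) (uk : unitary_mx k) (Tt : utri T tau).
Hypothesis ZT : forall v : 'cV[K]_q, nrm2 (Zmx X w *m (k *m v)) = nrm2 (T *m v).
Hypothesis sX : sorting X s.
Variables (r : nat) (rq : (r.+1 <= q)%N) (f : 'I_r.+1 -> bool * 'I_q).
Hypothesis f_mono : forall a b : 'I_r.+1, (a < b)%N -> flag_lt (f a) (f b).

(** An increasing choice f of items in the flag order; (false, i) and (true, i) stand
    for the exponents h_i and - h_i. *)
Definition fsel (e : bool) : 'M[K]_(q, r.+1) :=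
  \matrix_(i, a) (f a == (e, i))%:R.

Lemma f_inj : injective f.
Proof.
have irr x : ~~ flag_lt x x by case: x => -[] i /=; rewrite ltnn.
move=> a b fab; apply/val_inj/eqP; rewrite eqn_leq -!(rwP andP).
split; rewrite leqNgt; apply/negP => /f_mono; rewrite fab; exact/negP.
Qed.

Lemma fsel_mul e (g : 'cV[K]_r.+1) i :
  (fsel e *m g) i 0 = \sum_(a | f a == (e, i)) g a 0.
Proof.
rewrite mxE [RHS]big_mkcond; apply: eq_bigr => a _; rewrite mxE.
by case: eqP => _; rewrite ?mul1r ?mul0r.
Qed.

Lemma nrm2_fsel (g : 'cV[K]_r.+1) :
  nrm2 (fsel false *m g) + nrm2 (fsel true *m g) = nrm2 g.
Proof.
rewrite !nrm2E !ip_adjr -ipDr !mulmxA -mulmxDl; congr (ip g _).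
suff -> : adjmx (fsel false) *m fsel false + adjmx (fsel true) *m fsel true =
  1%:M by rewrite mul1mx.
apply/matrixP => a b; rewrite [LHS]mxE [X in X + _]mxE [X in _ + X]mxE.
have sel e (i : 'I_q) : adjmx (fsel e) a i * fsel e i b =
    ((f a == (e, i)) && (f b == (e, i)))%:R.
  rewrite adjmxE !mxE; case: (f a == _); case: (f b == _);
    by rewrite ?sconj1 ?sconj0 ?mulr1 ?mul0r ?mulr0.
under eq_bigr => i _ do rewrite sel.
under [X in _ + X]eq_bigr => i _ do rewrite sel.
have [e [i fa]] : exists e i, f a = (e, i) by case: (f a) => e i; exists e, i.
have S1 e' : \sum_(l < q) ((f a == (e', l)) && (f b == (e', l)))%:R =
    ((e' == e) && (a == b))%:R :> K.
  rewrite (bigD1 i)//= big1 ?addr0 => [|l li].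
    rewrite fa xpair_eqE eqxx andbT eq_sym; case: eqP => //= ->.
    by rewrite -fa (inj_eq f_inj) eq_sym.
  by rewrite fa xpair_eqE [i == l]eq_sym (negPf li) andbF.
rewrite !S1 mxE; case: e {fa S1} => /=; by rewrite ?addr0 ?add0r.
Qed.

Definition isq2 : R := (Num.sqrt 2)^-1.
Lemma isq2_sqr : isq2 ^+ 2 = 1 / 2.
Proof. by rewrite exprVn sqr_sqrtr ?ler0n// mul1r. Qed.

(** The pairs x = k (a + b) / sqrt 2, y = k (a - b) / sqrt 2 on which the hyperbolic form
    is evaluated; a and b are the parts of the coefficient vector that belong to
    items (false, i) and (true, i). *)
Definition frx := of_real F isq2 *: (k *m (fsel false + fsel true)).
Definition fry := of_real F isq2 *: (k *m (fsel false - fsel true)).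

Lemma nrm2_frame (g : 'cV[K]_r.+1) :
  nrm2 (frx *m g) + nrm2 (fry *m g) = nrm2 g.
Proof.
rewrite /frx /fry -!scalemxAl -!mulmxA !nrm2Z !(unitary_nrm2 _ uk) isq2_sqr.
by rewrite !mulmxDl mulNmx nrm2B nrm2D -nrm2_fsel; field.
Qed.

(** The position of the a-th largest |x_i|. *)
Definition topi (a : 'I_r.+1) : 'I_q := s (widen_ord rq a).

(** The coordinates of the frame that belong to the r + 1 largest |x_i|, in the directions
    where the hyperbolic form expands. *)
Definition frG : 'M[K]_r.+1 := of_real F isq2 *: rowsub topi
  (frx + real_diag F (\row_i Num.sg (X 0 i)) *m (w *m fry)).

Lemma frG_coord (g : 'cV[K]_r.+1) a : nsq ((frG *m g) a 0) =
  nsq ((frx *m g) (topi a) 0 +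
    of_real F (Num.sg (X 0 (topi a))) * (w *m (fry *m g)) (topi a) 0) / 2.
Proof.
rewrite /frG -scalemxAl [X in nsq X]mxE nsqM nsq_real isq2_sqr mul1r mulrC.
congr (nsq _ / 2).
have -> : (rowsub topi (frx + real_diag F (\row_i Num.sg (X 0 i)) *m (w *m fry)) *m g) a 0
    = ((frx + real_diag F (\row_i Num.sg (X 0 i)) *m (w *m fry)) *m g) (topi a) 0.
  by rewrite !mxE; apply: eq_bigr => b _; rewrite mxE.
by rewrite mulmxDl mxE -!mulmxA mul_real_diag; congr (_ + of_real F _ * _); rewrite mxE.
Qed.

Lemma sum_topi (g : 'I_q -> R) :
  \sum_(a < r.+1) g (topi a) = \sum_(i < q | (s^-1%g i < r.+1)%N) g i.
Proof.
rewrite [RHS](reindex_inj (@perm_inj _ s)) /=.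
under [RHS]eq_bigl => i do rewrite permK.
by rewrite (big_ord_narrow_cond rq (P := xpredT)).
Qed.

Lemma sum_topi_le (g : 'I_q -> R) : (forall i, 0 <= g i) ->
  \sum_(a < r.+1) g (topi a) <= \sum_i g i.
Proof.
move=> g0; rewrite sum_topi big_mkcond; apply: ler_sum => i _.
by case: ifP.
Qed.

Lemma frG_contraction : mx_contraction frG.
Proof.
move=> g; rewrite {1}/nrm2.
under eq_bigr => a _ do rewrite big_ord1 frG_coord.
pose h i := nsq ((frx *m g) i 0 +
    of_real F (Num.sg (X 0 i)) * (w *m (fry *m g)) i 0) / 2.
apply: (@le_trans _ _ (\sum_i h i)).
  by apply: (@sum_topi_le h) => i; rewrite divr_ge0// nsq_ge0.
rewrite -nrm2_frame; apply: le_trans (_ : nrm2 (frx *m g) + nrm2 (w *m (fry *m g)) <= _).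
  rewrite /nrm2 -big_split; apply: ler_sum => i _ /=; rewrite !big_ord1 /h.
  set a := _ i 0; set b := _ i 0.
  have H : nsq (of_real F (Num.sg (X 0 i)) * b) <= nsq b.
    rewrite nsqM nsq_real ler_piMl ?nsq_ge0//.
    have [->|x0] := eqVneq (X 0 i) 0; first by rewrite sgr0 expr0n.
    by rewrite sqr_sg x0.
  have := nsq_ge0 (a - of_real F (Num.sg (X 0 i)) * b).
  by rewrite !nsqD nsqN mulrN sreN; lra.
by rewrite lerD2l; exact: wc.
Qed.

(** The smallest of the r + 1 largest expansion factors e^(2|x_i|), and the relative
    excess of each of them over it. *)
Definition thr : R := expR (2 * `|X 0 (topi ord_max)|).
Definition exc (a : 'I_r.+1) : R := expR (2 * `|X 0 (topi a)|) / thr - 1.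

Lemma thr_ge1 : 1 <= thr.
Proof. by rewrite -expR0 ler_expR mulr_ge0. Qed.

Lemma exc_ge0 a : 0 <= exc a.
Proof.
rewrite subr_ge0 ler_pdivlMr ?expR_gt0// mul1r ler_expR ler_pM2l//.
by apply: sX; rewrite /= -ltnS.
Qed.

(** A positive definite matrix above the hyperbolic form on the frame.  Its determinant is
    bounded above by the top expansion factors and below by its pivots. *)
Definition frU : 'M[K]_r.+1 := (of_real F thr)%:M *m
  (1%:M + adjmx frG *m (real_diag F (\row_a exc a) *m frG)).

Lemma frU_form (g : 'cV[K]_r.+1) : ip g (frU *m g) =
  thr * (nrm2 g + \sum_a exc a * nsq ((frG *m g) a 0)).
Proof.
rewrite /frU -mulmxA mul_scalar_mx ipZr mulmxDl mul1mx ipDr; congr (_ * (_ + _)).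
rewrite -!mulmxA -ip_adjr; apply: eq_bigr => a _; rewrite big_ord1 mul_real_diag.
by rewrite mulrA -of_realC -mulrA sreZ mxE.
Qed.

Lemma frU_posdef : posdefmx frU.
Proof.
apply/posdefP; split.
  rewrite /frU mul_scalar_mx.
  have -> (A : 'M[K]_r.+1) : adjmx (of_real F thr *: A) = of_real F thr *: adjmx A.
    by apply/matrixP => i j; rewrite !mxE sconjM sconj_real of_realC.
  by rewrite adjmxD adjmx1 !adjmxM adjmxK adj_real_diag mulmxA.
move=> v v0; rewrite frU_form mulr_gt0 ?expR_gt0//.
rewrite ltr_pwDl ?nrm2_gt0// sumr_ge0// => a _.
by rewrite mulr_ge0 ?exc_ge0 ?nsq_ge0.
Qed.

(** Directions beyond the r + 1 largest |x_i| have no excess over the threshold. *)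
Lemma hform_frU (g : 'cV[K]_r.+1) : hform X w (frx *m g) (fry *m g) <= ip g (frU *m g).
Proof.
apply: le_trans (hform_le X wc _ _ thr_ge1) _.
rewrite frU_form nrm2_frame mulrDr lerD2l mulr_sumr.
pose h i := Num.max (expR (2 * `|X 0 i|) - thr) 0 *
   (nsq ((frx *m g) i 0 + of_real F (Num.sg (X 0 i)) * (w *m (fry *m g)) i 0) / 2).
have -> : \sum_a thr * (exc a * nsq ((frG *m g) a 0)) = \sum_(a < r.+1) h (topi a).
  apply: eq_bigr => a _; rewrite frG_coord mulrA; congr (_ * _).
  rewrite /exc mulrBr mulr1 mulrC divfK ?gt_eqF ?expR_gt0// max_l//.
  by have := exc_ge0 a; rewrite /exc subr_ge0 ler_pdivlMr ?expR_gt0// mul1r subr_ge0.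
rewrite (sum_topi h) [leRHS]big_mkcond; apply: ler_sum => i _; case: ifP => // ir.
rewrite /h.
rewrite max_r ?mul0r// subr_le0 ler_expR ler_pM2l//.
rewrite -[i in leLHS](permKV s); apply: sX => /=.
by move/negbT: ir; rewrite -leqNgt => /ltnW.
Qed.

(** Equal to e^(2 h_i) or e^(- 2 h_i) when tau = e^h. *)
Definition pivot (x : bool * 'I_q) : R :=
  if x.1 then (tau x.2)^-1 ^+ 2 else tau x.2 ^+ 2.

(** For an item (false, i) the vector lies on the diagonal, where the form is that of the
    triangular factor.  For an item (true, i) it is paired by [hform_ge] with the
    vector that the triangular factor maps to e_i. *)
Lemma frU_pivot a g : flagv a g -> pivot (f a) <= ip g (frU *m g).
Proof.
move=> [ga gb]; apply: le_trans (hform_frU g).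
case E : (f a) => [[] i] /=; rewrite /pivot /=.
- have [xi [Txi xii xil]] := utri_preimage_delta i Tt.
  pose x' := of_real F isq2 *: (k *m xi).
  have H1 : hform X w x' x' = 1.
    rewrite hform_diag /x' mulmxZr nrm2Z isq2_sqr ZT Txi.
    by rewrite nrm2_delta; field.
  apply: le_trans (hform_ge wc _ _ H1); rewrite -ipNl -ipDl.
  have -> : frx *m g - fry *m g = of_real F isq2 *: (k *m ((fsel true + fsel true) *m g)).
    rewrite /frx /fry -!scalemxAl -scalerBr -!mulmxA -mulmxBr -mulmxBl.
    suff -> : fsel false + fsel true - (fsel false - fsel true) =
      fsel true + fsel true by [].
    by rewrite opprB addrC addrA subrK.
  rewrite /x' ipZl ipZr mulrA -expr2 isq2_sqr (unitary_ip _ _ uk) mulmxDl ipDl.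
  have -> : ip (fsel true *m g) xi = (tau i)^-1.
    rewrite /ip (bigD1 i)//= big_ord1 fsel_mul (big_pred1 a) => [|b /=]; last first.
      by rewrite -E (inj_eq f_inj).
    rewrite ga sconj1 mul1r xii sre_real big1 ?addr0// => l li; rewrite big_ord1.
    have [il|] := ltnP i l; first by rewrite xil// mulr0 sre0.
    rewrite leq_eqVlt -[_ == _]/(l == i) (negPf li) /= => il.
    rewrite fsel_mul big1 ?sconj0 ?mul0r ?sre0// => b /eqP fb; apply: gb.
    rewrite ltnNge; apply/negP; rewrite leq_eqVlt => /orP[/eqP/val_inj ba|/f_mono].
      by move: fb li; rewrite ba E => -[->]; rewrite eqxx.
    by rewrite fb E /= ltnNge ltnW.
  by rewrite le_eqVlt (_ : _ == _) //; apply/eqP; field; case: Tt => _ _ /(_ i); rewrite lt0r => /andP[].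
- have B0 : fsel true *m g = 0.
    apply/matrixP => l j; rewrite ord1 fsel_mul mxE big1// => b /eqP fb; apply: gb.
    rewrite ltnNge; apply/negP; rewrite leq_eqVlt => /orP[/eqP/val_inj ba|/f_mono].
      by move: fb; rewrite ba E.
    by rewrite fb E.
  have -> : fry *m g = frx *m g.
    rewrite /frx /fry -!scalemxAl -!mulmxA; congr (_ *: (_ *m _)).
    by rewrite mulmxBl mulmxDl B0 addr0 subr0.
  rewrite hform_diag /frx -scalemxAl mulmxZr nrm2Z isq2_sqr -mulmxA ZT.
  rewrite mulrA (_ : 2 * (1 / 2) = 1 :> R); last by field.
  rewrite mul1r mulmxDl B0 addr0.
  apply: utri_lower Tt _; split.
    rewrite fsel_mul (big_pred1 a) => [//|b /=].
    by rewrite -E (inj_eq f_inj).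
  move=> l il; rewrite fsel_mul big1// => b /eqP fb; apply: gb.
  rewrite ltnNge; apply/negP; rewrite leq_eqVlt => /orP[/eqP/val_inj ba|/f_mono].
    by move: fb il; rewrite ba E => -[->]; rewrite ltnn.
  by rewrite fb E /= ltnNge ltnW.
Qed.

Lemma prod_pivot_le : \prod_a pivot (f a) <= \prod_a expR (2 * `|X 0 (topi a)|).
Proof.
have piv0 x : 0 <= pivot x by rewrite /pivot; case: ifP => _; rewrite sqr_ge0.
rewrite -(ler_pXn2r (sdim_gt0 F)) ?nnegrE//; last 2 first.
- by apply: prodr_ge0 => a _.
- by apply: prodr_ge0 => a _; rewrite expR_ge0.
rewrite -!prodrXl; apply: le_trans (detR_ge_pivots frU_posdef _ frU_pivot) _ => //.
rewrite /frU detRM (@detR_upper _ _ _ _ (fun=> thr)); last 2 first.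
- by move=> i; rewrite mxE eqxx mulr1n.
- by move=> i j ij; rewrite mxE; case: eqP => // ji; move: ij; rewrite ji ltnn.
apply: (@le_trans _ _ ((\prod_(i < r.+1) thr ^+ d) * \prod_a (1 + exc a) ^+ d)).
  apply: ler_wpM2l; first by apply: prodr_ge0 => a _; rewrite exprn_ge0// expR_ge0.
  by apply: detR_contraction_le; [exact: frG_contraction|exact: exc_ge0].
rewrite -big_split le_eqVlt; apply/orP; left; apply/eqP; apply: eq_bigr => a _ /=.
by rewrite -exprMn /exc addrC subrK mulrC divfK// gt_eqF// expR_gt0.
Qed.

End Frame.

(** A numerical key for the flag order, by which a given family of items can be sorted. *)
Definition flag_key (x : bool * 'I_q) : nat :=
  if x.1 then (q + q - x.2)%N else x.2.

Lemma flag_key_inj : injective flag_key.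
Proof.
move=> [[] i] [[] j] /= H; have := ltn_ord i; have := ltn_ord j;
  rewrite /flag_key /= in H => iq jq.
- by congr (_, _); apply: val_inj; rewrite /=; lia.
- by exfalso; lia.
- by exfalso; lia.
- by congr (_, _); apply: val_inj.
Qed.

Lemma flag_key_lt x y : (flag_key x < flag_key y)%N -> flag_lt x y.
Proof.
by case: x y => [[] i] [[] j]; rewrite /flag_key /=; have := ltn_ord i;
  have := ltn_ord j; lia.
Qed.

(** The chosen signs and indices are items of the flag; once sorted they form a frame, and
    [prod_pivot_le] is the inequality between exponentials of partial sums. *)
Lemma Zmx_wmaj (X : 'rV[R]_q) (w k T : 'M[K]_q) (h : 'rV[R]_q) (s : 'S_q) :
  mx_contraction w -> unitary_mx k -> utri T (fun i => expR (h 0 i)) ->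
  (forall v : 'cV[K]_q, nrm2 (Zmx X w *m (k *m v)) = nrm2 (T *m v)) ->
  sorting X s -> wmaj X s h.
Proof.
move=> wc uk Tt ZT sX r u e.
have E (g : 'I_q -> R) :
    \sum_(i < q | (i < r)%N) g i = \sum_(i < q | (i < minn r q)%N) g i.
  by apply: eq_bigl => i; rewrite leq_min ltn_ord andbT.
rewrite !E; move: (geq_minr r q); case: (minn r q) => [|m] mq {r E}.
  by rewrite !big1.
rewrite !(big_ord_narrow_cond mq (P := xpredT)) /=.
pose item (a : 'I_m.+1) := (e (widen_ord mq a), u (widen_ord mq a)).
have item_inj : injective item.
  by move=> a b [_ /perm_inj/(congr1 val) /= ab]; apply: val_inj.
have [p pP] := sort_perm (fun a => - (flag_key (item a))%:R : R).
have mono (a b : 'I_m.+1) : (a < b)%N -> flag_lt (item (p a)) (item (p b)).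
  move=> ab; apply: flag_key_lt; rewrite ltn_neqAle.
  have := pP _ _ (ltnW ab); rewrite lerN2 ler_nat => ->; rewrite andbT.
  apply/negP => /eqP/flag_key_inj/item_inj/perm_inj abE.
  by move: ab; rewrite abE ltnn.
have := prod_pivot_le wc uk Tt ZT sX mq mono.
rewrite -expR_sum.
have -> : \prod_a pivot (fun i => expR (h 0 i)) (item (p a)) =
    \prod_a pivot (fun i => expR (h 0 i)) (item a).
  by rewrite [RHS](reindex_inj (@perm_inj _ p)).
have -> : \prod_a pivot (fun i => expR (h 0 i)) (item a) =
    \prod_a expR (2 * ((-1) ^+ e (widen_ord mq a) * h 0 (u (widen_ord mq a)))).
  apply: eq_bigr => a _; rewrite /pivot /=; case: (e _) => /=.
    by rewrite -expRN -expRM_natl -mulr_natl expr1 mulN1r.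
  by rewrite -expRM_natl -mulr_natl expr0 mul1r.
rewrite -expR_sum ler_expR -!mulr_sumr ler_pM2l//.
Qed.

End WeakMajorization.

(** * Attained exponents: transfers between neighbours *)

Section Attained.
Variables (R : realType) (F : scalar_kind) (q : nat).
Local Notation K := (Defs.scalar R F).

Lemma Ugroup_unitary (k : 'M[K]_q) : Ugroup k -> unitary_mx k.
Proof. by case. Qed.

Lemma Ugroup1 : Ugroup (1%:M : 'M[K]_q).
Proof. by split; [exact: unitary1|case: F => //=; rewrite det1]. Qed.

Lemma UgroupM (k l : 'M[K]_q) : Ugroup k -> Ugroup l -> Ugroup (k *m l).
Proof.
move=> [uk dk] [ul dl]; split; first exact: unitaryM.
by case: F k l uk dk ul dl => //= k l _ dk _ dl; rewrite det_mulmx dk dl mulr1.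
Qed.

(** A square has positive determinant, whence SO(q) in the real case. *)
Lemma unitary_square_det1 (g : 'M[K]_q) : unitary_mx g ->
  match F return 'M[Defs.scalar R F]_q -> Prop with
  | Reals => fun k => \det (k : 'M[R]_q) = 1
  | _ => fun _ => True
  end (g *m g).
Proof.
case: F g => //= g /(congr1 (fun A : 'M[R]_q => \det A)).
rewrite det1 !det_mulmx => <-; congr (_ * _).
by rewrite /adjmx (_ : map_mx _ _ = g^T) ?det_tr//; apply/matrixP => a b; rewrite !mxE.
Qed.

(** The matrix that acts by a given 2 x 2 block in the plane of e_i and e_j. *)
Definition plane (i j : 'I_q) (m00 m01 m10 m11 : K) : 'M[K]_q :=
  \matrix_(a, b) if b == i then (if a == i then m00 else if a == j then m10 else 0)
    else if b == j then (if a == i then m01 else if a == j then m11 else 0)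
    else (a == b)%:R.

Section Plane.
Variables (i j : 'I_q).
Hypothesis ij : i != j.
Let ji : j == i = false. Proof. by rewrite eq_sym (negPf ij). Qed.

Lemma mul_plane (A : 'M[K]_q) m00 m01 m10 m11 a b :
  (A *m plane i j m00 m01 m10 m11) a b =
  if b == i then A a i * m00 + A a j * m10
  else if b == j then A a i * m01 + A a j * m11 else A a b.
Proof.
rewrite mxE; case: (eqVneq b i) => [->|bi].
  rewrite (bigD1 i)//= (bigD1 j)/=; last by rewrite ji.
  rewrite !mxE !eqxx ji big1 ?addr0// => l /andP[li lj].
  by rewrite mxE eqxx (negPf li) (negPf lj) mulr0.
case: (eqVneq b j) => [->|bj].
  rewrite (bigD1 i)//= (bigD1 j)/=; last by rewrite ji.
  rewrite !mxE !eqxx ji big1 ?addr0// => l /andP[li lj].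
  by rewrite mxE eqxx ji (negPf li) (negPf lj) mulr0.
rewrite (bigD1 b)//= mxE (negPf bi) (negPf bj) eqxx mulr1 big1 ?addr0// => l lb.
by rewrite mxE (negPf bi) (negPf bj) (negPf lb) mulr0.
Qed.

Lemma plane_mul (A : 'M[K]_q) m00 m01 m10 m11 a b :
  (plane i j m00 m01 m10 m11 *m A) a b =
  if a == i then m00 * A i b + m01 * A j b
  else if a == j then m10 * A i b + m11 * A j b else A a b.
Proof.
rewrite mxE; case: (eqVneq a i) => [->|ai].
  rewrite (bigD1 i)//= (bigD1 j)/=; last by rewrite ji.
  rewrite !mxE !eqxx ji big1 ?addr0// => l /andP[li lj].
  by rewrite mxE (negPf li) (negPf lj) eq_sym (negPf li) mul0r.
case: (eqVneq a j) => [->|aj].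
  rewrite (bigD1 i)//= (bigD1 j)/=; last by rewrite ji.
  rewrite !mxE !eqxx ji big1 ?addr0// => l /andP[li lj].
  by rewrite mxE (negPf li) (negPf lj) eq_sym (negPf lj) mul0r.
rewrite (bigD1 a)//= mxE (negPf ai) (negPf aj) eqxx mul1r big1 ?addr0// => l la.
rewrite mxE (negPf ai) (negPf aj) [a == l]eq_sym (negPf la).
by case: ifP => _; [rewrite mul0r|case: ifP => _; rewrite mul0r].
Qed.

Lemma planeM m00 m01 m10 m11 n00 n01 n10 n11 :
  plane i j m00 m01 m10 m11 *m plane i j n00 n01 n10 n11 =
  plane i j (m00 * n00 + m01 * n10) (m00 * n01 + m01 * n11)
            (m10 * n00 + m11 * n10) (m10 * n01 + m11 * n11).
Proof.
apply/matrixP => a b; rewrite plane_mul !mxE !eqxx ji.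
case: (b =P i) => [bE|/eqP bi].
  by case: (a =P i) => [_|_]; case: (a =P j).
case: (b =P j) => [bE|/eqP bj].
  by case: (a =P i) => [_|_]; case: (a =P j).
rewrite [i == b]eq_sym [j == b]eq_sym (negPf bi) (negPf bj) !mulr0 !addr0.
case: (a =P i) => [->|_]; first by rewrite eq_sym (negPf bi).
by case: (a =P j) => [->|_] //; rewrite eq_sym (negPf bj).
Qed.

Lemma plane1 : plane i j 1 0 0 1 = 1%:M.
Proof.
apply/matrixP => a b; rewrite !mxE.
case: (b =P i) => [->|_]; first by case: (a =P i); case: (a =P j).
case: (b =P j) => [->|//].
by case: (a =P i) => [->|_]; rewrite ?(negPf ij)//; case: (a =P j).
Qed.

Lemma adj_plane m00 m01 m10 m11 : adjmx (plane i j m00 m01 m10 m11) =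
  plane i j (sconj m00) (sconj m10) (sconj m01) (sconj m11).
Proof.
apply/matrixP => a b; rewrite adjmxE !mxE [b == a]eq_sym.
case: (a =P i) => [aE|/eqP ai].
  case: (b =P i) => [bE|/eqP bi]; first by [].
  case: (b =P j) => [bE|/eqP bj]; first by [].
  by rewrite aE [i == b]eq_sym (negPf bi) sconj0.
case: (a =P j) => [aE|/eqP aj].
  case: (b =P i) => [bE|/eqP bi]; first by [].
  case: (b =P j) => [bE|/eqP bj]; first by [].
  by rewrite aE [j == b]eq_sym (negPf bj) sconj0.
case: (b =P i) => [bE|/eqP bi]; first by rewrite bE (negPf ai) sconj0.
case: (b =P j) => [bE|/eqP bj]; first by rewrite bE (negPf aj) sconj0.
by case: eqP => _; rewrite ?sconj1 ?sconj0.
Qed.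

Variable u : K.
Hypothesis u1 : nsq u = 1.

(** A rotation conjugated by the phase u, so that it acts on the entry u |T_ij| as a real
    rotation does on |T_ij|. *)
Definition givens (c s : R) : 'M[K]_q :=
  plane i j (of_real F c) (- (u * of_real F s)) (sconj u * of_real F s) (of_real F c).

Lemma uuC : u * sconj u = 1.
Proof. by rewrite mul_sconj u1 of_real1. Qed.
Lemma Cuu : sconj u * u = 1.
Proof. by rewrite sconj_mul u1 of_real1. Qed.

Lemma urC (a b : R) : u * of_real F a * (sconj u * of_real F b) = of_real F (a * b).
Proof. by rewrite of_realM -mulrA (mulrA _ (sconj u)) of_realC !mulrA uuC mul1r. Qed.
Lemma Cur (a b : R) : sconj u * of_real F a * (u * of_real F b) = of_real F (a * b).
Proof. by rewrite of_realM -mulrA (mulrA _ u) of_realC !mulrA Cuu mul1r. Qed.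

Lemma givensM c s c' s' : givens c s *m givens c' s' =
  givens (c * c' - s * s') (c * s' + s * c').
Proof.
rewrite /givens planeM; congr plane.
- by rewrite mulNr urC -of_realM -of_realN -of_realD.
- rewrite mulrN mulrA of_realC -mulrA -of_realM mulNr -mulrA -of_realM -opprD.
  by rewrite -mulrDr -of_realD.
- rewrite -mulrA -of_realM mulrA of_realC -mulrA -of_realM -mulrDr -of_realD.
  by rewrite addrC.
- by rewrite mulrN Cur -of_realM -of_realN -of_realD addrC.
Qed.

Lemma adj_givens c s : adjmx (givens c s) = givens c (- s).
Proof.
rewrite /givens adj_plane !sconj_real sconjN !sconjM !sconjK !sconj_real.
by congr plane; rewrite of_realN ?mulrN ?opprK of_realC.
Qed.

Lemma givens_unitary c s : c ^+ 2 + s ^+ 2 = 1 -> unitary_mx (givens c s).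
Proof.
move=> cs; rewrite /unitary_mx adj_givens givensM.
have -> : c * c - - s * s = 1 by rewrite -cs; ring.
have -> : c * s + - s * c = 0 by ring.
by rewrite /givens of_real1 of_real0 !mulr0 oppr0 plane1.
Qed.

(** A rotation is the square of the rotation by half its angle. *)
Lemma givens_Ugroup c s : c ^+ 2 + s ^+ 2 = 1 -> Ugroup (givens c s).
Proof.
move=> cs; split; first exact: givens_unitary.
have [c' [s' [cs' cE sE]]] : exists c' s',
    [/\ c' ^+ 2 + s' ^+ 2 = 1, c = c' * c' - s' * s' & s = c' * s' + s' * c'].
  have [c1|c1] := eqVneq c (-1).
    by exists 0, 1; rewrite c1; split; [ring|ring|]; move: cs; rewrite c1; nra.
  have c1' : 0 < 1 + c.
    rewrite lt_neqAle; apply/andP; split; last by nra.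
    by rewrite eq_sym addrC addr_eq0.
  pose c' := Num.sqrt ((1 + c) / 2).
  have c'0 : c' != 0 by rewrite gt_eqF// sqrtr_gt0 divr_gt0.
  have c'2 : c' ^+ 2 = (1 + c) / 2 by rewrite sqr_sqrtr// ltW// divr_gt0.
  have s'2 : (s / (2 * c')) ^+ 2 = (1 - c) / 2.
    rewrite expr_div_n exprMn c'2.
    have -> : s ^+ 2 = (1 + c) * (1 - c) by nra.
    by field; rewrite gt_eqF.
  exists c', (s / (2 * c')); split; last by field.
    by rewrite c'2 s'2; field.
  by rewrite -!expr2 c'2 s'2; field.
by rewrite cE sE -givensM; exact/unitary_square_det1/givens_unitary.
Qed.

End Plane.

(** The norms of the images of unit vectors under the triangular block with rows (a, be)
    and (0, c0) take every value between a and c0: for t such a value the quadratic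
    form |B z|^2 - t^2 |z|^2 is indefinite, hence has an isotropic vector (x, 1). *)
Lemma isotropic_rotation (a c0 t be : R) : 0 < a -> 0 < c0 -> 0 < t ->
  between a c0 t -> exists c s, c ^+ 2 + s ^+ 2 = 1 /\
    (a * c + be * s) ^+ 2 + (c0 * s) ^+ 2 = t ^+ 2.
Proof.
move=> a0 c00 t0 bw.
have [at_|at_] := eqVneq a t.
  by exists 1, 0; split; [ring|rewrite at_; ring].
(* the leading coefficient and a quarter of the discriminant *)
pose A := a ^+ 2 - t ^+ 2; pose D := t ^+ 2 * be ^+ 2 - A * (c0 ^+ 2 - t ^+ 2).
have A0 : A != 0 by rewrite subr_eq0 eqrXn2 ?ltW.
have D0 : 0 <= D.
  have P : (a - t) * (c0 - t) <= 0.
    by move: bw; rewrite /between => /orP[|] /andP[? ?]; nra.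
  have -> : D = t ^+ 2 * be ^+ 2 - (a - t) * (c0 - t) * ((a + t) * (c0 + t)).
    by rewrite /D /A; ring.
  rewrite subr_ge0; apply: (@le_trans _ _ 0).
    by rewrite mulr_le0_ge0// mulr_ge0// addr_ge0// ltW.
  by rewrite mulr_ge0// sqr_ge0.
pose x := (Num.sqrt D - a * be) / A.
have xE : A * x ^+ 2 + 2 * a * be * x + (be ^+ 2 + c0 ^+ 2 - t ^+ 2) = 0.
  have AxE : A * x = Num.sqrt D - a * be by rewrite mulrC divfK.
  have : A * (A * x ^+ 2 + 2 * a * be * x + (be ^+ 2 + c0 ^+ 2 - t ^+ 2)) = 0.
    transitivity ((A * x) ^+ 2 + 2 * a * be * (A * x) + A * (be ^+ 2 + c0 ^+ 2 - t ^+ 2)).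
      by ring.
    rewrite AxE; have : Num.sqrt D ^+ 2 = D by rewrite sqr_sqrtr.
    by move: (Num.sqrt D) => y; rewrite /D /A => yE; ring: yE.
  by move/eqP; rewrite mulf_eq0 (negPf A0) => /eqP.
have n0 : 0 < x ^+ 2 + 1 by rewrite ltr_wpDl ?sqr_ge0.
pose n := Num.sqrt (x ^+ 2 + 1).
have n2 : n ^+ 2 = x ^+ 2 + 1 by rewrite sqr_sqrtr// ltW.
have nn0 : n != 0 by rewrite gt_eqF// sqrtr_gt0.
have n20 : n ^+ 2 != 0 by rewrite expf_neq0.
exists (x / n), (1 / n); split.
  have -> : (x / n) ^+ 2 + (1 / n) ^+ 2 = (x ^+ 2 + 1) / n ^+ 2 by field.
  by rewrite -n2 divff.
have -> : (a * (x / n) + be * (1 / n)) ^+ 2 + (c0 * (1 / n)) ^+ 2 =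
  ((a * x + be) ^+ 2 + c0 ^+ 2) / n ^+ 2 by field.
apply: (mulIf n20); rewrite divfK// n2.
by move: xE; rewrite /A => xE; nra.
Qed.

Variable X : 'rV[R]_q.

(** The values h = HA (Z(X, w) k) with w in the closed ball, the Iwasawa factor e^h n being
    written as one triangular matrix T. *)
Definition attained : set 'rV[R]_q := [set h | exists w k k' T : 'M[K]_q,
  [/\ mx_contraction w, Ugroup k, Ugroup k', utri T (fun i => expR (h 0 i)) &
      Zmx X w *m k = k' *m T]].

(** For w = 1 the matrix Z(X, w) is e^X. *)
Lemma attained_self : attained X.
Proof.
exists 1%:M, 1%:M, 1%:M, (real_diag F (map_mx (@expR R) X)); split.
- by move=> v; rewrite mul1mx.
- exact: Ugroup1.
- exact: Ugroup1.
- split=> [i|i j ij|i]; rewrite ?expR_gt0// real_diagE ?eqxx ?mxE//.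
  by case: eqP => // ij'; move: ij; rewrite ij' ltnn.
rewrite mulmx1 mul1mx /Zmx mulmx1; apply/matrixP => i j.
rewrite [LHS]mxE !real_diagE; case: eqP => [_|]; last by rewrite addr0.
by rewrite !mxE -of_realD /Defs.cosh /Defs.sinh; congr of_real; field.
Qed.

(** Rotating k in the plane of e_i and e_j changes the norm of the i-th column of the
    triangular block continuously; a rotation of k' restores triangularity, and the
    product of the two diagonal entries is preserved. *)
Lemma attained_adj : adj_closed attained.
Proof.
move=> h i j al [w [k [k' [T [wc Uk Uk' [Td Tl _] E]]]]] jE bw.
have ij : i != j by rewrite -val_eqE /=; lia.
have iltj : (i < j)%N by rewrite jE.
set a := expR (h 0 i); set c0 := expR (h 0 j); set t := expR al.
have a0 : 0 < a by exact: expR_gt0.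
have c00 : 0 < c0 by exact: expR_gt0.
have t0 : 0 < t by exact: expR_gt0.
have tN : t != 0 by rewrite gt_eqF.
pose be := Num.sqrt (nsq (T i j)).
have [u [u1 uE]] : exists u : K, nsq u = 1 /\ T i j = u * of_real F be.
  have [b0|b0] := eqVneq (T i j) 0.
    exists 1; rewrite nsq1; split => //.
    by rewrite /be b0 nsq0 sqrtr0 of_real0 mulr0.
  have be0 : 0 < be.
    rewrite sqrtr_gt0 lt0r nsq_ge0 andbT; apply: contra b0 => /eqP/nsq0_eq0 ->//.
  exists (T i j * of_real F be^-1); split.
    rewrite nsqM nsq_real exprVn sqr_sqrtr ?nsq_ge0// divff//.
    by apply: contra b0 => /eqP/nsq0_eq0 ->.
  by rewrite -mulrA realV_mul ?mulr1// gt_eqF.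
have bw' : between a c0 t by rewrite /between !ler_expR.
have [c [s [cs csE]]] := isotropic_rotation be a0 c00 t0 bw'.
pose c' := (a * c + be * s) / t; pose s' := c0 * s / t.
have cs' : c' ^+ 2 + s' ^+ 2 = 1.
  by rewrite /c' /s' !expr_div_n -mulrDl csE divff// expf_neq0.
pose k2 := givens i j u c s; pose k3 := givens i j u c' s'.
have Uk2 : Ugroup k2 by exact: givens_Ugroup.
have Uk3 : Ugroup k3 by exact: givens_Ugroup.
exists w, (k *m k2), (k' *m k3), (adjmx k3 *m (T *m k2)); split => //.
- exact: UgroupM.
- exact: UgroupM.
- have ji : j == i = false by rewrite eq_sym (negPf ij).
  pose B := T *m k2.
  have Bi x : B x i = T x i * of_real F c + T x j * (sconj u * of_real F s).
    by rewrite /B mul_plane// eqxx.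
  have Bj x : B x j = - (T x i * (u * of_real F s)) + T x j * of_real F c.
    by rewrite /B mul_plane// ji eqxx mulrN.
  have Bo x y : y != i -> y != j -> B x y = T x y.
    by move=> yi yj; rewrite /B mul_plane// (negPf yi) (negPf yj).
  have Bii : B i i = of_real F (a * c + be * s).
    by rewrite Bi Td uE urC// -of_realM -of_realD.
  have Bji : B j i = sconj u * of_real F (c0 * s).
    rewrite Bi (Tl j i)// mul0r add0r Td mulrA of_realC -mulrA -of_realM//.
  have Bij : B i j = u * of_real F (be * c - a * s).
    rewrite Bj Td uE mulrA of_realC -!mulrA -!of_realM -mulrN -mulrDr -of_realN.
    by rewrite -of_realD addrC.
  have Bjj : B j j = of_real F (c0 * c).
    by rewrite Bj (Tl j i)// mul0r oppr0 add0r Td -of_realM.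
  have T'E x y : (adjmx k3 *m B) x y =
     if x == i then of_real F c' * B i y + u * of_real F s' * B j y
     else if x == j then - (sconj u * of_real F s') * B i y + of_real F c' * B j y
     else B x y.
    rewrite /k3 adj_givens plane_mul// of_realN !mulrN opprK//.
  split=> [x|x y xy|x]; last exact: expR_gt0.
  + rewrite T'E [upd2 _ _ _ _ _ 0 x]mxE; case: (eqVneq x i) => [->|xi].
      rewrite Bii Bji urC// -!of_realM -of_realD; congr of_real; rewrite -/t.
      rewrite /c' /s'; apply: (mulIf tN); rewrite -expr2 -csE; field.
      by [].
    case: (eqVneq x j) => [->|xj].
      rewrite Bij Bjj mulNr Cur// -!of_realM -of_realN -of_realD; congr of_real.
      rewrite expRB expRD -/a -/c0 -/t /c' /s'.
      transitivity (a * c0 * (c ^+ 2 + s ^+ 2) / t); last by rewrite cs mulr1.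
      by field.
    by rewrite Bo// Td.
  + rewrite T'E; case: (eqVneq x i) => [xi|xi].
      have yi : (y < i)%N by rewrite -xi.
      have yNi : y != i by rewrite -val_eqE neq_ltn yi.
      have yNj : y != j by rewrite -val_eqE neq_ltn (ltn_trans yi).
      by rewrite !Bo// !Tl ?mulr0 ?addr0// (ltn_trans yi).
    case: (eqVneq x j) => [xj|xj].
      have [->|yi] := eqVneq y i.
        rewrite Bii Bji mulNr -mulrA -of_realM mulrA of_realC -mulrA -of_realM.
        rewrite -mulrN -mulrDr -of_realN -of_realD (_ : _ + _ = 0) ?of_real0 ?mulr0//.
        by rewrite /c' /s'; field.
      have yi' : (y < i)%N.
        by rewrite ltn_neqAle -[_ == _]/(y == i) yi /= -ltnS -jE -xj.
      have yNj : y != j by rewrite -val_eqE neq_ltn (ltn_trans yi').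
      by rewrite !Bo// !Tl ?mulr0 ?addr0// (ltn_trans yi').
    have xgj : (i < x)%N -> (j < x)%N.
      move=> ix; rewrite ltn_neqAle [_ == _](_ : _ = (j == x))// eq_sym xj jE//.
    have [yi|yi] := eqVneq y i.
      rewrite yi in xy *; rewrite Bi !Tl ?mul0r ?addr0//; exact: xgj.
    have [yj|yj] := eqVneq y j.
      rewrite yj in xy *; rewrite Bj !Tl ?mul0r ?oppr0 ?addr0//.
      exact: ltn_trans xy.
    by rewrite Bo// Tl.
- rewrite mulmxA E -mulmxA -[k' *m k3 *m _]mulmxA; congr (_ *m _).
  by rewrite mulmxA unitary_mulmxV ?mul1mx//; exact: Ugroup_unitary.
Qed.

End Attained.

(** * Attained exponents: shrinking the last coordinate *)

Section AttainedLast.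
Variables (R : realType) (F : scalar_kind) (q : nat).
Local Notation K := (Defs.scalar R F).

(** Cauchy-Schwarz for a positive semidefinite Hermitian form, with values in
    the scalars. *)
Lemma form_CS n (A : 'M[K]_n) (x z : 'cV[K]_n) : adjmx A = A ->
  (forall v : 'cV[K]_n, 0 <= ip v (A *m v)) ->
  nsq ((adjmx z *m (A *m x)) 0 0) <= ip z (A *m z) * ip x (A *m x).
Proof.
move=> AH A0; set mu := (adjmx z *m (A *m x)) 0 0.
have real_CS (a b : 'cV[K]_n) : ip a (A *m b) ^+ 2 <= ip a (A *m a) * ip b (A *m b).
  have H s : 0 <= ip a (A *m a) + s ^+ 2 * ip b (A *m b) - 2 * s * ip a (A *m b).
    have := A0 (a - of_real F s *: b).
    rewrite mulmxBr !ipDl !ipDr !ipNl !ipNr mulmxZr !ipZl !ipZr.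
    have -> : ip b (A *m a) = ip a (A *m b) by rewrite ipC ip_adjr AH.
    lra.
  have [b0|b0] := eqVneq (ip b (A *m b)) 0.
    rewrite b0 mulr0; have := H ((ip a (A *m a) + 1) / ip a (A *m b)).
    have := A0 a; rewrite b0; move: (ip a (A *m a)) (ip a (A *m b)) => p m p0.
    have [->|m0] := eqVneq m 0; first by rewrite expr0n.
    by rewrite mulr0 addr0 -mulrA divfK//; lra.
  have bp : 0 < ip b (A *m b) by rewrite lt0r b0 A0.
  have := H (ip a (A *m b) / ip b (A *m b)).
  rewrite -(pmulr_lge0 _ bp).
  move: (ip b _) bp b0 (ip a (A *m a)) (ip a (A *m b)) => p p0 pn al m.
  have -> : (al + (m / p) ^+ 2 * p - 2 * (m / p) * m) * p = al * p - m ^+ 2 by field.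
  by rewrite subr_ge0.
have [m0|m0] := eqVneq mu 0; first by rewrite m0 nsq0 mulr_ge0.
have mp : 0 < nsq mu.
  by rewrite lt0r nsq_ge0 andbT; apply: contra m0 => /eqP/nsq0_eq0 ->.
have E1 : ip (z *m mu%:M) (A *m x) = nsq mu.
  by rewrite ip_adjr /ip !big_ord1 -/mu [X in sconj X]mxE eqxx mulr1n.
have E2 : ip (z *m mu%:M) (A *m (z *m mu%:M)) = nsq mu * ip z (A *m z).
  have AzE : adjmx z *m (A *m z) = (of_real F (ip z (A *m z)))%:M.
    apply/matrixP => i j; rewrite !ord1 [RHS]mxE eqxx mulr1n.
    rewrite -sre_form -mulmxA; apply: sconj_fixed.
    by rewrite -adjmxE !adjmxM adjmxK AH mulmxA.
  rewrite ip_adjr mulmxA mulmxA -[adjmx z *m A *m z]mulmxA AzE /ip !big_ord1.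
  rewrite mul_scalar_mx !mxE !eqxx !mulr1n of_realC mulrA -of_realC sreZ.
  by rewrite mulrC.
have := real_CS (z *m mu%:M) x; rewrite E1 E2 expr2 -!mulrA ler_pM2l//.
Qed.

Variable X : 'rV[R]_q.

(** Let v and y be the last columns of k and k'.  Changing w to w' = w + (c - w v) v^*
    affects only the last column of T, and its diagonal entry becomes al + z^* c with
    al = y^* cosh X v and z = sinh X y.  As w' is a contraction if c c^* <= A, where
    A = 1 - w w^* + (w v) (w v)^*, the best choice is c = A z la with
    la = (t - al) / (z^* A z).  It is admissible if and only if |t - al|^2 is at most
    z^* A z = |al|^2 - 1, that is t + 1 / t <= 2 Re al.  This holds for t0 = e^(h_i),
    and so for every t = e^a with |a| <= |h_i|. *)
Lemma attained_last : last_closed (attained F X).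
Proof.
move=> h i a [w [k [k' [T [wc Uk Uk' Tt E]]]]] iq ah.
have uk := Ugroup_unitary Uk; have uk' := Ugroup_unitary Uk'.
have [Td Tl _] := Tt.
have iP (x : 'I_q) : (i < x)%N = false by apply/negbTE; rewrite -leqNgt -ltnS iq.
pose ei : 'cV[K]_q := delta_mx i 0; pose v := k *m ei; pose y := k' *m ei.
set C := real_diag F (map_mx (@Defs.cosh R) X).
set S := real_diag F (map_mx (@Defs.sinh R) X).
have ei1 : nrm2 ei = 1 by exact: nrm2_delta.
have v1 : nrm2 v = 1 by rewrite unitary_nrm2.
have y1 : nrm2 y = 1 by rewrite unitary_nrm2.
have HC : adjmx C = C := adj_real_diag F _.
have HS : adjmx S = S := adj_real_diag F _.
pose z := S *m y; set t0 := expR (h 0 i); set t := expR a.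
have t00 : 0 < t0 by exact: expR_gt0.
have tp : 0 < t by exact: expR_gt0.
(* y is orthogonal to all the columns of Z k but the last one *)
have ZyE : adjmx (Zmx X w) *m y = v *m (of_real F t0)%:M.
  have : adjmx ei *m T = of_real F t0 *: adjmx ei.
    apply/matrixP => a0 b; rewrite ord1 mxE (bigD1 i)//= big1 => [|l li].
      rewrite adjmxE !mxE !eqxx sconj1 mul1r addr0 eq_sym.
      case: (eqVneq i b) => [<-|ib]; first by rewrite Td ?eqxx sconj1 mulr1.
      rewrite sconj0 mulr0 Tl//; rewrite ltn_neqAle.
      by rewrite [_ == _](_ : _ = (b == i))// eq_sym ib /= leqNgt iP.
    by rewrite adjmxE mxE (negPf li) sconj0 mul0r.
  move=> /(congr1 (@adjmx R F _ _)); rewrite adjmxM adjmxK.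
  have -> : adjmx (of_real F t0 *: adjmx ei) = ei *m (of_real F t0)%:M.
    apply/matrixP => x b; rewrite ord1 !mxE big_ord1 !mxE eqxx mulr1n.
    by rewrite sconjM sconjK sconj_real.
  move=> TE; rewrite /v -mulmxA -TE.
  have -> : adjmx T *m ei = adjmx (k' *m T) *m y.
    by rewrite adjmxM -mulmxA /y [adjmx k' *m _]mulmxA uk' mul1mx.
  by rewrite -E adjmxM !mulmxA unitary_mulmxV// mul1mx.
have wzE : adjmx w *m z = v *m (of_real F t0)%:M - C *m y.
  rewrite -ZyE /Zmx adjmxD adjmxM HC HS mulmxDl -mulmxA addrC addKr//.
pose al := (adjmx y *m (C *m v)) 0 0.
have vCy : (adjmx v *m (C *m y)) 0 0 = sconj al.
  by rewrite /al -adjmxE !adjmxM !adjmxK HC !mulmxA.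
have vv : adjmx v *m v = 1%:M.
  by rewrite /v adjmxM mulmxA -[_ *m adjmx k *m k]mulmxA uk mulmx1;
  apply/matrixP => r c; rewrite !ord1 !mxE eqxx (bigD1 i)//= !mxE !eqxx sconj1 mul1r
   big1 ?addr0// => l li; rewrite !mxE (negPf li) mulr0.
have CSy : nrm2 (C *m y) = nrm2 z + 1.
  rewrite -y1 /z /C /S /nrm2 -big_split /=; apply: eq_bigr => x _; rewrite !big_ord1.
  rewrite !mul_real_diag !nsqM !nsq_real !mxE; have := cosh2_sinh2 (X 0 x).
  by move: (Defs.cosh _) (Defs.sinh _) => c s cs; rewrite -[X in _ + X]mul1r -cs; ring.
have ipvCy : ip v (C *m y) = sre al.
  by rewrite -(sre_conj al) -vCy mxE sre_sum /ip; apply: eq_bigr => x _;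
  rewrite big_ord1 adjmxE.
have vt : nrm2 (v *m (of_real F t0)%:M) = t0 ^+ 2.
  have -> : v *m (of_real F t0)%:M = of_real F t0 *: v.
    by apply/matrixP => x b; rewrite ord1 !mxE big_ord1 !mxE eqxx mulr1n of_realC.
  by rewrite nrm2Z v1 mulr1.
have vwz : (adjmx v *m (adjmx w *m z)) 0 0 = of_real F t0 - sconj al.
  by rewrite wzE mulmxBr mulmxA vv mul1mx !mxE eqxx mulr1n -vCy mxE.
have nwz : nrm2 (adjmx w *m z) = t0 ^+ 2 - 2 * t0 * sre al + nrm2 z + 1.
  rewrite wzE nrm2B vt CSy.
  have -> : v *m (of_real F t0)%:M = of_real F t0 *: v.
    by apply/matrixP => x b; rewrite ord1 !mxE big_ord1 !mxE eqxx mulr1n of_realC.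
  by rewrite ipZl ipvCy; ring.
have vk : adjmx v *m k = adjmx ei.
  by rewrite /v adjmxM -mulmxA uk mulmx1.
have zk (b : 'cV[K]_q) : adjmx z *m b = adjmx ei *m (adjmx k' *m (S *m b)).
  by rewrite /z /y !adjmxM HS -!mulmxA.
clearbody v z.
have t0al : t0 ^+ 2 + 1 <= 2 * t0 * sre al.
  by have := contraction_adj wc z; rewrite nwz; lra.
(* t + 1 / t increases with |log t| *)
have tal : t ^+ 2 + 1 <= 2 * t * sre al.
  have T0 : t0 + t0^-1 <= 2 * sre al.
    rewrite -(ler_pM2l t00) mulrDr divff ?gt_eqF//; nra.
  have T1 : t + t^-1 <= t0 + t0^-1.
    have cosh_abs (b : R) : expR b + (expR b)^-1 = expR `|b| + (expR `|b|)^-1.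
      by have [b0|b0] := leP 0 b; [rewrite ger0_norm|rewrite ltr0_norm// expRN invrK addrC].
    rewrite /t /t0 (cosh_abs a) (cosh_abs (h 0 i)).
    have : expR `|a| <= expR `|h 0 i| by rewrite ler_expR.
    have : 1 <= expR `|a| by rewrite -expR0 ler_expR.
    move: (expR `|a|) (expR `|h 0 i|) => A B A1 AB.
    have A0 : A != 0 by rewrite gt_eqF// (lt_le_trans _ A1).
    have B0 : B != 0 by rewrite gt_eqF// (lt_le_trans _ (le_trans A1 AB)).
    rewrite -subr_ge0.
    have -> : B + B^-1 - (A + A^-1) = (B - A) * ((A * B - 1) / (A * B)).
      by field; apply/andP.
    by rewrite mulr_ge0 ?subr_ge0// divr_ge0//; nra.
  have := le_trans T1 T0; rewrite -(ler_pM2l tp) mulrDr divff ?gt_eqF//; nra.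
pose A := 1%:M - w *m adjmx w + (w *m v) *m adjmx (w *m v).
have AE (x : 'cV[K]_q) : ip x (A *m x) =
    nrm2 x - nrm2 (adjmx w *m x) + nsq ((adjmx v *m (adjmx w *m x)) 0 0).
  rewrite /A mulmxDl mulmxBl mul1mx ipDr ipDr ipNr -!mulmxA.
  rewrite ![ip x (w *m _)]ip_adjl -nrm2E; congr (_ + _).
  rewrite [ip _ (v *m _)]ip_adjl adjmxM -mulmxA -nrm2E.
  by rewrite /nrm2 !big_ord1.
have A0 (x : 'cV[K]_q) : 0 <= ip x (A *m x).
  by rewrite AE addr_ge0 ?nsq_ge0// subr_ge0; exact: contraction_adj.
have HA' : adjmx A = A.
  by rewrite /A adjmxD adjmxB adjmx1 !adjmxM !adjmxK.
have AzE : ip z (A *m z) = nsq al - 1.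
  rewrite AE nwz vwz nsqD nsqN nsq_conj nsq_real sconj_real mulrN sreN sreZ sre_conj.
  ring.
set rho2 := ip z (A *m z) in AzE.
have nta : nsq (of_real F t - al) <= rho2.
  by rewrite AzE nsqD nsqN nsq_real sconj_real mulrN sreN sreZ; lra.
(* if rho2 = 0 then t = al, and any value of la will do *)
pose la := of_real F rho2^-1 * (of_real F t - al).
have rla : of_real F rho2 * la = of_real F t - al.
  rewrite /la mulrA -of_realM; have [r0|r0] := eqVneq rho2 0.
    rewrite r0 mul0r of_real0 mul0r; apply/esym/nsq0_eq0/le_anti.
    by rewrite nsq_ge0 andbT -r0.
  by rewrite divff// of_real1 mul1r.
have nla : nsq la * rho2 <= 1.
  rewrite /la nsqM nsq_real; have [->|r0] := eqVneq rho2 0; first by rewrite mulr0.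
  have rp : 0 < rho2 by rewrite lt0r r0 A0.
  have -> (N : R) : rho2^-1 ^+ 2 * N * rho2 = N / rho2 by field.
  by rewrite ler_pdivrMr// mul1r.
pose c := (A *m z) *m la%:M.
pose w' := w + (c - w *m v) *m adjmx v.
exists w', k, k', (T + adjmx k' *m (S *m (c - w *m v)) *m adjmx ei); split => //.
- rewrite -[w']adjmxK; apply: contraction_adj => x.
  have -> : adjmx w' *m x = (adjmx w *m x - v *m (adjmx v *m (adjmx w *m x)))
      + v *m (adjmx c *m x).
    rewrite /w' adjmxD adjmxM adjmxK adjmxB adjmxM mulmxDl -mulmxA mulmxBl mulmxBr.
    by rewrite -!mulmxA addrA addrAC.
  have orth (b : 'cV[K]_q) (m : 'cV[K]_1) : nrm2 (b - v *m (adjmx v *m b) + v *m m) =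
      nrm2 b - nrm2 (adjmx v *m b) + nrm2 m.
    have vm (x1 x2 : 'cV[K]_1) : ip (v *m x1) (v *m x2) = ip x1 x2.
      by rewrite ip_adjr mulmxA vv mul1mx.
    have h1 (m' : 'cV[K]_1) : ip b (v *m m') = ip (adjmx v *m b) m' by rewrite ip_adjl.
    rewrite nrm2D nrm2B [nrm2 (v *m m)]nrm2E [nrm2 (v *m (_ *m _))]nrm2E !vm.
    by rewrite ipDl ipNl vm !h1 -!nrm2E; ring.
  rewrite orth.
  have n11 (m : 'cV[K]_1) : nrm2 m = nsq (m 0 0) by rewrite /nrm2 !big_ord1.
  rewrite !n11.
  have cx : nsq ((adjmx c *m x) 0 0) <= ip x (A *m x).
    have -> : (adjmx c *m x) 0 0 = sconj la * (adjmx z *m (A *m x)) 0 0.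
      rewrite /c !adjmxM HA' -!mulmxA mxE big_ord1; congr (_ * _).
      by rewrite !mxE eqxx.
    rewrite nsqM nsq_conj; apply: (@le_trans _ _ (nsq la * (rho2 * ip x (A *m x)))).
      by rewrite ler_wpM2l ?nsq_ge0// form_CS.
    by rewrite mulrA ler_piMl.
  move: cx; rewrite AE; lra.
- set g := adjmx k' *m _.
  have gE x y0 : (T + g *m adjmx ei) x y0 = T x y0 + (if y0 == i then g x 0 else 0).
    rewrite [LHS]mxE; congr (_ + _); rewrite [LHS]mxE big_ord1 adjmxE [ei _ _]mxE.
    rewrite eqxx andbT.
    by case: eqP => _; rewrite ?sconj1 ?sconj0 ?mulr1 ?mulr0.
  have gi : g i 0 = of_real F t - of_real F t0.
    have -> : g i 0 = (adjmx z *m (c - w *m v)) 0 0.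
      rewrite zk -/g.
      rewrite [RHS]mxE (bigD1 i)//= adjmxE [ei _ _]mxE !eqxx sconj1 mul1r big1 ?addr0// => l li.
      by rewrite adjmxE [ei _ _]mxE (negPf li) sconj0 mul0r.
    rewrite mulmxBr mxE /c mulmxA.
    have -> : (adjmx z *m (A *m z) *m la%:M) 0 0 = of_real F t - al.
      rewrite mxE big_ord1 [la%:M _ _]mxE eqxx mulr1n.
      have -> : (adjmx z *m (A *m z)) 0 0 = of_real F rho2.
        rewrite /rho2 -sre_form -mulmxA; apply: sconj_fixed.
        by rewrite -adjmxE !adjmxM adjmxK HA' mulmxA.
      exact: rla.
    have -> : (- (adjmx z *m (w *m v))) 0 0 = - (of_real F t0 - al).
      rewrite mxE; congr (- _).
      have -> : adjmx z *m (w *m v) = adjmx (adjmx v *m (adjmx w *m z)).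
        by rewrite !adjmxM !adjmxK mulmxA.
      by rewrite adjmxE vwz sconjD sconjN sconjK sconj_real.
    by rewrite opprB addrA subrK.
  split=> [x|x y0 xy|x]; last exact: expR_gt0.
  + rewrite gE [upd1 _ _ _ 0 x]mxE Td; case: (eqVneq x i) => [->|_]; last by rewrite addr0.
    by rewrite gi addrC subrK.
  + rewrite gE Tl// add0r; case: eqP => // yi; move: xy; rewrite yi iP//.
- have -> : Zmx X w' = Zmx X w + S *m (c - w *m v) *m adjmx v.
    by rewrite /w' /Zmx mulmxDr addrA mulmxA.
  rewrite mulmxDl E [RHS]mulmxDr; congr (_ + _).
  rewrite -!mulmxA vk.
  by rewrite [RHS]mulmxA unitary_mulmxV// mul1mx.
Qed.

Lemma weyl_hull_attained : weyl_hull X `<=` attained F X.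
Proof.
have [s sX] := sortingP X; rewrite (weyl_hull_wmaj sX) => h.
apply: (wmaj_in_closed sX).
- exact: attained_adj.
- exact: attained_last.
- exact: attained_self.
Qed.

End AttainedLast.

(** * The Iwasawa decomposition *)

Section Iwasawa.
Variables (R : realType) (F : scalar_kind) (q : nat).
Local Notation K := (Defs.scalar R F).

(** What distinguishes the identity component among invertible matrices. *)
Definition pos_det (g : 'M[K]_q) : Prop :=
  match F return 'M[Defs.scalar R F]_q -> Prop with
  | Reals => fun g => 0 < \det (g : 'M[R]_q)
  | _ => fun _ => True
  end g.

Definition iwasawa (g : 'M[K]_q) (h : 'rV[R]_q) :=
  exists k n : 'M[K]_q, [/\ Ugroup k, upper_unipotent n &
    g = k *m real_diag F (map_mx (@expR R) h) *m n].

(** In an Iwasawa decomposition of g the factor e^h n is the Cholesky factor of g^* g. *)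
Lemma iwasawa_utri g h : iwasawa g h -> exists T : 'M[K]_q,
  utri T (fun i => expR (h 0 i)) /\ adjmx T *m T = adjmx g *m g.
Proof.
move=> [k [n [Uk [n1 nl] ->]]]; exists (real_diag F (map_mx (@expR R) h) *m n); split.
  split=> [i|i j ij|i]; rewrite ?expR_gt0 ?mul_real_diag ?mxE//.
    by rewrite n1 mulr1.
  by rewrite nl// mulr0.
rewrite -!mulmxA [in RHS]adjmxM -[RHS]mulmxA [X in _ = _ *m X]mulmxA.
by rewrite (Ugroup_unitary Uk) mul1mx.
Qed.

Lemma iwasawa_uniq g h h' : iwasawa g h -> iwasawa g h' -> h = h'.
Proof.
move=> /iwasawa_utri[T [Tt TE]] /iwasawa_utri[T' [Tt' TE']].
apply/rowP => i; apply: expR_inj.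
have := utri_gram_uniq Tt Tt'; rewrite TE TE' => /(_ erefl).
by move=> /(congr1 (fun f => f i)).
Qed.

Lemma HA_iwasawa g h : iwasawa g h -> HA g = h.
Proof.
move=> gh; apply: (@iwasawa_uniq g) => //.
exact: (@xgetI _ 0 (iwasawa g) h gh).
Qed.

Lemma HA_cases g : HA g = 0 \/ iwasawa g (HA g).
Proof.
have [[h gh]|N] := pselect (exists h, iwasawa g h).
  by right; rewrite (HA_iwasawa gh).
by left; rewrite /HA xgetPN// => h gh; apply: N; exists h.
Qed.

(** The unitary factor g T^-1 has positive determinant, so it belongs to SO(q) in the
    real case. *)
Lemma iwasawaI (g T : 'M[K]_q) (h : 'rV[R]_q) : utri T (fun i => expR (h 0 i)) ->
  adjmx T *m T = adjmx g *m g -> pos_det g -> iwasawa g h.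
Proof.
move=> Tt TE dg; have [S TS ST] := utri_invertible Tt.
have [Td Tl _] := Tt.
have uk : unitary_mx (g *m S).
  rewrite /unitary_mx adjmxM mulmxA -(mulmxA (adjmx S)) -TE.
  by rewrite mulmxA -adjmxM TS adjmx1 mul1mx.
have gE : g = g *m S *m T by rewrite -mulmxA ST mulmx1.
exists (g *m S), (real_diag F (map_mx (@expR R) (- h)) *m T); split.
- split => //; move: (g *m S) gE uk dg Td Tl => k gE uk dg Td Tl.
  rewrite /pos_det gE in dg; move: k T {Tt TE TS ST gE S g} uk dg Td Tl.
  case: F => //= k T uk dg Td Tl.
  have dT : 0 < \det T.
    rewrite -det_tr det_trig; last by apply/is_trig_mxP => i j ij; rewrite mxE Tl.
    by apply: prodr_gt0 => i _; rewrite mxE Td expR_gt0.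
  have := congr1 (fun A : 'M[R]_q => \det A) uk; rewrite /= det_mulmx det1.
  have -> : adjmx (k : 'M[Defs.scalar R Reals]_q) = k^T.
    by apply/matrixP => a b; rewrite !mxE.
  rewrite det_tr; move: dg; rewrite det_mulmx pmulr_lgt0// => dk /eqP.
  rewrite -expr2 sqrf_eq1 => /orP[/eqP//|/eqP dk1].
  by move: dk; rewrite dk1 oppr_gt0 ltr10.
- split=> [i|i j ij]; rewrite mul_real_diag.
    by rewrite Td -of_realM !mxE -expRD addNr expR0 of_real1.
  by rewrite Tl// mulr0.
- rewrite {1}gE -!mulmxA; congr (_ *m (_ *m _)).
  apply/matrixP => i j; rewrite !mul_real_diag mulrA -of_realM !mxE -expRD addrN.
  by rewrite expR0 of_real1 mul1r.
Qed.

(** By the intermediate value theorem the determinant keeps its sign along a segment of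
    invertible matrices. *)
Lemma pos_det_path (g g0 : 'M[K]_q) : pos_det g0 ->
  (forall s (v : 'cV[K]_q), 0 <= s <= 1 -> v != 0 ->
    (g0 + of_real F s *: (g - g0)) *m v != 0) -> pos_det g.
Proof.
rewrite /pos_det; move: g g0; case: F => //= g g0 d0 H.
have detN s : 0 <= s <= 1 -> \det (g0 + s *: (g - g0)) != 0.
  move=> s01; rewrite -det_tr; apply/det0P => -[v v0].
  move=> /(congr1 trmx); rewrite trmx_mul trmxK trmx0 => /eqP.
  by apply/negP/H => //; rewrite -(inj_eq trmx_inj) trmxK trmx0.
pose P : 'M[{poly R}]_q := map_mx polyC g0 + 'X *: map_mx polyC (g - g0).
have PE s : (\det P).[s] = \det (g0 + s *: (g - g0)).
  rewrite -[LHS]/(horner_eval s (\det P)) -det_map_mx; congr (\det _).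
  apply/matrixP => i j; rewrite [LHS]mxE /P !mxE.
  by rewrite -[LHS]/(_.[s]) !hornerE.
rewrite ltNge; apply/negP => d1.
have [|s s01] := @poly_ivt R (- \det P) 0 1 ler01.
  rewrite !hornerN !PE scale0r addr0 scale1r addrC subrK oppr_le0 oppr_ge0.
  by rewrite (ltW d0).
by rewrite rootN /root PE => /eqP sr; move: (detN s s01); rewrite sr eqxx.
Qed.

Lemma Ugroup_pos_det (k T : 'M[K]_q) t : Ugroup k -> utri T t -> pos_det (k *m T).
Proof.
rewrite /pos_det => -[_]; move: k T; case: F => //= k T dk [Td Tl t0].
rewrite det_mulmx dk mul1r -det_tr det_trig.
  by apply: prodr_gt0 => i _; rewrite mxE Td t0.
by apply/is_trig_mxP => i j ij; rewrite mxE Tl.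
Qed.

(** If Z(X, w) v = 0 then the hyperbolic isometry gives |v|^2 - |w v|^2 = - |N|^2, so that
    N = 0 as well, and the hyperbolic rotation is invertible. *)
Lemma Zmx_inj X (w : 'M[K]_q) (v : 'cV[K]_q) : mx_contraction w ->
  Zmx X w *m v = 0 -> v = 0.
Proof.
move=> wc Zv; have := hyperbolic_isometry X v (w *m v) v (w *m v).
rewrite -!nrm2E Pv_Zmx Zv nrm20 sub0r => H.
have N0 : Nv X v (w *m v) = 0.
  by apply: nrm20_eq0; have := wc v; have := nrm2_ge0 (Nv X v (w *m v)); lra.
apply/matrixP => i j; rewrite ord1 [RHS]mxE.
have := congr1 (fun A : 'cV[K]_q => A i 0) Zv; rewrite -Pv_Zmx /= PvE [RHS]mxE => E1.
have := congr1 (fun A : 'cV[K]_q => A i 0) N0; rewrite /= NvE [RHS]mxE => E2.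
have : of_real F (Defs.cosh (X 0 i)) * (of_real F (Defs.cosh (X 0 i)) * v i 0 +
      of_real F (Defs.sinh (X 0 i)) * (w *m v) i 0) -
   of_real F (Defs.sinh (X 0 i)) * (of_real F (Defs.sinh (X 0 i)) * v i 0 +
      of_real F (Defs.cosh (X 0 i)) * (w *m v) i 0) = 0.
  by rewrite E1 E2 !mulr0 subr0.
rewrite !mulrDr opprD addrACA !mulrA -!of_realM [Defs.sinh _ * Defs.cosh _]mulrC.
rewrite subrr addr0 -mulrBl -of_realN -of_realD -!expr2 cosh2_sinh2 of_real1 mul1r//.
Qed.

(** Openness: near an Iwasawa decomposition the decomposition exists and its
    abelian part varies continuously, both because pivots are extremal values. *)
Lemma iwasawa_near (k0 T0 : 'M[K]_q) (h0 : 'rV[R]_q) (eps : R) : Ugroup k0 ->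
  utri T0 (fun i => expR (h0 0 i)) -> 0 < eps ->
  exists2 del, 0 < del & forall g : 'M[K]_q, nrm (g - k0 *m T0) <= del ->
    exists2 h, iwasawa g h & forall i : 'I_q, `|h 0 i - h0 0 i| < eps.
Proof.
move=> Uk0 Tt0 eps0; set g0 := k0 *m T0.
have [S0 TS ST] := utri_invertible Tt0.
have g0v (v : 'cV[K]_q) : nrm (g0 *m v) = nrm (T0 *m v).
  by rewrite /nrm /g0 -mulmxA (unitary_nrm2 _ (Ugroup_unitary Uk0)).
have vle (v : 'cV[K]_q) : nrm v <= nrm S0 * nrm (g0 *m v).
  by rewrite g0v -{1}[v]mul1mx -ST -mulmxA nrm_mul.
pose eta := 1 - expR (- (eps / 2)).
have e2 : 0 < eps / 2 by rewrite divr_gt0.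
have eta0 : 0 < eta by rewrite subr_gt0 expR_lt1 oppr_lt0.
have eta1 : eta < 1 by rewrite ltrBlDr ltrDl expR_gt0.
have S0p : 0 < nrm S0 + 1 by rewrite ltr_wpDl ?nrm_ge0.
exists (eta / (nrm S0 + 1)); first exact: divr_gt0.
move=> g gd.
have Dv (v : 'cV[K]_q) : nrm ((g - g0) *m v) <= eta * nrm (g0 *m v).
  apply: le_trans (nrm_mul _ _) _; apply: (@le_trans _ _ (eta / (nrm S0 + 1) * nrm v)).
    by rewrite ler_wpM2r ?nrm_ge0.
  rewrite -mulrA ler_pM2l// mulrC ler_pdivrMr//.
  apply: le_trans (vle v) _; rewrite mulrC ler_wpM2l ?nrm_ge0//.
  by rewrite lerDl.
have g0_gt0 (v : 'cV[K]_q) : v != 0 -> 0 < nrm (g0 *m v).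
  move=> v0; rewrite lt0r nrm_ge0 andbT; apply: contra v0 => /eqP gv.
  have := vle v; rewrite gv mulr0 => nv; apply/eqP/nrm20_eq0.
  by apply/eqP; rewrite -nrm_sqr sqrf_eq0; apply/eqP/le_anti; rewrite nv nrm_ge0.
have path s (v : 'cV[K]_q) : 0 <= s <= 1 ->
    (1 - eta) * nrm (g0 *m v) <= nrm ((g0 + of_real F s *: (g - g0)) *m v).
  move=> /andP[s0 s1]; rewrite mulrBl mul1r lerBlDr.
  have -> : g0 *m v = (g0 + of_real F s *: (g - g0)) *m v - of_real F s *: ((g - g0) *m v).
    by rewrite mulmxDl scalemxAl addrK.
  apply: le_trans (nrmD _ _) _; rewrite lerD2l nrmN nrmZ ger0_norm//.
  have -> : (g0 + of_real F s *: (g - g0)) *m v - of_real F s *: ((g - g0) *m v) = g0 *m v.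
    by rewrite mulmxDl scalemxAl addrK.
  by apply: le_trans (Dv v); rewrite ler_piMl ?nrm_ge0.
have lo (v : 'cV[K]_q) : (1 - eta) * nrm (g0 *m v) <= nrm (g *m v).
  have := path 1 v; rewrite ler01 lexx of_real1 scale1r [g0 + _]addrC subrK; exact.
have hi (v : 'cV[K]_q) : nrm (g *m v) <= (1 + eta) * nrm (g0 *m v).
  rewrite -[g in leLHS](subrK g0) mulmxDl; apply: le_trans (nrmD _ _) _.
  by rewrite mulrDl mul1r addrC lerD2l.
have [T [t [Tt TE]]] : exists T t, utri T t /\ adjmx T *m T = adjmx g *m g.
  apply/cholesky/posdef_gram => v v0; rewrite -nrm_sqr exprn_gt0//.
  by apply: lt_le_trans (lo v); rewrite mulr_gt0 ?subr_gt0 ?g0_gt0.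
have t_gt0 i : 0 < t i by case: Tt.
pose h : 'rV[R]_q := \row_i ln (t i).
have hE : (fun i => expR (h 0 i)) = t.
  by apply/funext => i; rewrite mxE lnK// posrE.
exists h.
  apply: (iwasawaI (T := T)) => //; first by rewrite hE.
  apply: (@pos_det_path g g0); first exact: Ugroup_pos_det Tt0.
  move=> s v s01 v0; apply/eqP => E; have := path s v s01.
  rewrite E nrm0 leNgt mulr_gt0 ?subr_gt0 ?g0_gt0//.
have sq_nrm (A B : 'M[K]_q) c : 0 <= c ->
    (forall v : 'cV[K]_q, nrm (A *m v) <= c * nrm (B *m v)) ->
    forall v : 'cV[K]_q, nrm2 (A *m v) <= c ^+ 2 * nrm2 (B *m v).
  move=> c0 AB v; rewrite -!nrm_sqr -exprMn lerXn2r// nnegrE ?nrm_ge0//.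
  by rewrite mulr_ge0 ?nrm_ge0.
have gT (v : 'cV[K]_q) : nrm (T *m v) = nrm (g *m v) by rewrite /nrm (gram_nrm2 _ TE).
have H1 := utri_le Tt Tt0 (@sq_nrm T T0 (1 + eta) (addr_ge0 ler01 (ltW eta0)) _).
have H2 := utri_le Tt0 Tt (@sq_nrm T0 T (1 - eta)^-1 _ _).
move=> i.
have e0 : 0 < expR (h0 0 i) := expR_gt0 _.
have {}H1 : t i <= (1 + eta) * expR (h0 0 i).
  have A : 0 <= (1 + eta) * expR (h0 0 i) by apply: mulr_ge0; [apply: addr_ge0 => //; exact: ltW|exact: ltW].
  rewrite -(ler_pXn2r (n := 2))// ?nnegrE//; last exact: ltW.
  rewrite exprMn.
  by apply: H1 => v; rewrite gT -g0v.
have {}H2 : expR (h0 0 i) <= (1 - eta)^-1 * t i.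
  have A : 0 <= (1 - eta)^-1 * t i by apply: mulr_ge0; [rewrite invr_ge0 subr_ge0; exact: (ltW eta1)|exact: ltW].
  rewrite -(ler_pXn2r (n := 2))// ?nnegrE//.
  rewrite exprMn.
  apply: H2 => [|v]; first by rewrite invr_ge0 subr_ge0 ltW.
  by rewrite ler_pdivlMl ?subr_gt0// gT -g0v.
have tE : t i = expR (h 0 i) by rewrite -hE.
apply: (@le_lt_trans _ _ (eps / 2)); last by rewrite ltr_pdivrMr// ltr_pMr// ltr1n.
have ee : expR (- (eps / 2)) = 1 - eta by rewrite /eta opprB addrC subrK.
rewrite ler_norml -ler_expR -[X in _ && X]ler_expR !expRB -tE; apply/andP; split.
  rewrite ee ler_pdivlMr// -ler_pdivlMl ?subr_gt0//.
rewrite ler_pdivrMr//; apply: le_trans H1 _; rewrite ler_pM2r//.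
have -> : expR (eps / 2) = (1 - eta)^-1 by rewrite -ee expRN invrK.
by rewrite -[leRHS]mul1r ler_pdivlMr ?subr_gt0//; nra.
Qed.

End Iwasawa.

(** * The spectral theorem and Hermitian determinants *)

(** An eigenvalue of the complexified matrix is real by symmetry, and the real or the
    imaginary part of an eigenvector is an eigenvector. *)
Lemma symmetric_eigenvector (R : realType) n (M : 'M[R]_n) : (0 < n)%N -> M^T = M ->
  exists y l, y != 0 /\ M *m y = l *: y :> 'cV[R]_n.
Proof.
move=> n0 MT; pose MC := map_mx (real_complex R) M.
have [a /eigenvalueP[x xM x0]] := eigenvalue_closed MC n0.
pose xr := map_mx (@complex.Re R) x; pose xi := map_mx (@complex.Im R) x.
have [E1 E2] : xr *m M = complex.Re a *: xr - complex.Im a *: xi /\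
               xi *m M = complex.Re a *: xi + complex.Im a *: xr.
  split; apply/rowP => j; have := congr1 (fun A : 'rV[R[i]]_n => A 0 j) xM;
    rewrite !mxE => /(congr1 (fun z => (complex.Re z, complex.Im z))) /=.
  - case: a {xM} => ar ai; case: (x 0 j) => br bi /= -[<- _].
    by rewrite raddf_sum; apply: eq_bigr => k _; rewrite !mxE; case: (x 0 k) => c e /=; ring.
  - case: a {xM} => ar ai; case: (x 0 j) => br bi /= -[_ <-].
    by rewrite raddf_sum; apply: eq_bigr => k _; rewrite !mxE; case: (x 0 k) => c e /=; ring.
have symm : xr *m M *m xi^T = (xi *m M *m xr^T)^T.
  by rewrite !trmx_mul trmxK MT mulmxA.
have ai0 : complex.Im a = 0.
  have dC : (xi *m xr^T) 0 0 = (xr *m xi^T) 0 0.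
    by rewrite !mxE; apply: eq_bigr => k _; rewrite !mxE mulrC.
  have sq (z : 'rV[R]_n) : (z *m z^T) 0 0 = \sum_j z 0 j ^+ 2.
    by rewrite mxE; apply: eq_bigr => k _; rewrite mxE expr2.
  have lin (A B : 'M[R]_1) b c : (b *: A + c *: B) 0 0 = b * A 0 0 + c * B 0 0.
    by rewrite !mxE.
  have := congr1 (fun A : 'M[R]_1 => A 0 0) symm.
  rewrite /= [RHS]mxE E1 E2 -scaleNr !mulmxDl -!scalemxAl !lin dC !sq => H.
  have : complex.Im a * (\sum_j xr 0 j ^+ 2 + \sum_j xi 0 j ^+ 2) = 0 by lra.
  move/eqP; rewrite mulf_eq0 => /orP[/eqP//|/eqP s0]; exfalso.
  have p1 (z : 'rV[R]_n) : 0 <= \sum_j z 0 j ^+ 2 by apply: sumr_ge0 => k _; rewrite sqr_ge0.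
  have := p1 xr; have := p1 xi => H1 H2.
  have /psumr_eq0P Z1 : \sum_j xr 0 j ^+ 2 = 0 by lra.
  have /psumr_eq0P Z2 : \sum_j xi 0 j ^+ 2 = 0 by lra.
  move: x0; apply/negP; rewrite negbK; apply/eqP/rowP => k; rewrite mxE.
  have : complex.Re (x 0 k) = 0.
    by apply/eqP; have /eqP := Z1 (fun k _ => sqr_ge0 _) k isT; rewrite sqrf_eq0 mxE.
  have : complex.Im (x 0 k) = 0.
    by apply/eqP; have /eqP := Z2 (fun k _ => sqr_ge0 _) k isT; rewrite sqrf_eq0 mxE.
  by case: (x 0 k) => /= ? ? -> ->.
rewrite ai0 !scale0r ?subr0 ?addr0 in E1 E2.
have row_col (z : 'rV[R]_n) : z *m M = complex.Re a *: z -> M *m z^T = complex.Re a *: z^T.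
  by move=> /(congr1 trmx); rewrite trmx_mul MT linearZ.
have [r0|r0] := eqVneq xr 0.
  exists xi^T, (complex.Re a); split; last exact: row_col.
  rewrite -(inj_eq trmx_inj) trmxK trmx0; apply: contra x0 => /eqP i0.
  apply/eqP/rowP => k; rewrite mxE.
  have := congr1 (fun A : 'rV[R]_n => A 0 k) r0; have := congr1 (fun A : 'rV[R]_n => A 0 k) i0.
  by rewrite !mxE; case: (x 0 k) => /= ? ? -> ->.
exists xr^T, (complex.Re a); split; last exact: row_col.
by rewrite -(inj_eq trmx_inj) trmxK trmx0.
Qed.

Section Spectral.
Variables (R : realType) (F : scalar_kind).
Local Notation K := (Defs.scalar R F).
Local Notation d := (sdim F).

(** An eigenvector of the real form, read as a vector of scalars. *)
Lemma hermitian_eigenvector n (A : 'M[K]_n) : (0 < n)%N -> adjmx A = A ->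
  exists v l, v != 0 /\ A *m v = of_real F l *: v :> 'cV[K]_n.
Proof.
move=> n0 AH.
have [||y [l [y0 yl]]] := @symmetric_eigenvector R _ (realify A).
- by rewrite muln_gt0 n0 sdim_gt0.
- by rewrite -realify_adj AH.
pose v : 'cV[K]_n := \col_a \sum_(k < d) sbasis R F k * of_real F (y (opair a k) 0).
have vk a (k : nat) (kd : (k < d)%N) : scoord (v a 0) k = y (opair a (Ordinal kd)) 0.
  rewrite mxE scoord_sum (bigD1 (Ordinal kd))//= scoordZ scoord_basis// eqxx mul1r.
  rewrite big1 ?addr0// => m mk; rewrite scoordZ scoord_basis//.
  by case: eqP => [E|]; rewrite ?mul0r//; move: mk; rewrite -val_eqE /= E eqxx.
exists v, l; split.
  apply: contra y0 => /eqP v0; apply/eqP/matrixP => i j; rewrite ord1 [RHS]mxE.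
  have := vk (odiv i) (omod i) (ltn_ord (omod i)).
  rewrite v0 mxE /scoord mulr0 sre0 => ->; congr (y _ _).
  by rewrite -[LHS]opairK; congr opair; apply: val_inj.
apply/matrixP => a j; rewrite ord1 mxE [RHS]mxE; apply: scoord_inj => k kd.
rewrite of_realC scoordZ vk scoord_sum.
have := congr1 (fun M : 'cV[R]_(n * d) => M (opair a (Ordinal kd)) 0) yl.
rewrite /= [RHS]mxE mulrC => <-; rewrite mxE.
transitivity (\sum_(b < n) \sum_(m < d) smat (A a b) k m * y (opair b m) 0).
  apply: eq_bigr => b _; rewrite mxE mulr_sumr scoord_sum; apply: eq_bigr => m _.
  by rewrite mulrA scoordZ.
rewrite -(big_odiv (F := F) _ (fun b m => smat (A a b) k m * y (opair b m) 0)).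
by apply: eq_bigr => i _; rewrite mxE odivK omodK opairK.
Qed.

(** The Householder reflection that exchanges e_0 and v; it exists because their inner
    product is real. *)
Lemma unitary_first_col n (v : 'cV[K]_(1 + n)) : nrm2 v = 1 ->
  v 0 0 = of_real F (sre (v 0 0)) ->
  exists u, [/\ unitary_mx u, adjmx u = u & u *m (delta_mx 0 0 : 'cV[K]_(1 + n)) = v].
Proof.
move=> v1 v0; set e : 'cV[K]_(1 + n) := delta_mx 0 0.
have e1 : nrm2 e = 1 by exact: nrm2_delta.
have [->|ve] := eqVneq v e.
  by exists 1%:M; rewrite mul1mx adjmx1; split => //; exact: unitary1.
pose z := v - e; pose N := nrm2 z.
have N0 : 0 < N by rewrite nrm2_gt0// subr_eq0.
have NE : N = 2 - 2 * sre (v 0 0).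
  rewrite /N /z nrm2B v1 e1; congr (_ - 2 * _).
  rewrite /ip (bigD1 0)//= big_ord1 mxE !eqxx mulr1 sre_conj big1 ?addr0// => l l0.
  by rewrite big_ord1 mxE (negPf l0) mulr0 sre0.
have zz : adjmx z *m z = (of_real F N)%:M.
  apply/matrixP => i j; rewrite !ord1 [RHS]mxE eqxx mulr1n mxE of_real_sum.
  by apply: eq_bigr => k _; rewrite big_ord1 adjmxE sconj_mul.
pose u := 1%:M - of_real F (2 / N) *: (z *m adjmx z).
have uH : adjmx u = u.
  rewrite /u adjmxB adjmx1; congr (_ - _); apply/matrixP => i j.
  have scE (M : 'M[K]_(1 + n)) a b s : (of_real F s *: M) a b = of_real F s * M a b.
    by rewrite mxE.
  rewrite adjmxE !scE sconjM sconj_real of_realC -adjmxE.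
  by rewrite adjmxM adjmxK.
exists u; split => //.
  rewrite /unitary_mx uH /u mulmxBl mul1mx mulmxBr mulmx1 mulmxZr -scalemxAl.
  rewrite -mulmxA [adjmx z *m (z *m _)]mulmxA zz mul_scalar_mx mulmxZr !scalerA -!of_realM.
  have -> : 2 / N * (2 / N) * N = 2 / N + 2 / N by field; rewrite gt_eqF.
  by rewrite of_realD scalerDl opprB addrK subrK.
rewrite /u mulmxBl mul1mx -scalemxAl -mulmxA.
have -> : adjmx z *m e = (of_real F (sre (v 0 0) - 1))%:M.
  apply/matrixP => i j; rewrite !ord1 [RHS]mxE eqxx mulr1n mxE (bigD1 0)//=.
  rewrite [e _ _]mxE eqxx mulr1 big1 ?addr0 => [|l l0]; last first.
    by rewrite [e _ _]mxE (negPf l0) mulr0.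
  rewrite adjmxE [z _ _]mxE [(- e) _ _]mxE [e _ _]mxE eqxx v0 sconjD sconjN sconj1 sconj_real.
  by rewrite of_realD of_realN of_real1 sre_real.
have -> : z *m (of_real F (sre (v 0 0) - 1))%:M = of_real F (sre (v 0 0) - 1) *: z.
  by apply/matrixP => i j; rewrite ord1 !mxE big_ord1 !mxE eqxx mulr1n of_realC.
rewrite scalerA -of_realM.
have -> : 2 / N * (sre (v 0 0) - 1) = - 1.
  have -> : sre (v 0 0) - 1 = - (N / 2) by rewrite NE; field.
  by field; rewrite gt_eqF.
by rewrite of_realN of_real1 scaleN1r opprK addrC subrK.
Qed.

Lemma real_diag_row_mx m n (a : 'rV[R]_m) (b : 'rV[R]_n) :
  real_diag F (row_mx a b) = block_mx (real_diag F a) 0 0 (real_diag F b).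
Proof.
apply/matrixP => i j; rewrite real_diagE.
case: (split_ordP i) => k ->; case: (split_ordP j) => l ->;
  rewrite ?block_mxEul ?block_mxEur ?block_mxEdl ?block_mxEdr ?real_diagE
    ?eq_lshift ?eq_rshift ?eq_lrshift ?eq_rlshift ?row_mxEl ?row_mxEr ?mxE //.
Qed.

Lemma spectral_theorem n (A : 'M[K]_n) : adjmx A = A ->
  exists (u : 'M[K]_n) (l : 'rV[R]_n),
    unitary_mx u /\ A = u *m real_diag F l *m adjmx u.
Proof.
elim: n A => [|n IH] A AH.
  by exists 1%:M, 0; split; [exact: unitary1|apply/matrixP => -[]].
have [v' [l [v'0 v'E]]] := hermitian_eigenvector (ltn0Sn n) AH.
have [v [v1 vr vE]] : exists v : 'cV[K]_n.+1,
    [/\ nrm2 v = 1, v 0 0 = of_real F (sre (v 0 0)) & A *m v = of_real F l *: v].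
  pose c : K := if v' 0 0 == 0 then 1 else sconj (v' 0 0).
  have c0 : nsq c != 0.
    rewrite /c; case: ifP => [_|/negbT v00]; first by rewrite nsq1 oner_eq0.
    by rewrite nsq_conj; apply: contra v00 => /eqP/nsq0_eq0 ->.
  have cr : v' 0 0 * c = of_real F (sre (v' 0 0 * c)).
    rewrite /c; case: eqP => [->|_]; first by rewrite mul0r sre0 of_real0.
    by rewrite mul_sconj sre_real.
  pose v2 := v' *m c%:M.
  have v2E i : v2 i 0 = v' i 0 * c by rewrite mxE big_ord1 mxE eqxx mulr1n.
  have Av2 : A *m v2 = of_real F l *: v2 by rewrite /v2 mulmxA v'E scalemxAl.
  have n2 : nrm2 v2 != 0.
    apply: contra v'0 => /eqP/nrm20_eq0 v20; apply/eqP/matrixP => i j.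
    have H := v2E i; rewrite v20 [LHS]mxE in H.
    rewrite ord1 [RHS]mxE; move/(congr1 (@nsq R F)): H.
    rewrite nsq0 nsqM => /esym/eqP; rewrite mulf_eq0 (negPf c0) orbF.
    by move=> /eqP/nsq0_eq0.
  exists (of_real F (nrm v2)^-1 *: v2); split.
  - by rewrite nrm2Z exprVn nrm_sqr mulVf.
  - by rewrite mxE v2E cr -of_realM sre_real.
  - by rewrite mulmxZr Av2 !scalerA -!of_realM mulrC.
change n.+1 with (1 + n)%N in A, v, v1, vr, vE, AH |- *.
have [u [uu uH ue]] := unitary_first_col v1 vr.
set e : 'cV[K]_(1 + n) := delta_mx 0 0 in ue.
pose B := u *m A *m u.
have BH : adjmx B = B by rewrite /B !adjmxM uH AH mulmxA.
have uuE : u *m u = 1%:M by rewrite -[X in X *m _]uH.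
have Be : B *m e = of_real F l *: e.
  by rewrite /B -!mulmxA ue vE mulmxZr -ue mulmxA uuE mul1mx.
have AE : A = u *m B *m u by rewrite /B !mulmxA uuE mul1mx -mulmxA uuE mulmx1.
clearbody B.
have Bcol i : B i 0 = of_real F l * (i == 0)%:R.
  have := congr1 (fun M : 'cV[K]_(1 + n) => M i 0) Be; rewrite /= -colE mxE => ->.
  by rewrite !mxE andbT.
have BE : B = block_mx (of_real F l)%:M 0 0 (drsubmx B).
  have l0 : lshift n (0 : 'I_1) = 0 :> 'I_(1 + n) by exact: val_inj.
  have r0 j : (rshift 1 j == 0 :> 'I_(1 + n)) = false by [].
  rewrite -[LHS]submxK; congr block_mx; apply/matrixP => i j.
  - by rewrite !ord1 !mxE l0 Bcol eqxx mulr1.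
  - by rewrite !ord1 !mxE l0 -BH adjmxE Bcol r0 mulr0 sconj0.
  - by rewrite !ord1 !mxE l0 Bcol r0 mulr0.
have [|u' [l' [uu' uE']]] := IH (drsubmx B).
  have : adjmx B = B := BH; rewrite {1}BE adjmx_block => /(congr1 drsubmx).
  by rewrite block_mxKdr.
exists (u *m block_mx 1%:M 0 0 u'), (row_mx (const_mx l) l'); split.
  apply: unitaryM => //; rewrite /unitary_mx adjmx_block adjmx1 !adjmx0 mulmx_block.
  by rewrite !mul0mx !mulmx0 !addr0 !add0r mul1mx uu' -scalar_mx_block.
rewrite AE adjmxM uH !mulmxA; congr (_ *m _); rewrite -!mulmxA; congr (_ *m _).
rewrite BE real_diag_row_mx adjmx_block adjmx1 !adjmx0 !mulmx_block.
rewrite !mul0mx !mulmx0 !addr0 !add0r mul1mx mulmx1 mulmxA -uE'; congr block_mx;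
  rewrite ?mulmx0//.
by apply/matrixP => i j; rewrite !ord1 real_diagE !mxE eqxx mulr1n.
Qed.

Lemma of_real_prod I (r : seq I) (P : pred I) (f : I -> R) :
  of_real F (\prod_(i <- r | P i) f i) = \prod_(i <- r | P i) of_real F (f i).
Proof. by apply: (big_morph _ (@of_realM R F) (@of_real1 R F)). Qed.

End Spectral.

Lemma diagonalization_form (R : realType) F n (A u : 'M[Defs.scalar R F]_n) l i :
  unitary_mx u -> A = u *m real_diag F l *m adjmx u ->
  l 0 i = ip (u *m (delta_mx i 0 : 'cV_n)) (A *m (u *m (delta_mx i 0 : 'cV_n))).
Proof.
move=> uu ->; rewrite -!mulmxA [adjmx u *m (u *m _)]mulmxA uu mul1mx.
rewrite (unitary_ip _ _ uu) /ip (bigD1 i)//= big_ord1 mul_real_diag !mxE !eqxx.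
rewrite sconj1 mul1r mulr1 sre_real big1 ?addr0// => j ji.
by rewrite big_ord1 mxE (negPf ji) sconj0 mul0r sre0.
Qed.

Lemma detR_diagonalization (R : realType) F n (A u : 'M[Defs.scalar R F]_n) l :
  unitary_mx u -> A = u *m real_diag F l *m adjmx u ->
  detR A = \prod_i l 0 i ^+ sdim F.
Proof.
move=> uu ->; rewrite !detRM mulrAC -detRM (unitary_mulmxV uu) detR1 mul1r.
rewrite (@detR_upper _ _ _ _ (fun i => l 0 i)) => [//|i|i j ij].
  by rewrite real_diagE eqxx.
by rewrite real_diagE; case: eqP => // ji; move: ij; rewrite ji ltnn.
Qed.

(** Over the quaternions, all unitary diagonalizations give the same product since its d-th
    power is the determinant of the real form and it is nonnegative. *)
Lemma hermdet_gram (R : realType) F n (T : 'M[Defs.scalar R F]_n) t : utri T t ->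
  hermdet (adjmx T *m T) = \prod_i t i ^+ 2.
Proof.
case: F T => T Tt; rewrite /hermdet.
- have [Td Tl _] := Tt.
  rewrite (_ : adjmx T = T^T); last by apply/matrixP => i j; rewrite !mxE.
  rewrite det_mulmx.
  rewrite det_tr -[\det T]det_tr det_trig; last by apply/is_trig_mxP => i j ij; rewrite mxE Tl.
  rewrite -big_split; apply: eq_bigr => i _ /=; rewrite mxE Td expr2//.
- have [Td Tl _] := Tt.
  rewrite det_mulmx -[X in _ * X]det_tr !det_trig; last 2 first.
  + by apply/is_trig_mxP => i j ij; rewrite !mxE Tl//= ?oppr0.
  + by apply/is_trig_mxP => i j ij; rewrite !mxE Tl//= ?oppr0.
  transitivity (@sre R Complexes (of_real Complexes (\prod_i t i ^+ 2))); last exact: sre_real.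
  apply: (congr1 (@sre R Complexes)); rewrite of_real_prod -big_split; apply: eq_bigr => i _ /=.
  rewrite !mxE Td /= oppr0; apply/eqP; rewrite eq_complex /=.
  by apply/andP; split; apply/eqP; ring.
- case: xgetP => [x _ [u [l [uu AE ->]]]|N].
  + have lE i : l 0 i = nrm2 (T *m (u *m (delta_mx i 0 : 'cV_n))).
      by rewrite nrm2E ip_adjr mulmxA; exact: diagonalization_form.
    have l0 i : 0 <= l 0 i by rewrite lE nrm2_ge0.
    apply/eqP; rewrite -(eqrXn2 (n := 4))//; last 2 first.
    * by apply: prodr_ge0.
    * by apply: prodr_ge0 => i _; rewrite sqr_ge0.
    have := detR_diagonalization uu AE; rewrite (detR_gram_utri Tt).
    by rewrite -!prodrXl => ->.
  + exfalso; have [|u [l [uu AE]]] := @spectral_theorem R Quaternions n (adjmx T *m T).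
      by rewrite adjmxM adjmxK.
    by apply: (N (\prod_i l 0 i)); exists u, l.
Qed.

(** * Lebesgue measure on tuples *)

Lemma measurable_preimage d1 d2 (T1 : measurableType d1) (T2 : measurableType d2)
  (f : T1 -> T2) (A : set T2) : measurable_fun setT f -> measurable A ->
  measurable (f @^-1` A).
Proof. by move=> mf mA; rewrite -[X in measurable X]setTI; exact: mf. Qed.

Definition image_measure d1 d2 (T1 : measurableType d1) (T2 : measurableType d2)
    (R : realType) (m : {measure set T1 -> \bar R}) (f : T1 -> T2)
    (mf : measurable_fun setT f) : {measure set T2 -> \bar R} :=
  measure_function_pushforward__canonical__measure_function_Measure m mf.

Section TupleMeasure.
Variable R : realType.
Local Notation RR := (measurableTypeR R).
Local Notation leb := (@lebesgue_measure R).

Lemma measurable_scale1 (r : R) : measurable_fun [set: RR] (fun x : RR => (r * x : RR)).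
Proof. exact: mulrl_measurable. Qed.

Lemma lebesgue_scale1 (r : R) (A : set RR) : 0 < r -> measurable A ->
  leb ((fun x : RR => r * x) @^-1` A) = ((r^-1)%:E * leb A)%E.
Proof.
move=> r0 mA; have r0' : 0 <= r by exact: ltW.
pose m := mscale (NngNum r0') (image_measure leb (measurable_scale1 r)).
have mAE (B : set RR) : m B = (r%:E * leb ((fun x : RR => (r * x)%R) @^-1` B))%E by [].
have mE : forall A, measurable A -> leb A = m A.
  apply: (@lebesgue_measure_unique R) => _ [[a b] _ <-].
  rewrite [RHS]mAE [X in (_ * leb X)%E](_ : _ = `](a / r), (b / r)]%classic); last first.
    by apply/seteqP; split => x /=; rewrite !in_itv /= ltr_pdivrMr// ler_pdivlMr// mulrC.
  rewrite !lebesgue_measure_itv /= !lte_fin ltr_pM2r ?invr_gt0//.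
  case: ifP => _; last by rewrite mule0.
  by rewrite -!EFinB -EFinM -mulrBl mulrC divfK// gt_eqF.
by rewrite (mE _ mA) mAE muleA -EFinM mulVf ?gt_eqF// mul1e.
Qed.

Definition scale_tuple n (r : nat -> R) (t : n.-tuple RR) : n.-tuple RR :=
  [tuple r i * tnth t i | i < n].

Lemma measurable_scale_tuple n (r : nat -> R) :
  measurable_fun setT (@scale_tuple n r).
Proof.
apply/measurable_fun_tnthP => i; rewrite (_ : _ \o _ = (fun t => r i * tnth t i)).
  exact: measurable_funM (measurable_cst _) (measurable_tnth i).
by apply/funext => t /=; rewrite tnth_mktuple.
Qed.

Lemma scale_cons n (r : nat -> R) (x : RR * n.-tuple RR) :
  scale_tuple r (cons_pair x) =
  cons_pair (r 0%N * x.1, scale_tuple (fun i => r i.+1) x.2).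
Proof.
apply: eq_from_tnth => i; rewrite tnth_mktuple.
case: (unliftP ord0 i) => [j ->|->]; last by rewrite !tnth0.
by rewrite !tnthS tnth_mktuple.
Qed.

(** The pushforward of a product measure under a product map, rescaled, is characterized
    by its values on rectangles. *)
Lemma lebesgue_scale n (r : nat -> R) (A : set (n.-tuple RR)) :
  (forall i, 0 < r i) -> measurable A ->
  lebesgue_tuple R n (scale_tuple r @^-1` A) =
  (((\prod_(i < n) r i)^-1)%:E * lebesgue_tuple R n A)%E.
Proof.
elim: n r A => [|n IH] r A r0 mA.
  rewrite big_ord0 invr1 mul1e; congr (_ _); apply/seteqP.
  by split => t /=; rewrite (tuple0 t) (tuple0 (scale_tuple _ _)).
pose r' i := r i.+1; pose c := \prod_(i < n.+1) r i.
have c0 : 0 < c by exact: prodr_gt0.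
have c0' : 0 <= c by exact: ltW.
pose f (x : RR * n.-tuple RR) : RR * n.-tuple RR := (r 0%N * x.1, scale_tuple r' x.2).
have mf : measurable_fun setT f.
  apply/measurable_fun_pairP; split => /=.
    exact: (measurableT_comp (measurable_scale1 (r 0%N)) measurable_fst).
  exact: (measurableT_comp (@measurable_scale_tuple n r') measurable_snd).
pose m := mscale (NngNum c0') (image_measure (leb \x lebesgue_tuple R n)%E mf).
have mAE B : m B = (c%:E * (leb \x lebesgue_tuple R n)%E (f @^-1` B))%E by [].
have mE : forall B, measurable B -> (leb \x lebesgue_tuple R n)%E B = m B.
  apply: product_measure_unique => B C mB mC.
  rewrite [LHS]mAE.
  have -> : f @^-1` (B `*` C) = ((fun x : RR => r 0%N * x) @^-1` B) `*` (scale_tuple r' @^-1` C).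
    by [].
  rewrite product_measure1E; last 2 first.
  - exact: (measurable_preimage (measurable_scale1 (r 0%N)) mB).
  - exact: (measurable_preimage (@measurable_scale_tuple n r') mC).
  transitivity (c%:E * ((((r 0%N)^-1)%:E * leb B) *
      (((\prod_(i < n) r' i)^-1)%:E * lebesgue_tuple R n C)))%E.
    congr (_ * (_ * _))%E; first exact: lebesgue_scale1.
    by apply: IH => // i; exact: r0.
  rewrite [X in (_ * X)%E]muleACA -EFinM.
  have cE : c * ((r 0%N)^-1 / \prod_(i < n) r' i) = 1.
    by rewrite /c big_ord_recl /= -invfM divff// mulf_neq0 ?gt_eqF// prodr_gt0.
  by rewrite [LHS](muleA c%:E) -(EFinM c) cE mul1e.
have mcA : measurable (@cons_pair R n @^-1` A).
  exact: measurable_preimage (@measurable_cons_pair _ _) mA.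
rewrite /= /lebesgue_cons /pushforward.
have -> : @cons_pair R n @^-1` (scale_tuple r @^-1` A) = f @^-1` (@cons_pair R n @^-1` A).
  by apply/seteqP; split => x /=; rewrite scale_cons.
by rewrite [in RHS](mE _ mcA) mAE muleA -EFinM mulVf ?gt_eqF// mul1e.
Qed.

Lemma measurable_box n (c : nat -> R) (e : R) :
  measurable [set t : n.-tuple RR | forall i : 'I_n, `|tnth t i - c i| < e].
Proof.
have -> : [set t : n.-tuple RR | forall i : 'I_n, `|tnth t i - c i| < e] =
    \bigcap_(i in [set: 'I_n]) ((fun t => tnth t i) @^-1` ball (c i) e).
  apply/seteqP; split => t /= H i; last first.
    by have := H i I; rewrite /= -ball_normE /= distrC.
  by move=> _; rewrite /= -ball_normE /= distrC.
apply: fin_bigcap_measurable => // i _.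
apply: measurable_preimage (measurable_tnth i) _.
exact: measurable_ball.
Qed.

Lemma lebesgue_box n (c : nat -> R) (e : R) : 0 < e ->
  lebesgue_tuple R n [set t | forall i : 'I_n, `|tnth t i - c i| < e] =
  ((2 * e) ^+ n)%:E.
Proof.
move=> e0; elim: n c => [|n IH] c.
  by rewrite expr0 /= diracE mem_set//= => -[].
rewrite /= /lebesgue_cons /pushforward.
have -> : @cons_pair R n @^-1` [set t | forall i : 'I_n.+1, `|tnth t i - c i| < e] =
   (ball (c 0%N) e : set RR) `*` [set t | forall i : 'I_n, `|tnth t i - c i.+1| < e].
  apply/seteqP; split => [[x t] /= H|[x t] /= [H1 H2] i].
    split; first by have := H ord0; rewrite tnth0 -ball_normE /= distrC.
    by move=> i; have := H (lift ord0 i); rewrite tnthS.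
  case: (unliftP ord0 i) => [j ->|->]; last by rewrite tnth0 distrC -ball_normE in H1 *.
  by rewrite tnthS; exact: H2.
rewrite product_measure1E; last 2 first.
- exact: measurable_ball.
- exact: (@measurable_box n (fun i => c i.+1)).
transitivity ((2 * e)%:E * ((2 * e) ^+ n)%:E)%E; last by rewrite -EFinM exprS.
congr (_ * _)%E; last exact: (IH (fun i => c i.+1)).
by apply: etrans (lebesgue_measure_ball _ (ltW e0)) _; rewrite mulr_natl.
Qed.

End TupleMeasure.

(** * Measurability on the space of matrices *)

Section NonMeasurable.
Context d (T : measurableType d) (R : realType).
Variable mu : {measure set T -> \bar R}.

(** The integral of a nonnegative function is a supremum over simple functions
    below it, hence monotone even without measurability.  The
    integrands built from the Iwasawa projection are compared in this way. *)
Lemma ge0_integral_mono (D E : set T) (f g : T -> \bar R) :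
  (forall x, D x -> 0 <= f x)%E -> (forall x, E x -> 0 <= g x)%E ->
  (forall x, D x -> 0 < f x -> E x /\ f x <= g x)%E ->
  (\int[mu]_(x in D) f x <= \int[mu]_(x in E) g x)%E.
Proof.
move=> f0 g0 fg; rewrite (integral_mkcond D) (integral_mkcond E).
have F0 x : (0 <= (f \_ D) x)%E by apply: erestrict_ge0.
have G0 x : (0 <= (g \_ E) x)%E by apply: erestrict_ge0.
have FG x : ((f \_ D) x <= (g \_ E) x)%E.
  rewrite {1}/patch; case: ifPn => // /set_mem Dx.
  have := f0 x Dx; rewrite le_eqVlt => /orP[/eqP <-//|fx].
  by have [Ex fgx] := fg x Dx fx; rewrite patchT ?inE.
rewrite !ge0_integralTE//; apply: le_ereal_sup => _ [h /= hf <-].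
by exists h => //= x; exact: le_trans (hf x) (FG x).
Qed.

End NonMeasurable.

Section MatrixMeasure.
Variables (R : realType) (F : scalar_kind) (q : nat).
Local Notation K := (Defs.scalar R F).
Local Notation d := (sdim F).
Local Notation RR := (measurableTypeR R).
Local Notation mxK := (mxF R F q).

Lemma scoord_of_coords (c : nat -> R) k : (k < d)%N -> scoord (of_coords F c) k = c k.
Proof.
rewrite /scoord /sbasis; case: F => /=.
- by case: k => // _; rewrite mul1r.
- by move: k => [|[|]]//= _; ring.
- by move: k => [|[|[|[|]]]]//= _; ring.
Qed.

Lemma entry_subproof (i j : 'I_q) (k : 'I_d) : ((i * q + j) * d + k < q * q * d)%N.
Proof.
have : (i * q + j < q * q)%N.
  apply: (@leq_trans (i.+1 * q)); first by rewrite mulSn addnC ltn_add2r.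
  by rewrite leq_mul2r ltn_ord orbT.
move=> H; apply: (@leq_trans ((i * q + j).+1 * d)).
  by rewrite mulSn addnC ltn_add2r.
by rewrite leq_mul2r H orbT.
Qed.
Definition entry i j k : 'I_(q * q * d) := Ordinal (entry_subproof i j k).

Lemma mx_of_tuple_coord (t : (q * q * d).-tuple RR) (i j : 'I_q) (k : 'I_d) :
  scoord (mx_of_tuple t i j) k = tnth t (entry i j k).
Proof. by rewrite mxE scoord_of_coords// (tnth_nth (0 : R)). Qed.

Lemma measurable_mxF_fun (f : mxK -> R) :
  measurable_fun setT (f \o @mx_of_tuple R F q) -> measurable_fun setT f.
Proof. by move=> mf _ Y mY; rewrite setTI; have := mf measurableT Y mY; rewrite setTI. Qed.

Section ScalarFun.
Context d' (T : measurableType d').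
Implicit Type f g : T -> K.

(** Measurability of scalar-valued functions through their real coordinates. *)
Definition smeas f := forall k, (k < d)%N -> measurable_fun setT (fun x => scoord (f x) k).

Lemma smeas_cst c : smeas (fun=> c).
Proof. by move=> k _; exact: measurable_cst. Qed.

Lemma smeasD f g : smeas f -> smeas g -> smeas (fun x => f x + g x).
Proof.
move=> mf mg k kd; under eq_fun do rewrite scoordD.
by apply: measurable_funD; [exact: mf|exact: mg].
Qed.

Lemma smeas_sum (I : Type) (s : seq I) (f : I -> T -> K) :
  (forall i, smeas (f i)) -> smeas (fun x => \sum_(i <- s) f i x).
Proof.
move=> mf k kd; under eq_fun do rewrite scoord_sum.
by apply: measurable_sum => i; exact: mf.
Qed.

Lemma smeas_lin f (L : K -> K) : (forall x y, L (x + y) = L x + L y) ->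
  (forall a x, L (x * of_real F a) = L x * of_real F a) ->
  smeas f -> smeas (fun x => L (f x)).
Proof.
move=> LD LZ mf k kd.
have L0 : L 0 = 0 by rewrite -[0 in LHS](mulr0 0) -of_real0 LZ of_real0 mulr0.
have E x : scoord (L (f x)) k = \sum_(m < d) scoord (L (sbasis R F m)) k * scoord (f x) m.
  rewrite {1}(scoord_expand (f x)) (big_morph L LD L0) scoord_sum.
  by apply: eq_bigr => m _; rewrite LZ scoordZ.
under eq_fun do rewrite E.
apply: measurable_sum => m; apply: measurable_funM; first exact: measurable_cst.
exact: mf.
Qed.

Lemma smeasM f g : smeas f -> smeas g -> smeas (fun x => f x * g x).
Proof.
move=> mf mg k kd.
have E x : scoord (f x * g x) k = \sum_(l < d) scoord (f x * sbasis R F l) k * scoord (g x) l.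
  rewrite {1}(scoord_expand (g x)) mulr_sumr scoord_sum.
  by apply: eq_bigr => l _; rewrite mulrA scoordZ.
under eq_fun do rewrite E.
apply: measurable_sum => l; apply: measurable_funM; last exact: mg.
apply: (@smeas_lin f (fun y => y * sbasis R F l)) => //.
  by move=> x y; rewrite mulrDl.
by move=> a x; rewrite -mulrA of_realC mulrA.
Qed.

Lemma smeas_conj f : smeas f -> smeas (fun x => sconj (f x)).
Proof.
apply: smeas_lin; first exact: sconjD.
by move=> a x; rewrite sconjM sconj_real of_realC.
Qed.

Lemma nsqE (x : K) : nsq x = \sum_(k < d) scoord x k ^+ 2.
Proof.
rewrite {1}/nsq {2}(scoord_expand x) mulr_sumr sre_sum; apply: eq_bigr => k _.
rewrite mulrA -of_realC sreZ expr2; congr (_ * _).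
by rewrite -sre_conj sconjM sconjK.
Qed.

Lemma smeas_nsq f : smeas f -> measurable_fun setT (fun x => nsq (f x)).
Proof.
move=> mf; under eq_fun do rewrite nsqE; apply: measurable_sum => k.
by apply: measurable_funX; exact: mf.
Qed.

Lemma smeas_mulmx m n p (A : T -> 'M[K]_(m, n)) (B : T -> 'M[K]_(n, p)) :
  (forall i j, smeas (fun x => A x i j)) -> (forall i j, smeas (fun x => B x i j)) ->
  forall i j, smeas (fun x => (A x *m B x) i j).
Proof.
move=> mA mB i j; under eq_fun do rewrite mxE.
by apply: smeas_sum => k; exact: smeasM.
Qed.

Lemma smeas_nrm2 m n (A : T -> 'M[K]_(m, n)) :
  (forall i j, smeas (fun x => A x i j)) -> measurable_fun setT (fun x => nrm2 (A x)).
Proof.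
move=> mA; apply: measurable_sum => i; apply: measurable_sum => j.
exact: smeas_nsq.
Qed.

End ScalarFun.

Lemma smeas_entry (i j : 'I_q) : smeas (fun w : mxK => (w : 'M[K]_q) i j).
Proof.
move=> k kd; apply: measurable_mxF_fun.
rewrite (_ : _ \o _ = (fun t => tnth t (entry i j (Ordinal kd)))).
  exact: measurable_tnth.
by apply/funext => t /=; rewrite -mx_of_tuple_coord.
Qed.

Lemma measurable_nrm2_mul (v : 'cV[K]_q) :
  measurable_fun setT (fun w : mxK => nrm2 ((w : 'M[K]_q) *m v)).
Proof.
apply: smeas_nrm2 => i j; apply: smeas_mulmx => [a b|a b].
  exact: smeas_entry.
exact: smeas_cst.
Qed.

Lemma measurable_nrm2_dist (c : 'M[K]_q) :
  measurable_fun setT (fun w : mxK => nrm2 ((w : 'M[K]_q) - c)).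
Proof.
apply: smeas_nrm2 => i j.
rewrite (_ : (fun _ => _) = (fun w : mxK => (w : 'M[K]_q) i j + (- c) i j)).
  by apply: smeasD; [exact: smeas_entry|exact: smeas_cst].
by apply/funext => w; rewrite mxE.
Qed.

Definition frob_ball (c : 'M[K]_q) (r : R) : set mxK :=
  [set w | nrm ((w : 'M[K]_q) - c) < r].

Lemma measurable_frob_ball c r : 0 < r -> measurable (frob_ball c r).
Proof.
move=> r0; have -> : frob_ball c r =
    (fun w : mxK => nrm2 ((w : 'M[K]_q) - c)) @^-1` `]-oo, (r ^+ 2)[%classic.
  apply/seteqP; split => w /=; rewrite /frob_ball /= in_itv /= -nrm_sqr;
    by rewrite ltr_pXn2r ?nnegrE ?nrm_ge0// ltW.
exact: measurable_preimage (measurable_nrm2_dist c) (measurable_itv _).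
Qed.

Section Dense.
Variables (m n : nat).
(** Matrices with rational coordinates: a countable dense set. *)
Definition ratmx (a : {ffun 'I_m * 'I_n * 'I_d -> rat}) : 'M[K]_(m, n) :=
  \matrix_(i, j) \sum_(k < d) sbasis R F k * of_real F (ratr (a (i, j, k))).

Lemma nrm2_coord (A : 'M[K]_(m, n)) : nrm2 A = \sum_i \sum_j \sum_(k < d) scoord (A i j) k ^+ 2.
Proof. by apply: eq_bigr => i _; apply: eq_bigr => j _; rewrite nsqE. Qed.

Lemma scoord_ratmx a i j (k : 'I_d) : scoord (ratmx a i j) k = ratr (a (i, j, k)).
Proof.
rewrite mxE scoord_sum (bigD1 k)//= scoordZ scoord_basis// eqxx mul1r.
rewrite big1 ?addr0// => l lk; rewrite scoordZ scoord_basis//.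
by rewrite -[_ == _]/(k == l) eq_sym (negPf lk) mul0r.
Qed.

Lemma ratmx_dense (A : 'M[K]_(m, n)) e : 0 < e -> exists a, nrm (A - ratmx a) < e.
Proof.
move=> e0; pose N : R := (m * n * d).+1%:R.
have N0 : 0 < N by rewrite ltr0n.
pose del := e / N; have del0 : 0 < del by exact: divr_gt0.
have /choice[a aP] (x : 'I_m * 'I_n * 'I_d) : exists r : rat,
    `|scoord (A x.1.1 x.1.2) x.2 - ratr r| < del.
  have /rat_in_itvoo[r] : scoord (A x.1.1 x.1.2) x.2 - del <
      scoord (A x.1.1 x.1.2) x.2 + del by rewrite ltrBlDr -addrA ltrDl addr_gt0.
  rewrite in_itv /= => /andP[r1 r2]; exists r.
  by rewrite distrC ltr_norml; apply/andP; split; lra.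
exists [ffun x => a x].
rewrite -(ltr_pXn2r (n := 2))// ?nnegrE ?nrm_ge0 ?ltW// nrm_sqr nrm2_coord.
apply: (@le_lt_trans _ _ ((m * n * d)%:R * del ^+ 2)).
  have -> : (m * n * d)%:R * del ^+ 2 = \sum_(i < m) \sum_(j < n) \sum_(k < d) del ^+ 2.
    rewrite !sumr_const !card_ord -!mulrnA mulr_natl; congr (_ *+ _).
    by rewrite mulnC (mulnC m) mulnA.
  apply: ler_sum => i _; apply: ler_sum => j _; apply: ler_sum => k _.
  rewrite -[leLHS]real_normK ?num_real// lerXn2r ?nnegrE ?normr_ge0 ?ltW//.
  have -> : scoord ((A - ratmx [ffun x => a x]) i j) k =
      scoord (A i j) k - scoord (ratmx [ffun x => a x] i j) k.
    rewrite mxE scoordD; congr (_ + _); rewrite mxE.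
    by rewrite /scoord mulrN sreN.
  by rewrite scoord_ratmx ffunE; exact: (aP (i, j, k)).
rewrite /del expr_div_n mulrA ltr_pdivrMr ?exprn_gt0// mulrC ltr_pM2l ?exprn_gt0//.
apply: (@lt_le_trans _ _ N); first by rewrite ltr_nat.
by rewrite expr2 ler_peMl ?ler1n//; exact: ltW.
Qed.

End Dense.

End MatrixMeasure.

(** * Haar measure of balls *)

Section Haar.
Variables (R : realType) (F : scalar_kind) (q : nat).
Local Notation K := (Defs.scalar R F).
Local Notation mxK := (mxF R F q).

Lemma measurable_det1_condition : measurable [set k : mxK |
  match F return 'M[Defs.scalar R F]_q -> Prop with
  | Reals => fun k => \det (k : 'M[R]_q) = 1
  | _ => fun _ => True
  end k].
Proof.
have ent := @smeas_entry R F q.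
move: ent; case: F => ent /=; last 2 first.
- exact: measurableT.
- exact: measurableT.
have mE (i j : 'I_q) : measurable_fun setT (fun w : mxF R Reals q => (w : 'M[R]_q) i j).
  have := ent i j 0%N isT; apply: eq_measurable_fun => w _.
  by rewrite /scoord /sbasis /= mul1r.
have md : measurable_fun setT (fun w : mxF R Reals q => \det (w : 'M[R]_q)).
  apply: measurable_sum => s; apply: measurable_funM; first exact: measurable_cst.
  by apply: measurable_prod => i _; exact: mE.
exact: (measurable_preimage md (measurable_set1 1)).
Qed.

Lemma measurable_Ugroup : measurable (@Ugroup R F q : set mxK).
Proof.
have -> : (@Ugroup R F q : set mxK) =
    (fun w : mxK => nrm2 (adjmx (w : 'M[K]_q) *m w - 1%:M)) @^-1` [set 0] `&`
    [set k : mxK | match F return 'M[Defs.scalar R F]_q -> Prop with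
      | Reals => fun k => \det (k : 'M[R]_q) = 1
      | _ => fun _ => True
      end k].
  apply/seteqP; split => w /= -[uw dw]; split => //.
    by rewrite uw subrr nrm20.
  by apply/subr0_eq/nrm20_eq0.
apply: measurableI; last exact: measurable_det1_condition.
apply: measurable_preimage; last exact: measurable_set1.
apply: smeas_nrm2 => i j.
rewrite (_ : (fun _ => _) = (fun w : mxK => (adjmx (w : 'M[K]_q) *m w) i j +
  (- 1%:M : 'M[K]_q) i j)); last by apply/funext => w; rewrite mxE.
apply: smeasD; last exact: smeas_cst.
apply: smeas_mulmx => a b; last exact: smeas_entry.
rewrite (_ : (fun _ => _) = (fun w : mxK => sconj ((w : 'M[K]_q) b a))).
  by apply: smeas_conj; exact: smeas_entry.
by apply/funext => w; rewrite adjmxE.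
Qed.

Lemma Ugroup_adj (k : 'M[K]_q) : Ugroup k -> Ugroup (adjmx k).
Proof.
move=> [uk dk]; split; first exact: unitary_adj.
move: k uk dk; case: F => //= k uk dk.
by rewrite (_ : adjmx (k : 'M[Defs.scalar R Reals]_q) = k^T) ?det_tr//;
  apply/matrixP => i j; rewrite !mxE.
Qed.

Lemma frob_ball_translate (k : 'M[K]_q) c r : Ugroup k ->
  [set k *m g | g in frob_ball c r] = frob_ball (k *m c) r.
Proof.
move=> Uk; have uk := Ugroup_unitary Uk.
have nk (A : 'M[K]_q) : nrm (k *m A) = nrm A by rewrite /nrm unitary_nrm2.
apply/seteqP; split => [_ [g gc <-]|g gc].
  by rewrite /frob_ball /= -mulmxBr nk.
exists (adjmx k *m g); last by rewrite mulmxA unitary_mulmxV// mul1mx.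
rewrite /frob_ball /= -nk mulmxBr mulmxA unitary_mulmxV// mul1mx//.
Qed.

(** Otherwise, by invariance, every ball of radius r centred in U(q) would be null, and
    countably many of them cover U(q). *)
Lemma haar_ball_gt0 (mu : probability (mxF R F q) R) (k0 : 'M[K]_q) r :
  normalized_haar mu -> Ugroup k0 -> 0 < r ->
  (0 < mu (frob_ball k0 r `&` @Ugroup R F q))%E.
Proof.
move=> [muU mu_inv] Uk0 r0.
have mU := measurable_Ugroup.
have muUC : mu (~` (@Ugroup R F q)) = 0%E.
  by rewrite probability_setC// muU subee.
suff bpos : (0 < mu (frob_ball k0 r))%E.
  apply: (lt_le_trans bpos).
  rewrite (measureDI mu (measurable_frob_ball k0 r0) mU) -[leRHS]add0e.
  rewrite leeD2r// -muUC; apply: le_measure; rewrite ?inE.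
  - exact: measurableD (measurable_frob_ball k0 r0) mU.
  - exact: measurableC.
  - by move=> x [].
rewrite lt0e measure_ge0 andbT; apply/negP => /eqP b0.
have ball0 k : Ugroup k -> mu (frob_ball k r) = 0%E.
  move=> Uk; have Ukk : Ugroup (k *m adjmx k0) by apply: UgroupM => //; exact: Ugroup_adj.
  have := mu_inv _ _ Ukk (measurable_frob_ball k0 r0).
  rewrite frob_ball_translate// -mulmxA (Ugroup_unitary Uk0) mulmx1 => ->.
  exact: b0.
have r2 : 0 < r / 2 by rewrite divr_gt0.
have /choice[C CP] (a : {ffun 'I_q * 'I_q * 'I_(sdim F) -> rat}) : exists C : set mxK,
    mu.-negligible C /\ frob_ball (ratmx R a) (r / 2) `&` @Ugroup R F q `<=` C.
  have [[k [ka Uk]]|N] := pselect (exists k, (frob_ball (ratmx R a) (r / 2) `&` @Ugroup R F q) k).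
    exists (frob_ball k r); split.
      exists (frob_ball k r); split => //; [exact: measurable_frob_ball|exact: ball0].
    move=> g [ga _]; rewrite /frob_ball /= -(subrKA (ratmx R a)).
    apply: le_lt_trans (nrmD _ _) _; rewrite (splitr r) ltrD//.
    by rewrite nrmBC.
  exists set0; split; first exact: negligible_set0.
  by move=> g gN; apply: N; exists g.
pose f n := if unpickle n is Some a then C a else set0.
have : mu.-negligible (@Ugroup R F q).
  apply: (@negligibleS _ _ _ _ (\bigcup_n f n)); last first.
    apply: negligible_bigcup => n; rewrite /f; case: unpickle => [a|].
      by have [] := CP a.
    exact: negligible_set0.
  move=> k Uk; have [a ka] := ratmx_dense k r2.
  exists (pickle a) => //; rewrite /f pickleK; have [_] := CP a; apply; split => //.
move=> /(measure_negligible mU) U0; move: muU; rewrite U0 => /eqP.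
by rewrite eq_sym onee_eq0.
Qed.

End Haar.

(** * Lebesgue measure on the space of matrices *)

Section LebesgueMatrix.
Variables (R : realType) (F : scalar_kind) (q : nat).
Local Notation K := (Defs.scalar R F).
Local Notation d := (sdim F).
Local Notation RR := (measurableTypeR R).
Local Notation mxK := (mxF R F q).
Local Notation leb := (@lebesgue_mx R F q).

Local Notation entry := (@entry F q).

Lemma entry_inj : injective (fun x : 'I_q * 'I_q * 'I_d => entry x.1.1 x.1.2 x.2).
Proof.
move=> [[i j] k] [[i' j'] k'] /(congr1 val) /= H.
have E1 := congr1 (fun n : nat => n %/ d)%N H; have E2 := congr1 (fun n : nat => n %% d)%N H.
rewrite /= !divnMDl ?sdim_gt0// !divn_small ?ltn_ord// !addn0 in E1.
rewrite /= !modnMDl !modn_small ?ltn_ord// in E2.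
have q0 : (0 < q)%N by have := ltn_ord i; lia.
have E3 := congr1 (fun n : nat => n %/ q)%N E1; have E4 := congr1 (fun n : nat => n %% q)%N E1.
rewrite /= !divnMDl// !divn_small ?ltn_ord// !addn0 in E3.
rewrite /= !modnMDl !modn_small ?ltn_ord// in E4.
by congr (_, _, _); apply: val_inj.
Qed.

Lemma entry_surj (x : 'I_(q * q * d)) : exists i j k, x = entry i j k.
Proof.
have [|g gK Kg] := @inj_card_bij _ _ _ entry_inj; first by rewrite !card_prod !card_ord.
by exists (g x).1.1, (g x).1.2, (g x).2; rewrite -[LHS]Kg; case: (g x) => -[].
Qed.

(** The real coordinates of a matrix, in the order in which tuples list them. *)
Definition center (c : 'M[K]_q) (n : nat) : R :=
  if insub n is Some x then
    xget 0 [set y | exists i j k, x = entry i j k /\ y = scoord (c i j) k] else 0.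

Lemma centerE c i j (k : 'I_d) : center c (entry i j k) = scoord (c i j) k.
Proof.
rewrite /center valK; case: xgetP => [y _ [i' [j' [k' [E ->]]]]|N].
  by have [-> -> ->] := entry_inj (x1 := (i, j, k)) (x2 := (i', j', k')) E.
by have := N (scoord (c i j) k); case; exists i, j, k.
Qed.

Lemma lebesgue_mxE (A : set mxK) :
  leb A = lebesgue_tuple R (q * q * d) (@mx_of_tuple R F q @^-1` A).
Proof. by []. Qed.

Lemma lebesgue_ball_gt0 (c : 'M[K]_q) r : 0 < r -> (0 < leb (frob_ball c r))%E.
Proof.
move=> r0; pose N : R := (q * q * d).+1%:R.
have N0 : 0 < N by rewrite ltr0n.
pose e := r / N; have e0 : 0 < e by exact: divr_gt0.
have H : (lebesgue_tuple R (q * q * d)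
   [set t | forall i : 'I_(q * q * d), (`|tnth t i - center c i| < e)%R] <=
   leb (frob_ball c r))%E.
  rewrite lebesgue_mxE; apply: le_measure; rewrite ?inE.
  - exact: measurable_box.
  - exact: measurable_preimage (@measurable_mx_of_tuple R F q) (measurable_frob_ball c r0).
  move=> t /= tc; rewrite /frob_ball /=.
  rewrite -(ltr_pXn2r (n := 2))// ?nnegrE ?nrm_ge0 ?ltW// nrm_sqr nrm2_coord.
  apply: (@le_lt_trans _ _ ((q * q * d)%:R * e ^+ 2)).
    have -> : (q * q * d)%:R * e ^+ 2 = \sum_(i < q) \sum_(j < q) \sum_(k < d) e ^+ 2.
      rewrite !sumr_const !card_ord -!mulrnA mulr_natl; congr (_ *+ _).
      by lia.
    apply: ler_sum => i _; apply: ler_sum => j _; apply: ler_sum => k _.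
    rewrite -[leLHS]real_normK ?num_real// lerXn2r ?nnegrE ?normr_ge0 ?ltW//.
    have -> : scoord ((mx_of_tuple t - c) i j) k = scoord (mx_of_tuple t i j) k - scoord (c i j) k.
      by rewrite mxE scoordD; congr (_ + _); rewrite mxE /scoord mulrN sreN.
    by rewrite mx_of_tuple_coord -centerE; exact: tc.
  rewrite /e expr_div_n mulrA ltr_pdivrMr ?exprn_gt0// mulrC ltr_pM2l ?exprn_gt0//.
  apply: (@lt_le_trans _ _ N); first by rewrite ltr_nat.
  by rewrite expr2 ler_peMl ?ler1n//; exact: ltW.
apply: lt_le_trans H; rewrite lebesgue_box// lte_fin exprn_gt0// mulr_gt0//.
Qed.

Lemma lebesgue_contraction_fin (A : set mxK) : measurable A ->
  (forall w, A w -> mx_contraction (w : 'M[K]_q)) -> (leb A < +oo)%E.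
Proof.
move=> mA Ac; have H : (leb A <= lebesgue_tuple R (q * q * d)
   [set t | forall i : 'I_(q * q * d), (`|tnth t i - 0| < 2)%R])%E.
  rewrite lebesgue_mxE; apply: le_measure; rewrite ?inE.
  - exact: measurable_preimage (@measurable_mx_of_tuple R F q) mA.
  - exact: (@measurable_box _ _ (fun=> 0)).
  move=> t /= /Ac tc x; have [i [j [k ->]]] := entry_surj x.
  rewrite subr0 -mx_of_tuple_coord; apply: (@le_lt_trans _ _ 1); last by rewrite ltr1n.
  rewrite -(ler_pXn2r (n := 2))// ?nnegrE// expr1n real_normK ?num_real//.
  apply: (@le_trans _ _ (nsq (mx_of_tuple (F := F) t i j))).
    rewrite nsqE (bigD1 k)//= lerDl; apply: sumr_ge0 => l _; exact: sqr_ge0.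
  have := tc (delta_mx j 0); rewrite -colE.
  rewrite nrm2_delta.
  apply: le_trans; have := nsq_le_nrm2 (col j (mx_of_tuple (F := F) t)) i 0.
  by rewrite mxE.
apply: le_lt_trans H _; rewrite (@lebesgue_box _ _ (fun=> 0))// ltry //.
Qed.

(** Scaling one column is a linear change of variables that is diagonal in real
    coordinates, whatever the scalars. *)
Definition scale_col (j : 'I_q) (r : R) (w : mxK) : mxK :=
  (w : 'M[K]_q) *m real_diag F (\row_i if i == j then r else 1).

Lemma scale_colE j r (w : mxK) a b : (scale_col j r w : 'M[K]_q) a b =
  (w : 'M[K]_q) a b * of_real F (if b == j then r else 1).
Proof. by rewrite mulr_real_diag mxE. Qed.

Lemma scale_col_mul j r (w : mxK) (v : 'cV[K]_q) : (scale_col j r w : 'M[K]_q) *m v =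
  (w : 'M[K]_q) *m (real_diag F (\row_i if i == j then r else 1) *m v).
Proof. by rewrite mulmxA. Qed.

Definition scale_col_coef (j : 'I_q) (r : R) (n : nat) : R := if ((n %/ d) %% q == j)%N then r else 1.

Lemma mx_of_tuple_scale j r (t : (q * q * d).-tuple RR) :
  mx_of_tuple (F := F) (scale_tuple (scale_col_coef j r) t) = scale_col j r (mx_of_tuple t).
Proof.
apply/matrixP => a b; rewrite scale_colE; apply: scoord_inj => k kd.
rewrite scoordZ -[k]/(Ordinal kd : nat) !mx_of_tuple_coord tnth_mktuple mulrC.
rewrite /scale_col_coef /= divnMDl ?sdim_gt0// divn_small// addn0 modnMDl modn_small//.
Qed.

Definition scale_col_card (j : 'I_q) : nat := #|[pred n : 'I_(q * q * d) | ((n %/ d) %% q == j)%N]|.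

Lemma scale_col_coef_prod j r :
  \prod_(n < q * q * d) scale_col_coef j r n = r ^+ scale_col_card j.
Proof. by rewrite -prodr_const [RHS]big_mkcond. Qed.

Lemma measurable_scale_col j r : measurable_fun setT (scale_col j r).
Proof.
move=> _ A mA; rewrite setTI.
rewrite -[measurable _]/(measurable (@mx_of_tuple R F q @^-1` (scale_col j r @^-1` A))).
rewrite (_ : _ @^-1` _ = scale_tuple (scale_col_coef j r) @^-1` (@mx_of_tuple R F q @^-1` A)).
  apply: (measurable_preimage (@measurable_scale_tuple R _ _)).
  exact: (measurable_preimage (@measurable_mx_of_tuple R F q) mA).
by apply/seteqP; split => t /=; rewrite mx_of_tuple_scale.
Qed.

Lemma lebesgue_scale_col j r (A : set mxK) : 0 < r -> measurable A ->
  leb (scale_col j r @^-1` A) = (((r ^+ scale_col_card j)^-1)%:E * leb A)%E.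
Proof.
move=> r0 mA; rewrite lebesgue_mxE.
rewrite (_ : _ @^-1` _ = scale_tuple (scale_col_coef j r) @^-1` (@mx_of_tuple R F q @^-1` A)).
  rewrite lebesgue_scale ?scale_col_coef_prod//.
    by move=> n; rewrite /scale_col_coef; case: ifP.
by apply/seteqP; split => t /=; rewrite mx_of_tuple_scale.
Qed.

Lemma integral_scale_col j r (f : mxK -> \bar R) : 0 < r ->
  measurable_fun setT f -> (forall w, 0 <= f w)%E ->
  (\int[leb]_w f (scale_col j r^-1 w) = (r ^+ scale_col_card j)%:E * \int[leb]_w f w)%E.
Proof.
move=> r0 mf f0; have rj0 : 0 <= r ^+ scale_col_card j by rewrite exprn_ge0// ltW.
pose m := image_measure leb (measurable_scale_col j r^-1).
transitivity (\int[m]_w f w)%E.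
  by apply/esym; rewrite [LHS]ge0_integral_pushforward//; exact: measurable_scale_col.
transitivity (\int[mscale (NngNum rj0) leb]_w f w)%E; last by rewrite ge0_integral_mscale.
apply: eq_measure_integral => A mA _.
have -> : m A = leb (scale_col j r^-1 @^-1` A) by [].
by rewrite lebesgue_scale_col ?invr_gt0// exprVn invrK.
Qed.

Lemma ip_le m n (a b : 'M[K]_(m, n)) : `|ip a b| <= nrm a * nrm b.
Proof.
rewrite -(ler_pXn2r (n := 2))// ?nnegrE ?mulr_ge0 ?nrm_ge0//.
by rewrite real_normK ?num_real// exprMn !nrm_sqr ip_CS.
Qed.

(** The form is continuous, so it suffices to test it on the countable dense set; this makes
    the sets of matrices below measurable. *)
Lemma form_dense (A w : 'M[K]_q) (b : 'cV[K]_q) c :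
  (forall a, c <= nrm2 (A *m ratmx R a + b) - nrm2 (w *m (A *m ratmx R a + b))) ->
  forall u : 'cV[K]_q, c <= nrm2 (A *m u + b) - nrm2 (w *m (A *m u + b)).
Proof.
move=> H u; set y := A *m u + b; rewrite leNgt; apply/negP => fy.
pose L := (1 + 2 * nrm y + 2 * (nrm (w *m y) * nrm w)) * (nrm A + 1).
have y0 := nrm_ge0 y; have wy0 := nrm_ge0 (w *m y); have w0 := nrm_ge0 w.
have A0 := nrm_ge0 A.
have wyw : 0 <= nrm (w *m y) * nrm w by exact: mulr_ge0.
have L1 : 0 < 1 + 2 * nrm y + 2 * (nrm (w *m y) * nrm w) by lra.
have A1 : 0 < nrm A + 1 by lra.
have L0 : 0 < L by exact: mulr_gt0.
pose eta := c - (nrm2 y - nrm2 (w *m y)).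
have eta0 : 0 < eta by rewrite /eta; lra.
pose e := Num.min (nrm A + 1)^-1 (eta / 2 / L).
have e0 : 0 < e by rewrite lt_min invr_gt0 A1 !divr_gt0.
have [a ua] := ratmx_dense u e0.
pose h := A *m (ratmx R a - u).
have hn : nrm h <= (nrm A + 1) * e.
  apply: le_trans (nrm_mul _ _) _; apply: ler_pM; rewrite ?nrm_ge0 ?lerDl//.
  by rewrite nrmBC ltW.
have h1 : nrm h <= 1.
  apply: le_trans hn _; rewrite mulrC -ler_pdivlMr// div1r /e ge_min lexx//.
have he : (1 + 2 * nrm y + 2 * (nrm (w *m y) * nrm w)) * nrm h <= eta / 2.
  apply: (@le_trans _ _ (L * e)).
    by rewrite /L -mulrA; apply: ler_wpM2l => //; exact: ltW.
  by rewrite mulrC -ler_pdivlMr// /e ge_min lexx orbT.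
have h0 := nrm_ge0 h.
have := H a; have -> : A *m ratmx R a + b = y + h.
  by rewrite /h mulmxBr /y [RHS]addrC [RHS]addrA subrK.
rewrite mulmxDr (nrm2D y h) (nrm2D (w *m y)) => Ha.
have B1 : nrm2 h <= nrm h by rewrite -nrm_sqr expr2 ler_piMl.
have B2 : ip y h <= nrm y * nrm h by apply: le_trans (ler_norm _) (ip_le _ _).
have B3 : - ip (w *m y) (w *m h) <= nrm (w *m y) * nrm w * nrm h.
  apply: le_trans (ler_norm _) _; rewrite normrN; apply: le_trans (ip_le _ _) _.
  by rewrite -mulrA ler_wpM2l// nrm_mul.
have B4 := nrm2_ge0 (w *m h).
have {}he : nrm h + 2 * (nrm y * nrm h) + 2 * (nrm (w *m y) * nrm w * nrm h) <=
    (c - (nrm2 y - nrm2 (w *m y))) / 2.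
  apply: le_trans he; rewrite le_eqVlt; apply/orP; left; apply/eqP; ring.
rewrite /eta in eta0.
move: (nrm y * nrm h) (nrm (w *m y) * nrm w * nrm h) B2 B3 he => U V B2 B3 he.
move: (ip y h) (ip (w *m y) (w *m h)) (nrm2 h) (nrm2 y) (nrm2 (w *m h))
  (nrm2 (w *m y)) (nrm h) B1 B2 B3 B4 he Ha eta0 h0 => x1 x2 x3 x4 x5 x6 x7.
by move=> *; lra.
Qed.

End LebesgueMatrix.

(** * Integrability of powers of det (1 - w^* w) *)

Section KappaFinite.
Variables (R : realType) (F : scalar_kind) (q : nat).
Local Notation K := (Defs.scalar R F).
Local Notation mxK := (mxF R F q).
Local Notation leb := (@lebesgue_mx R F q).

Lemma measurable_form (A : 'M[K]_q) (b : 'cV[K]_q) (c : R) :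
  measurable [set w : mxK | forall u : 'cV[K]_q,
    c <= nrm2 (A *m u + b) - nrm2 ((w : 'M[K]_q) *m (A *m u + b))].
Proof.
pose S (v : 'cV[K]_q) : set mxK := [set w | c <= nrm2 v - nrm2 ((w : 'M[K]_q) *m v)].
have mS v : measurable (S v).
  have -> : S v = (fun w : mxK => nrm2 ((w : 'M[K]_q) *m v)) @^-1`
      `]-oo, (nrm2 v - c)]%classic.
    by apply/seteqP; split => w /=; rewrite /S /= in_itv /= lerBrDl lerBrDr.
  exact: measurable_preimage (measurable_nrm2_mul v) (measurable_itv _).
rewrite (_ : [set w | _] = \bigcap_n (if unpickle n is Some a
    then S (A *m ratmx R a + b) else setT)).
  by apply: bigcapT_measurable => n; case: (unpickle n) => [a|].
apply/seteqP; split => w /= H.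
  by move=> n _; case: (unpickle n) => [a|] //=; exact: H.
apply: form_dense => a; have := H (pickle a) I.
by rewrite pickleK.
Qed.

Definition contr : set mxK := [set w | mx_contraction (w : 'M[K]_q)].

Lemma measurable_contr : measurable contr.
Proof.
have -> : contr = [set w : mxK | forall u : 'cV[K]_q,
    0 <= nrm2 (1%:M *m u + 0) - nrm2 ((w : 'M[K]_q) *m (1%:M *m u + 0))].
  by apply/seteqP; split => w /= H u; have := H u; rewrite addr0 mul1mx subr_ge0.
exact: measurable_form.
Qed.

(** The matrices for which the j-th pivot of 1 - w^* w is less than e. *)
Definition low (j : 'I_q) (e : R) : set mxK :=
  [set w | exists2 v : 'cV[K]_q, flagv j v & nrm2 v - nrm2 ((w : 'M[K]_q) *m v) < e].

(** Vectors of the flag are the values of u |-> A u + b for the projection A onto the first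
    coordinates and b = e_j. *)
Lemma measurable_low j e : measurable (low j e).
Proof.
pose A : 'M[K]_q := real_diag F (\row_i (if (i < j)%N then 1 else 0)).
pose b : 'cV[K]_q := delta_mx j 0.
have fA (v : 'cV[K]_q) : flagv j v -> A *m v + b = v.
  move=> [vj vi]; apply/colP => i; rewrite mxE mul_real_diag !mxE eqxx andbT.
  case: (ltngtP i j) => ij.
  - by rewrite -val_eqE /= ltn_eqF// of_real1 mul1r addr0.
  - by rewrite -val_eqE /= gtn_eqF// of_real0 mul0r addr0 vi.
  - by rewrite (val_inj ij) eqxx of_real0 mul0r add0r vj.
have Af u : flagv j (A *m u + b).
  split=> [|i ij]; rewrite mxE mul_real_diag !mxE eqxx andbT.
    by rewrite ltnn of_real0 mul0r add0r.
  by rewrite ltnNge ltnW//= -val_eqE /= gtn_eqF// of_real0 mul0r addr0.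
rewrite (_ : low j e = ~` [set w : mxK | forall u : 'cV[K]_q,
    e <= nrm2 (A *m u + b) - nrm2 ((w : 'M[K]_q) *m (A *m u + b))]).
  exact: measurableC (measurable_form _ _ _).
apply/seteqP; split => w /=.
  by move=> [v fv lv] /(_ v); rewrite fA// leNgt lv.
move/existsNP => [u /negP]; rewrite -ltNge => lu; exists (A *m u + b) => //.
Qed.

Lemma contr_scale_col j r (w : mxK) : 0 <= r <= 1 -> contr w -> contr (scale_col j r w).
Proof.
move=> /andP[r0 r1] wc v; rewrite scale_col_mul; apply: le_trans (wc _) _.
rewrite /nrm2; apply: ler_sum => i _; apply: ler_sum => k _.
rewrite mul_real_diag mxE nsqM nsq_real; apply: ler_piMl; first exact: nsq_ge0.
by case: ifP => _; rewrite ?expr1n// expr_le1.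
Qed.

(** Only the columns 0, ..., i enter in the i-th pivot. *)
Lemma low_scale_col (i j : 'I_q) r e (w : mxK) : (i < j)%N -> low i e (scale_col j r w) <-> low i e w.
Proof.
move=> ij; suff E (v : 'cV[K]_q) : flagv i v -> (scale_col j r w : 'M[K]_q) *m v = (w : 'M[K]_q) *m v.
  by split=> -[v fv H]; exists v => //; rewrite E// in H *.
move=> [_ vi]; rewrite scale_col_mul; congr (_ *m _); apply/colP => k.
rewrite mul_real_diag mxE; case: eqP => [->|_]; first by rewrite vi// mulr0.
by rewrite of_real1 mul1r.
Qed.

(** If v_j = 1, shrinking the j-th column amounts to shrinking v, which lowers |v|^2 by
    1 - (1 - e)^2, and this is at least e. *)
Lemma low_scale_col_contr j e (w : mxK) : 0 < e < 1 -> contr w -> ~ low j e (scale_col j (1 - e) w).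
Proof.
move=> /andP[e0 e1] wc [v [vj _]]; apply/negP; rewrite -leNgt scale_col_mul.
set D := real_diag _ _; have := wc (D *m v); set a := nrm2 (_ *m (D *m v)) => wv.
suff : nrm2 (D *m v) <= nrm2 v - e by lra.
rewrite lerBrDr /nrm2 (bigD1 j)//= [leRHS](bigD1 j)//= !big_ord1 addrAC.
apply: lerD.
  by rewrite mul_real_diag mxE eqxx vj mulr1 nsq_real nsq1 expr2; nra.
apply: ler_sum => i ij; rewrite !big_ord1 mul_real_diag mxE (negPf ij).
by rewrite of_real1 mul1r.
Qed.

Lemma bernoulli_le (N : nat) (e : R) : 0 <= e <= 1 -> 1 - N%:R * e <= (1 - e) ^+ N.
Proof.
move=> /andP[e0 e1]; elim: N => [|N IH]; first by rewrite mul0r subr0 expr0.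
rewrite exprS -natr1; have N0 : 0 <= N%:R :> R by rewrite ler0n.
have : (1 - e) * (1 - N%:R * e) <= (1 - e) * (1 - e) ^+ N by apply: ler_wpM2l => //; lra.
apply: le_trans; have : 0 <= N%:R * e * e by rewrite !mulr_ge0.
by lra.
Qed.

Definition eindic (A : set mxK) (w : mxK) : \bar R := (\1_A w)%:E.

Lemma measurable_eindic A : measurable A -> measurable_fun setT (eindic A).
Proof. by move=> mA; apply/measurable_EFinP; exact: measurable_indic. Qed.

Lemma eindic_ge0 A w : (0 <= eindic A w)%E.
Proof. by rewrite lee_fin. Qed.

Lemma eindicT (A : set mxK) w : A w -> eindic A w = 1%E.
Proof. by move=> Aw; rewrite /eindic indicE mem_set. Qed.

Lemma eindicF (A : set mxK) w : ~ A w -> eindic A w = 0%E.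
Proof. by move=> Aw; rewrite /eindic indicE memNset. Qed.

(** Shrinking the j-th column by 1 - e maps the contractions into those outside low j e.
    These carry at least the fraction (1 - e)^N of the mass, N being the number of real
    coordinates of a column, so that low j e carries at most the fraction N e. *)
Lemma integral_low j e (g : mxK -> \bar R) : 0 < e ->
  measurable_fun setT g -> (forall w, 0 <= g w)%E ->
  (forall r w, g (scale_col j r w) = g w) ->
  (\int[leb]_w (eindic contr w * g w * eindic (low j e) w) <=
   (((scale_col_card F j).+1%:R * e)%R)%:E * \int[leb]_w (eindic contr w * g w))%E.
Proof.
move=> e0 mg g0 gj; set N := scale_col_card F j.
pose G w := (eindic contr w * g w)%E.
have mG : measurable_fun setT G.
  by apply: emeasurable_funM => //; exact: measurable_eindic measurable_contr.
have G0 w : (0 <= G w)%E by rewrite mule_ge0// eindic_ge0.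
have I0 : (0 <= \int[leb]_w G w)%E by exact: integral_ge0.
have le1 : (\int[leb]_w (G w * eindic (low j e) w) <= \int[leb]_w G w)%E.
  apply: ge0_integral_mono => [w _|w _|w _ _] //; first by rewrite mule_ge0 ?eindic_ge0.
  split=> //; rewrite -[leRHS]mule1 lee_wpmul2l// lee_fin indicE.
  by case: (_ \in _).
case: (leP 1 e) => [e1|e1].
  apply: le_trans le1 _; rewrite -[leLHS]mul1e lee_wpmul2r// lee_fin.
  by rewrite -[leLHS]mulr1 ler_pM// ler1n.
pose f w := (G w * eindic (~` low j e) w)%E.
have mlow := measurable_low j e.
have mf : measurable_fun setT f.
  by apply: emeasurable_funM => //; exact: measurable_eindic (measurableC mlow).
have f0 w : (0 <= f w)%E by rewrite mule_ge0 ?eindic_ge0.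
have ml : measurable_fun setT (fun w => G w * eindic (low j e) w)%E.
  by apply: emeasurable_funM => //; exact: measurable_eindic mlow.
have l0 w : (0 <= G w * eindic (low j e) w)%E by rewrite mule_ge0 ?eindic_ge0.
have split_int : (\int[leb]_w G w = \int[leb]_w f w + \int[leb]_w (G w * eindic (low j e) w))%E.
  rewrite -ge0_integralD//; apply: eq_integral => w _.
  have [H|H] := pselect (low j e w).
    by rewrite /f (eindicT H) (eindicF (A := ~` _))// mule1 mule0 add0e.
  by rewrite /f (eindicF H) (eindicT (A := ~` _))// mule1 mule0 adde0.
have r0 : 0 < 1 - e by lra.
have Gf : (\int[leb]_w G w <= \int[leb]_w f (scale_col j ((1 - e)^-1)^-1 w))%E.
  apply: ge0_integral_mono => [w _|w _|w _ Gw] //; split=> //.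
  have wc : contr w.
    by apply: contrapT => N'; move: Gw; rewrite /G (eindicF N') mul0e ltxx.
  rewrite invrK /f /G gj (eindicT (A := ~` _)) ?mule1; last first.
    by apply: low_scale_col_contr => //; rewrite e0 e1.
  rewrite !eindicT//; apply: contr_scale_col => //; lra.
rewrite integral_scale_col ?invr_gt0// in Gf.
have c0 : 0 < (scale_col_card F j).+1%:R * e by rewrite mulr_gt0.
suff key (a b c : \bar R) : (c = a + b -> c <= ((1 - e)^-1 ^+ N)%:E * a -> 0 <= a ->
    0 <= b -> b <= ((N.+1%:R * e)%R)%:E * c)%E.
  exact: key split_int Gf (integral_ge0 leb (fun w _ => f0 w)) (integral_ge0 leb (fun w _ => l0 w)).
clear split_int Gf; case: c => [c||].
- case: a => [a||]; case: b => [b||] //.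
  rewrite -EFinD -!EFinM !lee_fin => -[->] Gf a0 b0.
  have B := @bernoulli_le N e; rewrite -/N in c0.
  have {}B : 1 - N%:R * e <= (1 - e) ^+ N by apply: B; lra.
  have P0 : 0 < (1 - e) ^+ N by rewrite exprn_gt0.
  have {}Gf : (1 - e) ^+ N * (a + b) <= a.
    by move: Gf; rewrite exprVn -[leRHS]mulrC ler_pdivlMr// mulrC.
  have : (1 - N%:R * e) * (a + b) <= a by apply: le_trans Gf; rewrite ler_wpM2r ?addr_ge0.
  have : 0 <= e * (a + b) by rewrite mulr_ge0 ?addr_ge0// ltW.
  by rewrite -natr1; nra.
- by move=> *; rewrite gt0_muley ?lte_fin// leey.
- by case: a => [a||]; case: b => [b||].
Qed.
(** For b = 2^a, a dyadic majorant of the power - a of the j-th pivot. *)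
Definition layer (b : R) (j : 'I_q) (w : mxK) : \bar R :=
  (\sum_(k <oo) ((b ^+ k)%:E * eindic (low j (2 * 2^-1 ^+ k)%R) w))%E.

Section Layer.
Variable b : R.
Hypothesis b12 : 1 < b < 2.

Let b0 : 0 < b. Proof. by case/andP: b12 => *; lra. Qed.

Lemma layer_term_ge0 j k w : (0 <= (b ^+ k)%:E * eindic (low j (2 * 2^-1 ^+ k)%R) w)%E.
Proof. by rewrite mule_ge0 ?eindic_ge0// lee_fin exprn_ge0// ltW. Qed.

Lemma measurable_layer_term j k :
  measurable_fun setT (fun w => (b ^+ k)%:E * eindic (low j (2 * 2^-1 ^+ k)%R) w)%E.
Proof.
by apply: emeasurable_funM => //; apply: measurable_eindic; exact: measurable_low.
Qed.

Lemma layer_ge0 j w : (0 <= layer b j w)%E.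
Proof. by apply: nneseries_ge0 => k _ _; exact: layer_term_ge0. Qed.

Lemma measurable_layer j : measurable_fun setT (layer b j).
Proof.
apply: (@ge0_emeasurable_sum _ _ _ setT
  (fun k w => (b ^+ k)%:E * eindic (low j (2 * 2^-1 ^+ k)%R) w)%E predT) => [k w _ _|k _].
  exact: layer_term_ge0.
exact: measurable_layer_term.
Qed.

Lemma layer_scale_col (i j : 'I_q) r w : (i < j)%N -> layer b i (scale_col j r w) = layer b i w.
Proof.
move=> ij; apply: eq_eseriesr => k _; congr (_ * _)%E.
have := @low_scale_col i j r (2 * 2^-1 ^+ k) w ij => H.
have [L|L] := pselect (low i (2 * 2^-1 ^+ k) w).
  by rewrite !eindicT//; apply/H.
by rewrite !eindicF// => /H.
Qed.

Lemma geometric_sum_le (c z : R) n : 0 <= c -> 0 < z < 1 ->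
  \sum_(0 <= k < n) (c * z ^+ k) <= c / (1 - z).
Proof.
move=> c0 /andP[z0 z1]; have := @geometric_seriesE R c z (negbT (lt_eqF z1)).
move=> /(congr1 (fun f => f n)); rewrite /series /= => ->.
rewrite -mulrA ler_wpM2l// ler_piMl ?invr_ge0 ?subr_ge0 ?(ltW z1)// gerBl.
by rewrite exprn_ge0// ltW.
Qed.

Lemma nneseriesZl_le (x : \bar R) (f : nat -> \bar R) : (0 <= x)%E ->
  (forall k, 0 <= f k)%E -> (x * \sum_(k <oo) f k <= \sum_(k <oo) x * f k)%E.
Proof.
case: x => [x||] // x0 f0; first by rewrite nneseriesZl.
have [[k fk]|N] := pselect (exists k, f k != 0%E).
  rewrite [leRHS](@nneseries_pinfty _ _ predT k) ?leey// => [n _|].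
    by rewrite mule_ge0.
  by rewrite gt0_mulye// lt0e fk f0.
rewrite eseries0 ?mule0; last by move=> k _ _; apply/eqP/negPn/negP => fk; apply: N; exists k.
by apply: nneseries_ge0 => k _ _; rewrite mule_ge0.
Qed.

(** The gaps of size about 2^-k occupy a proportion of order 2^-k, so the
    weights b^k with b < 2 are summable against them. *)
Lemma integral_layer j (g : mxK -> \bar R) :
  measurable_fun setT g -> (forall w, 0 <= g w)%E ->
  (forall r w, g (scale_col j r w) = g w) ->
  (\int[leb]_w (eindic contr w * g w) < +oo)%E ->
  (\int[leb]_w (eindic contr w * (g w * layer b j w)) < +oo)%E.
Proof.
move=> mg g0 gj; set I := (\int[leb]_w _)%E => Ifin.
have I0 : (0 <= I)%E by apply: integral_ge0 => w _; rewrite mule_ge0 ?eindic_ge0.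
have If : I \is a fin_num by rewrite ge0_fin_numE.
have cg0 w : (0 <= eindic contr w * g w)%E by rewrite mule_ge0 ?eindic_ge0.
have mcg : measurable_fun setT (fun w => eindic contr w * g w)%E.
  by apply: emeasurable_funM => //; exact: measurable_eindic measurable_contr.
pose u k w := ((b ^+ k)%:E * (eindic contr w * g w * eindic (low j (2 * 2^-1 ^+ k)%R) w))%E.
have u0 k w : (0 <= u k w)%E.
  by rewrite mule_ge0 ?lee_fin ?exprn_ge0 ?(ltW b0)// mule_ge0 ?eindic_ge0.
have mcge k : measurable_fun setT
    (fun w => eindic contr w * g w * eindic (low j (2 * 2^-1 ^+ k)%R) w)%E.
  by apply: emeasurable_funM => //; apply: measurable_eindic; exact: measurable_low.
have mu k : measurable_fun setT (u k) by apply: emeasurable_funM.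
apply: (@le_lt_trans _ _ (\int[leb]_w (\sum_(k <oo) u k w))%E).
  apply: ge0_integral_mono => [w _|w _|w _ _].
  - by rewrite !mule_ge0 ?eindic_ge0 ?layer_ge0.
  - by apply: nneseries_ge0.
  split=> //; rewrite muleA; apply: le_trans (nneseriesZl_le (cg0 w) _) _.
    by move=> k; exact: layer_term_ge0.
  apply: lee_nneseries => k _; first by rewrite mule_ge0 ?layer_term_ge0.
  by rewrite muleCA.
rewrite integral_nneseries//.
pose c := (scale_col_card F j).+1%:R * 2 * fine I.
have c0 : 0 <= c by rewrite !mulr_ge0// fine_ge0.
apply: (@le_lt_trans _ _ (c / (1 - b / 2))%:E); last exact: ltry.
apply: lime_le; first by apply: is_cvg_nneseries => n _ _; exact: integral_ge0.
apply: nearW => n; apply: (@le_trans _ _ (\sum_(0 <= k < n) (c * (b / 2) ^+ k)%:E)%E).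
  apply: lee_sum => k _; rewrite /u ge0_integralZl//; last 2 first.
  - by move=> w _; rewrite mule_ge0 ?eindic_ge0.
  - by rewrite lee_fin exprn_ge0// ltW.
  have e0 : 0 < 2 * 2^-1 ^+ k :> R by rewrite mulr_gt0// exprn_gt0// invr_gt0.
  have := integral_low e0 mg g0 gj; rewrite -/I -(fineK If) -EFinM.
  move/(lee_wpmul2l (x := (b ^+ k)%:E)); rewrite lee_fin exprn_ge0 ?(ltW b0)// -EFinM.
  move=> /(_ isT) H; apply: le_trans H _; rewrite lee_fin le_eqVlt; apply/orP; left.
  by apply/eqP; rewrite /c exprMn; ring.
rewrite sumEFin lee_fin; apply: geometric_sum_le => //.
by case/andP: b12 => b1 b2; rewrite divr_gt0//= ltr_pdivrMr// mul1r.
Qed.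

Lemma prod_layer_ge0 s w : (0 <= \big[mule/1%E]_(i <- s) layer b i w)%E.
Proof. by elim/big_rec: _ => // i x _ x0; rewrite mule_ge0 ?layer_ge0. Qed.

Lemma measurable_prod_layer s :
  measurable_fun setT (fun w => \big[mule/1%E]_(i <- s) layer b i w)%E.
Proof.
elim: s => [|i s IH].
  by under eq_fun do rewrite big_nil; exact: measurable_cst.
under eq_fun do rewrite big_cons.
by apply: emeasurable_funM => //; exact: measurable_layer.
Qed.

(** The factors are removed in decreasing order of the index: those that remain do not see
    the column that is being scaled. *)
Lemma integral_layers (s : seq 'I_q) : pairwise (fun j i : 'I_q => (i < j)%N) s ->
  (\int[leb]_w (eindic contr w * \big[mule/1%E]_(i <- s) layer b i w) < +oo)%E.
Proof.
elim: s => [_|j s IH].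
  under eq_integral do rewrite big_nil mule1.
  rewrite integral_indic ?setIT; [|exact: measurableT|exact: measurable_contr].
  apply: lebesgue_contraction_fin => //; exact: measurable_contr.
rewrite pairwise_cons => /andP[/allP js /IH sfin].
under eq_integral do rewrite big_cons muleC [(layer _ _ _ * _)%E]muleC -muleA.
under eq_integral do rewrite muleA muleC.
apply: integral_layer => // [|w|r w]; [exact: measurable_prod_layer|exact: prod_layer_ge0|].
by apply: eq_big_seq => i /js; exact: layer_scale_col.
Qed.

Lemma dyadic_bracket (t : R) : 0 < t <= 1 ->
  exists k, 2^-1 ^+ k <= t /\ t < 2 * 2^-1 ^+ k.
Proof.
move=> /andP[t0 t1]; have ex : exists k, 2^-1 ^+ k <= t.
  have : (fun n => (2^-1 : R) ^+ n) @ \oo --> (0 : R).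
    by apply: cvg_expr; rewrite gtr0_norm ?invr_gt0// invf_lt1// ltr1n.
  move/cvgrPdist_lt => /(_ t t0)[N _ HN]; exists N.
  have := HN N (leqnn N); rewrite sub0r normrN gtr0_norm ?exprn_gt0 ?invr_gt0//.
  exact: ltW.
case: (ex_minnP ex) => -[|k] kt kmin.
  by exists 0%N; split=> //; rewrite expr0 mulr1; lra.
exists k.+1; split=> //; rewrite exprS mulrA divff ?mul1r ?pnatr_eq0// ltNge.
by apply/negP => /kmin; rewrite ltnn.
Qed.
End Layer.

Lemma powR_le_layer (a t : R) (j : 'I_q) (w : mxK) (v : 'cV[K]_q) : 0 < a < 1 -> 0 < t <= 1 ->
  flagv j v -> nrm2 v - nrm2 ((w : 'M[K]_q) *m v) = t ->
  ((t `^ (- a))%:E <= layer (2 `^ a) j w)%E.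
Proof.
move=> /andP[a0 a1] t01 fv vt; have [k [k1 k2]] := dyadic_bracket t01.
have b0 : 0 < 2 `^ a :> R by rewrite powR_gt0.
have term k' : (0 <= ((2 `^ a) ^+ k')%:E * eindic (low j (2 * 2^-1 ^+ k')%R) w)%E.
  by rewrite mule_ge0 ?eindic_ge0// lee_fin exprn_ge0// ltW.
apply: (@le_trans _ _ (((2 `^ a) ^+ k)%:E * eindic (low j (2 * 2^-1 ^+ k)%R) w)%E); last first.
  apply: le_trans (nneseries_lim_ge k.+1 (fun n _ _ => term n)).
  by rewrite big_nat_recr//= leeDr// sume_ge0.
rewrite eindicT ?mule1; last by exists v => //; rewrite vt.
rewrite lee_fin; apply: (@le_trans _ _ ((2^-1 ^+ k) `^ (- a))).
  by rewrite !powRN lef_pV2 ?posrE ?powR_gt0 ?exprn_gt0 ?invr_gt0//; 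
     [apply: ge0_ler_powR; rewrite ?nnegrE ?exprn_ge0 ?invr_ge0// ltW//; case/andP: t01|case/andP: t01].
have -> : 2^-1 ^+ k = 2 `^ (- k%:R) :> R by rewrite powRN powR_mulrn// exprVn.
by rewrite -powRrM mulrNN -[leRHS]powR_mulrn ?powR_ge0// -powRrM mulrC.
Qed.

(** The Cholesky factor of 1 - w^* w relates the gaps |v|^2 - |w v|^2 to the determinant. *)
Lemma ball_cholesky (w : 'M[K]_q) : posdefmx (1%:M - adjmx w *m w) ->
  exists T t, [/\ utri T t, forall v : 'cV[K]_q, nrm2 (T *m v) = nrm2 v - nrm2 (w *m v),
    hermdet (1%:M - adjmx w *m w) = \prod_i t i ^+ 2 & forall i, t i ^+ 2 <= 1].
Proof.
move=> /[dup] wb /cholesky[T [t [Tt TE]]]; exists T, t.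
have Tv (v : 'cV[K]_q) : nrm2 (T *m v) = nrm2 v - nrm2 (w *m v).
  by rewrite !nrm2E !ip_adjr !mulmxA TE mulmxBl ipDr ipNr mul1mx.
split=> //; first by rewrite -TE; exact: hermdet_gram Tt.
move=> i; apply: le_trans (utri_lower (v := delta_mx i 0) Tt _) _.
  split=> [|l il]; first by rewrite mxE !eqxx.
  by rewrite mxE -val_eqE gtn_eqF.
by rewrite Tv nrm2_delta gerBl nrm2_ge0.
Qed.

Lemma ball_contr (w : mxK) : ball_mx w -> contr w.
Proof. by move=> /ball_cholesky[T [t [_ Tv _ _]]] v; rewrite -subr_ge0 -Tv nrm2_ge0. Qed.

(** The determinant is the product of the pivots, which lie in ]0, 1]; each power of a pivot
    is dominated by a layer function. *)
Lemma hermdet_powR_integral (s M : R) : -1 < s -> 0 <= M ->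
  (\int[leb]_(w in @ball_mx R F q)
    (M * (hermdet (1%:M - adjmx (w : 'M[K]_q) *m w)) `^ s)%:E < +oo)%E.
Proof.
(* it suffices to treat the exponent - a <= s, with 0 < a < 1 *)
move=> s1 M0; pose a : R := Num.max (- s) 2^-1.
have a01 : 0 < a < 1.
  rewrite /a lt_max gt_max invr_gt0 ltr0n orbT /= ltrNl s1/=.
  by rewrite invf_lt1// ltr1n.
have b12 : 1 < (2 : R) `^ a < 2.
  have l2 : 0 < ln (2 : R) by rewrite ln_gt0// ltr1n.
  case/andP: a01 => a0 a1; rewrite /powR pnatr_eq0 /= expR_gt1 mulr_gt0//=.
  by rewrite -[ltRHS](@lnK R 2) ?posrE// ltr_expR gtr_pMl.
have := @integral_layers _ b12 (rev (enum 'I_q)).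
have -> : pairwise (fun j i : 'I_q => (i < j)%N) (rev (enum 'I_q)).
  rewrite -sorted_pairwise ?rev_sorted; last by move=> x y z xy yz; exact: ltn_trans yz xy.
  by have := iota_ltn_sorted 0 q; rewrite -val_enum_ord sorted_map.
move/(_ isT); set f := (fun w => _ * _)%E => I1.
have f0 w : (0 <= f w)%E by rewrite mule_ge0 ?eindic_ge0 ?prod_layer_ge0.
have mf : measurable_fun setT f.
  apply: emeasurable_funM; last exact: measurable_prod_layer.
  by apply: measurable_eindic; exact: measurable_contr.
apply: (@le_lt_trans _ _ (\int[leb]_w (M%:E * f w))%E); last first.
  by rewrite ge0_integralZl//= lte_mul_pinfty// ge0_fin_numE// integral_ge0.
apply: ge0_integral_mono => [w _|w _|w wb _].
- by rewrite lee_fin mulr_ge0// powR_ge0.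
- by rewrite mule_ge0.
split=> //; rewrite EFinM lee_wpmul2l// /f eindicT ?mul1e; last exact: ball_contr.
have [T [t [Tt Tv -> t1]]] := ball_cholesky wb.
have t0 i : 0 < t i by case: Tt.
have P01 : 0 < \prod_i t i ^+ 2 <= 1.
  rewrite prodr_gt0 ?prodr_ile1//= => [i _|i _]; last by rewrite exprn_gt0.
  by rewrite exprn_ge0 ?t1// ltW.
apply: (@le_trans _ _ ((\prod_i t i ^+ 2) `^ (- a))%:E).
  by rewrite lee_fin; apply: ger_powR => //; rewrite lerNl /a le_max lexx.
rewrite (_ : \prod_i t i ^+ 2 = \prod_(i <- rev (enum 'I_q)) t i ^+ 2); last first.
  by rewrite -[LHS]big_enum; apply: perm_big; rewrite perm_sym perm_rev.
elim: (rev _) => [|i l IH]; first by rewrite !big_nil powR1.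
rewrite !big_cons powRM ?exprn_ge0 ?(ltW (t0 _))//; last first.
  by apply: prodr_ge0 => k _; rewrite exprn_ge0// ltW.
rewrite EFinM; apply: lee_pmul IH; rewrite ?lee_fin ?powR_ge0//.
have [v fv vt] := utri_attain i Tt; apply: (@powR_le_layer a _ i w v) => //.
  by rewrite t1 exprn_gt0.
by rewrite -Tv.
Qed.

End KappaFinite.

(** * Test functions *)

Section Bump.
Variables (R : realType) (q : nat).

Lemma dist_coord_continuous (h : 'rV[R]_q) i :
  continuous (fun y : 'rV[R]_q => `|y 0 i - h 0 i|).
Proof.
move=> x; apply: (@continuous_comp _ _ _ (fun y : 'rV[R]_q => y 0 i - h 0 i) (@Num.norm R R)).
  apply: (@continuousB _ _ _ (fun y : 'rV[R]_q => y 0 i) (cst (h 0 i))).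
    exact: coord_continuous.
  exact: cst_continuous.
exact: norm_continuous.
Qed.

(** A continuous bump at h, supported in the box of half-side eps. *)
Definition tent (h : 'rV[R]_q) (eps : R) (y : 'rV[R]_q) : R :=
  Num.max (eps - \sum_(i < q) `|y 0 i - h 0 i|) 0.

Lemma tent_ge0 h eps y : 0 <= tent h eps y.
Proof. by rewrite le_max lexx orbT. Qed.

Lemma tent_le h eps y : 0 <= eps -> tent h eps y <= eps.
Proof. by move=> e0; rewrite ge_max e0 andbT gerBl sumr_ge0. Qed.

Lemma tent_neq0 h eps y : tent h eps y != 0 -> forall i, `|y 0 i - h 0 i| <= eps.
Proof.
rewrite /tent /Num.max; case: ifP => [_|/negbT]; first by rewrite eqxx.
rewrite -leNgt subr_ge0 => H _ i; apply: le_trans H.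
by rewrite (bigD1 i)//= lerDl sumr_ge0.
Qed.

Lemma tent_continuous h eps : continuous (tent h eps).
Proof.
move=> y; apply: (@continuous_max R _ (fun y : 'rV[R]_q => eps - \sum_(i < q) `|y 0 i - h 0 i|)
  (cst 0)); last exact: cst_continuous.
apply: (@continuousB _ _ _ (cst eps) (fun y : 'rV[R]_q => \sum_(i < q) `|y 0 i - h 0 i|)).
  exact: cst_continuous.
apply: continuous_big => [|i _ x]; first exact: add_continuous.
exact: dist_coord_continuous.
Qed.

Lemma rhoA_continuous F : continuous (@rhoA R F q).
Proof.
apply: continuous_big => [|i _ x]; first exact: add_continuous.
apply: (@continuousM _ _ (cst _) (fun h : 'rV[R]_q => h 0 i)); first exact: cst_continuous.
exact: coord_continuous.
Qed.

Definition box (h : 'rV[R]_q) (eps : R) : set 'rV[R]_q :=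
  [set y | forall i, `|y 0 i - h 0 i| <= eps].

Lemma compact_box h eps : compact (box h eps).
Proof.
rewrite (_ : box h eps = [set y : 'rV[R]_q | forall i,
    `[(h 0 i - eps), (h 0 i + eps)]%classic (y 0 i)]).
  by apply: (@rV_compact R q (fun i => `[(h 0 i - eps), (h 0 i + eps)]%classic)) => i;
    exact: segment_compact.
by apply/seteqP; split => y /= H i; have := H i; rewrite /= in_itv /= ler_distl.
Qed.

Lemma closed_box h eps : closed (box h eps).
Proof.
rewrite (_ : box h eps = \bigcap_(i in setT) [set y : 'rV[R]_q | `|y 0 i - h 0 i| <= eps]).
  apply: closed_bigI => i _.
  apply: (@closed_comp _ _ (fun y : 'rV[R]_q => `|y 0 i - h 0 i|) [set a | a <= eps]) => [y _|].
    exact: dist_coord_continuous.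
  exact: closed_le.
by apply/seteqP; split => y /= H i; [move=> _|]; exact: H.
Qed.

Lemma box_nbhs (O : set 'rV[R]_q) h : open O -> O h ->
  exists2 eps, 0 < eps & box h eps `<=` O.
Proof.
move=> Oo Oh; have /nbhs_ballP[e /= e0 He] : nbhs h O by exact: open_nbhs_nbhs.
exists (e / 2); first by rewrite divr_gt0.
move=> y yb; apply: He; split=> // i j; rewrite (ord1 i).
rewrite -ball_normE /= distrC; apply: le_lt_trans (yb j) _; lra.
Qed.

(** The weight cancels the factor in the dual Abel transform of type A. *)
Definition test_fun F h eps (y : 'rV[R]_q) : R := tent h eps y * expR (rhoA F y).

Lemma test_fun_support F h eps : fun_support (test_fun F h eps) `<=` box h eps.
Proof.
rewrite [X in _ `<=` X](closure_id _).1; last exact: closed_box.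
apply: closureS => y /=; rewrite /test_fun mulf_eq0 negb_or => /andP[/tent_neq0 //].
Qed.

Lemma test_fun_Cc F h eps : Cc (test_fun F h eps).
Proof.
split.
  move=> y; apply: continuousM; first exact: tent_continuous.
  by apply: continuous_comp; [exact: rhoA_continuous|exact: continuous_expR].
apply: subclosed_compact (@compact_box h eps) _; first exact: closed_closure.
exact: test_fun_support.
Qed.

End Bump.

(** * Bounds for the integrands *)

Section Estimates.
Variables (R : realType) (F : scalar_kind) (q : nat).
Local Notation K := (Defs.scalar R F).
Local Notation mxK := (mxF R F q).
Local Notation leb := (@lebesgue_mx R F q).
Local Notation ballK := (@ball_mx R F q).
Implicit Type X : 'rV[R]_q.

(** Where the Iwasawa decomposition does not exist HA is 0, which lies in the hull too. *)
Lemma HA_in_hull X (w k : 'M[K]_q) : mx_contraction w -> Ugroup k ->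
  weyl_hull X (HA (Zmx X w *m k)).
Proof.
move=> wc Uk; have [s sX] := sortingP X; rewrite (weyl_hull_wmaj sX) /=.
have [->|/iwasawa_utri[T [Tt TE]]] := HA_cases (Zmx X w *m k).
  move=> r u e; rewrite big1 ?sumr_ge0// => i _; by rewrite mxE mulr0.
apply: (Zmx_wmaj wc (Ugroup_unitary Uk) Tt _ sX) => v.
by rewrite (gram_nrm2 _ TE) mulmxA.
Qed.

(** The Iwasawa exponents of Z(X, w) lie in the hull, so their sum, which is the
    logarithm of the determinant, is at most the sum of the |x_i|. *)
Lemma absdet_Zmx X (w : 'M[K]_q) : mx_contraction w ->
  exists2 y, absdet (Zmx X w) = expR y & `|y| <= \sum_i `|X 0 i|.
Proof.
move=> wc; have [s sX] := sortingP X.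
have : posdefmx (adjmx (Zmx X w) *m Zmx X w).
  apply: posdef_gram => v v0; apply: nrm2_gt0; apply: contra v0 => /eqP Zv.
  by apply/eqP; exact: Zmx_inj Zv.
move=> /cholesky[T [t [Tt TE]]]; have t0 i : 0 < t i by case: Tt.
pose h : 'rV[R]_q := \row_i ln (t i).
have hE i : expR (h 0 i) = t i by rewrite mxE lnK ?posrE.
have Th : utri T (fun i => expR (h 0 i)).
  by case: Tt => Td Tl _; split=> // i; rewrite ?hE.
have hm : wmaj X s h.
  apply: (Zmx_wmaj (k := 1%:M) wc (unitary1 _ _ _) Th _ sX) => v.
  by rewrite mul1mx (gram_nrm2 _ TE).
exists (\sum_i h 0 i).
  rewrite /absdet -TE (hermdet_gram Tt) expR_sum prodrXl sqrtr_sqr ger0_norm.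
    by apply: eq_bigr => i _; rewrite hE.
  by apply: prodr_ge0 => i _; exact: ltW.
have sumX : \sum_i `|X 0 i| = \sum_i `|X 0 (s i)| by rewrite (reindex_perm s).
have E (f : 'I_q -> R) : \sum_(i < q | (i < q)%N) f i = \sum_i f i.
  by apply: eq_bigl => i; rewrite ltn_ord.
rewrite ler_norml sumX; apply/andP; split.
  have := hm q 1%g (fun=> true); rewrite !E; under eq_bigr do rewrite expr1 mulN1r perm1.
  by rewrite sumrN lerNl.
by have := hm q 1%g (fun=> false); rewrite !E; under eq_bigr do rewrite expr0 mul1r perm1.
Qed.

Lemma absdet_powR_bounds X (e : R) : exists2 B, 0 < B &
  forall w : 'M[K]_q, mx_contraction w -> B^-1 <= absdet (Zmx X w) `^ e <= B.
Proof.
exists (expR (\sum_i `|X 0 i| * `|e|)); first exact: expR_gt0.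
move=> w wc; have [y -> yX] := absdet_Zmx X wc.
rewrite -expRN /powR gt_eqF ?expR_gt0// expRK !ler_expR -ler_norml normrM mulrC.
by rewrite -mulr_suml ler_wpM2r.
Qed.

(** Each pivot of 1 - w^* w is at least 1 - r and at most 1. *)
Lemma shrink_ball (w : 'M[K]_q) r : 0 <= r < 1 -> (forall v : 'cV[K]_q, nrm2 (w *m v) <= r * nrm2 v) ->
  ballK w /\ (1 - r) ^+ q <= hermdet (1%:M - adjmx w *m w) <= 1.
Proof.
move=> /andP[r0 r1] wr; have wb : posdefmx (1%:M - adjmx w *m w).
  apply/posdefP; split; first by rewrite adjmxB adjmx1 adjmxM adjmxK.
  move=> v v0; have v2 := nrm2_gt0 v0; have := wr v.
  rewrite mulmxBl mul1mx ipDr ipNr -nrm2E -mulmxA -ip_adjr -nrm2E; nra.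
split=> //; have [T [t [Tt Tv -> t1]]] := ball_cholesky wb.
have r1' : 0 <= 1 - r by lra.
apply/andP; split; last first.
  by apply: prodr_ile1 => i _; rewrite t1 sqr_ge0.
rewrite -[X in _ ^+ X]card_ord -prodr_const; apply: ler_prod => i _.
rewrite r1' /=; have [v [vi _] <-] := utri_attain i Tt.
rewrite Tv; have := wr v; have := nsq_le_nrm2 v i 0; rewrite vi nsq1; nra.
Qed.

Lemma powR_ge_norm (a x s : R) : 0 < a -> a <= x <= 1 -> a `^ `|s| <= x `^ s.
Proof.
move=> a0 /andP[ax x1]; have x0 : 0 < x by lra.
apply: (@le_trans _ _ (x `^ `|s|)).
  by apply: ge0_ler_powR; rewrite ?nnegrE ?(ltW a0) ?(ltW x0).
by apply: ger_powR; rewrite ?x0// ler_norm.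
Qed.

(** The ball of radius eta / 2 around (1 - eta) w0, for small eta. *)
Lemma strict_contraction_near (w0 : 'M[K]_q) del : mx_contraction w0 -> 0 < del ->
  exists w1 r s, [/\ 0 < r, 0 <= s < 1 & forall w : 'M[K]_q, frob_ball w1 r w ->
    nrm (w - w0) < del /\ forall v : 'cV[K]_q, nrm2 (w *m v) <= s * nrm2 v].
Proof.
move=> wc del0; have w00 := nrm_ge0 w0; have N0 : 0 < 1 + nrm w0 by lra.
pose eta := Num.min 2^-1 (del / (1 + nrm w0)).
have eta0 : 0 < eta by rewrite lt_min invr_gt0 ltr0n divr_gt0.
have eta1 : eta <= 2^-1 by rewrite ge_min lexx.
have eta2 : eta * (1 + nrm w0) <= del by rewrite -ler_pdivlMr// ge_min lexx orbT.
have half : 2^-1 < 1 :> R by rewrite invf_lt1// ltr1n.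
exists (of_real F (1 - eta) *: w0), (eta / 2), ((1 - eta / 2) ^+ 2); split.
- by rewrite divr_gt0.
- by rewrite sqr_ge0/= expr_lt1//; lra.
move=> w; rewrite /frob_ball /= => ww; split.
  have -> : w - w0 = (w - of_real F (1 - eta) *: w0) + of_real F (- eta) *: w0.
    rewrite -addrA; congr (_ + _); rewrite -scaleNr -of_realN -scalerDl -of_realD.
    by rewrite (_ : - (1 - eta) - eta = -1); [rewrite of_realN of_real1 scaleN1r|ring].
  apply: le_lt_trans (nrmD _ _) _; rewrite nrmZ normrN gtr0_norm//; lra.
move=> v; have wv : nrm (w *m v) <= (1 - eta / 2) * nrm v.
  have -> : w *m v = (w - of_real F (1 - eta) *: w0) *m v + of_real F (1 - eta) *: (w0 *m v).
    by rewrite mulmxBl scalemxAl subrK.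
  apply: le_trans (nrmD _ _) _; rewrite nrmZ ger0_norm; last by lra.
  have H1 := nrm_mul (w - of_real F (1 - eta) *: w0) v.
  have H2 : nrm (w0 *m v) <= nrm v by rewrite ler_wsqrtr.
  have := nrm_ge0 v; have := nrm_ge0 (w - of_real F (1 - eta) *: w0); nra.
rewrite -!nrm_sqr -exprMn lerXn2r ?nnegrE ?nrm_ge0// mulr_ge0 ?nrm_ge0//; lra.
Qed.

Lemma Zmx_near X (w0 k0 : 'M[K]_q) del : 0 < del ->
  exists2 e, 0 < e & forall w k : 'M[K]_q, nrm (w - w0) < e -> nrm (k - k0) < e ->
    nrm (Zmx X w *m k - Zmx X w0 *m k0) <= del.
Proof.
move=> del0; pose S : 'M[K]_q := real_diag F (map_mx (@Defs.sinh R) X).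
pose Z0 : 'M[K]_q := Zmx X w0.
have S0 := nrm_ge0 S; have Z00 := nrm_ge0 Z0; have k00 := nrm_ge0 k0.
pose L := nrm S * (nrm k0 + 1) + nrm Z0 + 1.
have L0 : 0 < L by rewrite /L; nra.
exists (Num.min 1 (del / L)); first by rewrite lt_min ltr01 divr_gt0.
move=> w k; rewrite !lt_min => /andP[_ we] /andP[k1 ke].
have -> : Zmx X w *m k - Zmx X w0 *m k0 = S *m (w - w0) *m k + Z0 *m (k - k0).
  rewrite [Z0 *m _]mulmxBr addrA -mulmxDl; congr (_ *m _ - _).
  by rewrite /Z0 /Zmx -/S mulmxBr [RHS]addrCA subrK.
have kk : nrm k <= nrm k0 + 1.
  by rewrite -[k](subrK k0) addrC; apply: le_trans (nrmD _ _) _; rewrite lerD2l ltW.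
have a0 := nrm_ge0 (w - w0); have b0 := nrm_ge0 (k - k0).
have H1 : nrm (S *m (w - w0) *m k) <= nrm S * (nrm k0 + 1) * (del / L).
  apply: le_trans (nrm_mul _ _) _.
  apply: (@le_trans _ _ (nrm S * nrm (w - w0) * (nrm k0 + 1))).
    by apply: ler_pM; rewrite ?nrm_ge0 ?nrm_mul.
  rewrite mulrAC; apply: ler_wpM2l; last exact: ltW.
  by rewrite mulr_ge0//; lra.
have H2 : nrm (Z0 *m (k - k0)) <= nrm Z0 * (del / L).
  by apply: le_trans (nrm_mul _ _) _; rewrite ler_wpM2l// ltW.
apply: le_trans (nrmD _ _) _.
have D : L * (del / L) = del by rewrite mulrC divfK ?gt_eqF.
have dL : 0 < del / L by exact: divr_gt0.
rewrite -[leRHS]D /L !mulrDl mul1r; lra.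
Qed.

End Estimates.

(** * Positivity and finiteness of the transform *)

Section Support.
Variables (R : realType) (F : scalar_kind) (q : nat).
Variable dk : probability (mxF R F q) R.
Hypothesis hdk : normalized_haar dk.
Variable p : R.
Hypothesis hp : 2 * q%:R - 1 < p.
Variable X : 'rV[R]_q.
Local Notation K := (Defs.scalar R F).
Local Notation mxK := (mxF R F q).
Local Notation leb := (@lebesgue_mx R F q).
Local Notation ballK := (@ball_mx R F q).
Local Notation s := (m_exponent F q p).
Local Notation hd w := (hermdet (1%:M - adjmx (w : 'M[K]_q) *m w)).

Lemma m_exponent_gt : -1 < s.
Proof.
have d0 : 0 < (sdim F)%:R :> R by rewrite ltr0n sdim_gt0.
have : 0 < (sdim F)%:R * (p - (2 * q%:R - 1)) by rewrite mulr_gt0// subr_gt0.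
by rewrite /m_exponent; lra.
Qed.

Lemma hermdet_integral_gt0 : (0 < \int[leb]_(w in ballK) (hd w `^ s)%:E)%E.
Proof.
have r01 : 0 < (2^-1 : R) by rewrite invr_gt0.
have c0 : mx_contraction (0 : 'M[K]_q) by move=> v; rewrite mul0mx nrm20 nrm2_ge0.
have [w1 [r [t [r0 t01 H]]]] := strict_contraction_near c0 r01.
have t1 : 0 < (1 - t) ^+ q by rewrite exprn_gt0//; case/andP: t01 => *; lra.
apply: (@lt_le_trans _ _ (\int[leb]_(w in frob_ball w1 r) (((1 - t) ^+ q) `^ `|s|)%:E)%E).
  rewrite integral_cst; last exact: measurable_frob_ball.
  by rewrite mule_gt0 ?lebesgue_ball_gt0// lte_fin powR_gt0.
apply: ge0_integral_mono => [w _|w _|w /H[_ wt] _]; rewrite ?lee_fin ?powR_ge0//.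
by have [wb hw] := shrink_ball t01 wt; split=> //; exact: powR_ge_norm.
Qed.

Lemma kappa_gt0 : 0 < kappa F q p.
Proof.
rewrite /kappa /Rintegral fine_gt0// hermdet_integral_gt0/=.
have := @hermdet_powR_integral R F q s 1 m_exponent_gt ler01.
by under eq_integral do rewrite mul1r.
Qed.

(** All the points HA (Z(X, w) k) lie in the hull. *)
Lemma abel_dual_outside f : (forall y, weyl_hull X y -> f y = 0) -> abel_dual dk p f X = 0.
Proof.
move=> f0; rewrite /abel_dual /Rintegral integral0_eq// => w wb.
rewrite /abelA_dual /Rintegral integral0_eq ?mul0r// => k Uk.
by rewrite f0 ?mul0r//; apply: HA_in_hull => //; exact: ball_contr.
Qed.

Section Inside.
Variables (h : 'rV[R]_q) (eps : R).
Hypothesis eps0 : 0 < eps.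

Lemma abelA_test_fun (g : 'M[K]_q) : abelA_dual dk (test_fun F h eps) g =
  fine (\int[dk]_(k in @Ugroup R F q) (tent h eps (HA (g *m k)))%:E).
Proof.
rewrite /abelA_dual /Rintegral; congr fine; apply: eq_integral => k _; congr EFin.
by rewrite /test_fun -mulrA -expRD subrr expR0 mulr1.
Qed.

Lemma abelA_test_fun_fin (g : 'M[K]_q) :
  (\int[dk]_(k in @Ugroup R F q) (tent h eps (HA (g *m k)))%:E <= eps%:E)%E.
Proof.
apply: (@le_trans _ _ (\int[dk]_(k in @Ugroup R F q) eps%:E)%E).
  apply: ge0_integral_mono => [k _|k _|k Uk _]; rewrite ?lee_fin ?tent_ge0 ?(ltW eps0)//.
  by split=> //; rewrite tent_le// ltW.
rewrite integral_cst; last exact: measurable_Ugroup.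
rewrite le_eqVlt; apply/orP; left; apply/eqP; transitivity (eps%:E * 1)%E; last exact: mule1.
by congr (_ * _)%E; exact: (proj1 hdk).
Qed.

Lemma abelA_test_fun_bounds (g : 'M[K]_q) :
  0 <= abelA_dual dk (test_fun F h eps) g <= eps.
Proof.
rewrite abelA_test_fun; have H := abelA_test_fun_fin g.
have I0 : (0 <= \int[dk]_(k in @Ugroup R F q) (tent h eps (HA (g *m k)))%:E)%E.
  by apply: integral_ge0 => k _; rewrite lee_fin tent_ge0.
rewrite fine_ge0//= -lee_fin fineK// ge0_fin_numE//.
by apply: le_lt_trans H _; exact: ltry.
Qed.

(** By [iwasawa_near] and [Zmx_near], HA (Z(X, w) k) is near h for w near w0 and for k in a ball
    of positive Haar measure. *)
Lemma abelA_test_fun_near : attained F X h -> exists w0 e c,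
  [/\ mx_contraction w0, 0 < e, 0 < c & forall w : 'M[K]_q, nrm (w - w0) < e ->
    c <= abelA_dual dk (test_fun F h eps) (Zmx X w)].
Proof.
move=> [w0 [k0 [k' [T [wc Uk0 Uk' Tt E]]]]].
have q0 : 0 < q.+1%:R :> R by rewrite ltr0n.
have e2 : 0 < eps / 2 / q.+1%:R by rewrite !divr_gt0.
have [del del0 Hdel] := iwasawa_near Uk' Tt e2.
have [e e0 He] := Zmx_near X w0 k0 del0.
pose A := frob_ball k0 e `&` @Ugroup R F q.
have mA : measurable (A : set mxK).
  by apply: measurableI; [exact: measurable_frob_ball|exact: measurable_Ugroup].
have dkA : (0 < dk A)%E by exact: haar_ball_gt0.
have dkAf : dk A \is a fin_num by exact: fin_num_measure.
exists w0, e, (eps / 2 * fine (dk A)); split=> //.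
  by rewrite mulr_gt0 ?divr_gt0// fine_gt0// dkA ltey_eq dkAf.
move=> w we; rewrite abelA_test_fun -lee_fin fineK; last first.
  rewrite ge0_fin_numE; first exact: le_lt_trans (abelA_test_fun_fin _) (ltry _).
  by apply: integral_ge0 => k _; rewrite lee_fin tent_ge0.
rewrite EFinM fineK// -integral_cst//.
apply: ge0_integral_mono => [k _|k _|k [kb Uk] _]; rewrite ?lee_fin ?tent_ge0 ?divr_ge0 ?(ltW eps0)//.
split=> //; have := He w k we kb; rewrite E => /Hdel[g gI gh].
rewrite (HA_iwasawa gI) le_max; apply/orP; left.
have : \sum_(i < q) `|g 0 i - h 0 i| <= \sum_(i < q) (eps / 2 / q.+1%:R).
  by apply: ler_sum => i _; exact: ltW.
rewrite sumr_const card_ord -[_ *+ q]mulr_natr => H.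
have : eps / 2 / q.+1%:R * q%:R <= eps / 2.
  by rewrite mulrAC ler_pdivrMr// ler_wpM2l ?divr_ge0 ?(ltW eps0)// ler_nat.
by move=> /(le_trans H); lra.
Qed.

(** The weights of the outer integral are bounded above by a multiple of the
    integrable density, and below by a constant near the relevant contraction. *)
Lemma abel_dual_test_fun_gt0 : weyl_hull X h -> 0 < abel_dual dk p (test_fun F h eps) X.
Proof.
move=> /(@weyl_hull_attained _ F _ _ _)/abelA_test_fun_near[w0 [e [c [wc e0 c0 Hc]]]].
have [B B0 HB] := @absdet_powR_bounds R F q X (- ((sdim F)%:R * (p + 1) / 2) + 1).
have k0 := kappa_gt0; have k0' : 0 < (kappa F q p)^-1 by rewrite invr_gt0.
set a := (- ((sdim F)%:R * (p + 1) / 2) + 1) in HB.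
pose G (w : mxK) := abelA_dual dk (test_fun F h eps) (Zmx X w) *
     absdet (Zmx X w) `^ a * m_density p w.
have G0 w : 0 <= G w.
  have /andP[I0 _] := abelA_test_fun_bounds (Zmx X w).
  by rewrite /G /m_density !mulr_ge0 ?powR_ge0// ltW.
rewrite /abel_dual /Rintegral -/a fine_gt0//; apply/andP; split.
  have [w1 [r [t [r0 t01 H]]]] := strict_contraction_near wc e0.
  have t1 : 0 < (1 - t) ^+ q by rewrite exprn_gt0//; case/andP: t01 => *; lra.
  pose m := c * B^-1 * ((kappa F q p)^-1 * ((1 - t) ^+ q) `^ `|s|).
  have m0 : 0 < m by rewrite !mulr_gt0 ?invr_gt0 ?powR_gt0.
  apply: (@lt_le_trans _ _ (\int[leb]_(w in frob_ball w1 r) m%:E)%E).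
    rewrite integral_cst; last exact: measurable_frob_ball.
    by rewrite mule_gt0 ?lebesgue_ball_gt0.
  apply: ge0_integral_mono => [w _|w _|w /H[wn wt] _]; rewrite ?lee_fin ?(ltW m0)//.
    exact: G0.
  have [wb hw] := shrink_ball t01 wt; split=> //.
  have /andP[Bw _] := HB w (ball_contr wb).
  rewrite /m /m_density; apply: ler_pM.
  - by rewrite mulr_ge0 ?invr_ge0// ltW.
  - by rewrite mulr_ge0 ?powR_ge0// ltW.
  - by apply: ler_pM => //; [exact: ltW|rewrite invr_ge0 ltW|exact: Hc].
  - by rewrite ler_wpM2l ?(ltW k0')//; exact: powR_ge_norm.
pose M := eps * B * (kappa F q p)^-1.
have M0 : 0 <= M by rewrite !mulr_ge0// ltW.
apply: le_lt_trans (@hermdet_powR_integral R F q s M m_exponent_gt M0).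
apply: ge0_integral_mono => [w _|w _|w wb _]; rewrite ?lee_fin.
- exact: G0.
- by rewrite mulr_ge0 ?powR_ge0.
split=> //; have /andP[_ Bw] := HB w (ball_contr wb).
have /andP[I0 I1] := abelA_test_fun_bounds (Zmx X w).
rewrite /M /m_density mulrA ler_wpM2r ?powR_ge0// ler_wpM2r ?(ltW k0')//.
by apply: ler_pM; rewrite ?powR_ge0.
Qed.

End Inside.
End Support.

Unset Implicit Arguments.

Theorem theorem11 (R : realType) (F : scalar_kind) (q : nat) (hq : (1 <= q)%N)
  (dk : probability (mxF R F q) R) (hdk : normalized_haar dk)
  (p : R) (hp : 2 * q%:R - 1 < p) (X : 'rV[R]_q) :
  radon_support (fun f : 'rV[R]_q -> R => abel_dual dk p f X) = weyl_hull X.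
Proof.
apply/seteqP; split => h /= hX.
  apply: contrapT => Nh; apply: hX; exists (~` weyl_hull X) => //; split.
    by rewrite openC; exact: weyl_hull_closed.
  move=> f _ fX; apply: abel_dual_outside => y yX; apply/eqP.
  by apply: contraPT yX => fy; apply: fX; exact: subset_closure.
move=> [V [Vo T0] Vh]; have [eps eps0 epsV] := box_nbhs Vo Vh.
have := abel_dual_test_fun_gt0 hdk hp eps0 hX.
rewrite T0 ?ltxx//; first exact: test_fun_Cc.
by apply: subset_trans (@test_fun_support _ _ _ _ _) epsV.
Qed.
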